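(* For any nonsingular triangle tiling billiard trajectory $\delta$, at least one of the two graphs $G_0^\delta, G_1^\delta$ is a tree (say, $G_0^{\delta}$, after possibly exchanging the two colors). The trajectory $\delta$ is periodic if and only if $G_1^\delta$ has a unique cycle in it. The trajectory $\delta$ is not periodic if and only if both of the graphs $G_0^\delta$ and $G_1^\delta$ are trees.
   Context: A periodic triangle tiling is a tiling of the Euclidean plane by congruent triangles such that any two tiles sharing a side are centrally symmetric to each other with respect to the midpoint of that side. The triangle tiling billiard on it: a point moves along a straight line inside each tile; when it reaches an interior point of an edge it passes to the neighbouring tile across this edge, with refraction according to Snell's law with coefficient $-1$, i.e. the new direction vector keeps the component normal to the edge and reverses the component tangent to the edge. A trajectory is nonsingular if it meets no vertex, and periodic if it is a closed curve. $\Lambda_\Delta=(V,E)$ is the embedded graph of vertices and sides of the tiles. For a trajectory $\delta$ let $V(\delta)\subset V$ be the set of endpoints of edges $e\in E$ with $\delta\cap e\ne\emptyset$. A coloring $\mathcal{L}_\delta:V(\delta)\to\{0,1\}$ is defined step by step: choose an edge crossed by $\delta$ and give one endpoint $w_0$ the color $0$ and the other endpoint $b_0$ the color $1$ (arbitrarily). If $w_jb_j$ is a crossed edge with $w_j$ of color $0$ and $b_j$ of color $1$, the next edge $w_{j+1}b_{j+1}$ crossed by $\delta$ (going along $\delta$ in either direction) belongs to the same tile and shares exactly one endpoint with $w_jb_j$; this endpoint keeps its color and the other endpoint receives the other color, so that either $b_j=b_{j+1}$ or $w_j=w_{j+1}$, the segments $b_jb_{j+1}$ and $w_jw_{j+1}$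 are not crossed by $\delta$, and $b_jw_{j+1}$, $w_jb_{j+1}$ are crossed by $\delta$. For $k\in\{0,1\}$, $G_k^\delta$ is the subgraph of $\Lambda_\Delta$ with vertex set $\mathcal{L}_\delta^{-1}(k)$, two vertices being joined by an edge whenever they are joined by an edge of $\Lambda_\Delta$. *)

(* Defs.v *)
From HB Require Import structures.
From mathcomp Require Import all_boot all_order all_algebra.
From mathcomp Require Import all_classical all_reals.

Set Implicit Arguments.
Unset Strict Implicit.
Unset Printing Implicit Defensive.

Import Order.TTheory GRing.Theory Num.Theory.
Local Open Scope classical_set_scope.
Local Open Scope ring_scope.

Notation plane R := 'rV[R]_2.
Notation triangle R := ('I_3 -> 'rV[R]_2).

Section Geometry.
Variable R : realType.
Implicit Types (a b e p u v : plane R) (t : triangle R).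

Definition dot u v : R := (u *m v^T) 0 0.
Definition enorm u : R := Num.sqrt (dot u u).

Definition on_line a b (s : R) : plane R := a + s *: (b - a).
Definition segment a b : set (plane R) :=
  [set p | exists s : R, 0 <= s <= 1 /\ p = on_line a b s].
Definition open_segment a b : set (plane R) :=
  [set p | exists s : R, 0 < s < 1 /\ p = on_line a b s].

Definition nondegenerate t : Prop :=
  row_free (col_mx (t 1 - t 0) (t 2%:R - t 0)).
Definition region t : set (plane R) :=
  [set p | exists l : 'I_3 -> R,
     [/\ forall i, 0 <= l i, \sum_i l i = 1 & p = \sum_i l i *: t i]].
Definition inside t : set (plane R) :=
  [set p | exists l : 'I_3 -> R,
     [/\ forall i, 0 < l i, \sum_i l i = 1 & p = \sum_i l i *: t i]].

Definition congruent t t' : Prop :=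
  exists f : plane R -> plane R,
    (forall p q, enorm (f p - f q) = enorm (p - q)) /\
    f @` region t = region t'.

Definition side t a b : Prop := exists i j, [/\ i != j, a = t i & b = t j].

(* Keeps the component of [v] normal to [e], reverses the tangential one. *)
Definition refract e v : plane R := v - (2 * (dot v e / dot e e)) *: e.

Definition same_direction u v : Prop := exists c : R, 0 < c /\ u = c *: v.

End Geometry.

Section Tiling.
Variables (R : realType) (I : Type) (tri : I -> triangle R).

Definition shared_side (T T' : I) (a b : plane R) : Prop :=
  [/\ T <> T', side (tri T) a b & side (tri T') a b].

(* Tiles are indexed by [I], so that the order in which the vertices of a tile
   are listed is immaterial.  The penultimate clause says that the tiling is
   edge-to-edge; in the last one, [a + b - p] is the image of [p] under the
   central symmetry about the midpoint of the side [a b]. *)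
Definition periodic_triangle_tiling : Prop :=
  [/\ forall T, nondegenerate (tri T),
      forall T T', congruent (tri T) (tri T'),
      \bigcup_T region (tri T) = setT &
      forall T T', T <> T' -> inside (tri T) `&` inside (tri T') = set0] /\
  [/\ forall T a b, side (tri T) a b -> exists T', shared_side T T' a b &
      forall T T' a b, shared_side T T' a b ->
        region (tri T') = (fun p => a + b - p) @` region (tri T)].

Definition tiling_vertex : set (plane R) := [set v | exists T i, v = tri T i].
Definition tiling_edge (v w : plane R) : Prop := exists T, side (tri T) v w.

(* A nonsingular trajectory never stops, and is the biinfinite polygonal line
   through its successive crossing points: inside [tile_at i] it runs from
   [pt i] to [pt (i + 1)], where it passes to [tile_at (i + 1)].  It meets no
   vertex because the crossing points are interior to the edges. *)
Record trajectory := Trajectory {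
  tile_at : int -> I;
  pt : int -> plane R;
  traj_inside : forall i,
    open_segment (pt i) (pt (i + 1)) `<=` inside (tri (tile_at i));
  traj_refract : forall i, exists a b,
    [/\ shared_side (tile_at i) (tile_at (i + 1)) a b,
        open_segment a b (pt (i + 1)) &
        same_direction (pt (i + 2) - pt (i + 1))
                       (refract (b - a) (pt (i + 1) - pt i))]
}.

Definition curve (d : trajectory) : set (plane R) :=
  \bigcup_i segment (pt d i) (pt d (i + 1)).

Definition periodic (d : trajectory) : Prop :=
  exists n : nat, (0 < n)%N /\ forall i, pt d (i + n%:Z) = pt d i.

Definition traj_vertices (d : trajectory) : set (plane R) :=
  [set v | exists w, tiling_edge v w /\ segment v w `&` curve d !=set0].

(* [w j] and [b j] are the endpoints of the edge crossed at [pt d j].  Only the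
   values of [L] on [traj_vertices d] matter. *)
Definition traj_coloring (d : trajectory) (L : plane R -> bool) : Prop :=
  exists w b : int -> plane R,
  [/\ forall j, tiling_edge (w j) (b j) /\ open_segment (w j) (b j) (pt d j),
      forall j, (w (j + 1) = w j /\ b (j + 1) <> b j) \/
                (b (j + 1) = b j /\ w (j + 1) <> w j) &
      forall j, L (w j) = false /\ L (b j) = true].

End Tiling.

(* Possibly infinite simple graphs. *)
Record graph (T : eqType) := Graph { gvert : set T; gadj : rel T }.

Section Graph.
Variable T : eqType.
Implicit Types (G : graph T) (c : seq T).

Definition connected_graph G : Prop :=
  forall x y, gvert G x -> gvert G y ->
    exists p : seq T, path (gadj G) x p /\ last x p = y.

Definition graph_cycle G c : Prop :=
  (2 < size c)%N /\ ucycle (gadj G) c.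

Definition same_cycle c c' : Prop :=
  exists n, c' = rot n c \/ c' = rot n (rev c).

Definition has_unique_cycle G : Prop :=
  exists c, graph_cycle G c /\ forall c', graph_cycle G c' -> same_cycle c c'.

Definition is_tree G : Prop :=
  [/\ gvert G !=set0, connected_graph G & forall c, ~ graph_cycle G c].

Definition induced_subgraph G (A : set T) : graph T :=
  Graph (gvert G `&` A) (fun x y => [&& gadj G x y, `[< A x >] & `[< A y >]]).

End Graph.

Section ColorGraphs.
Variables (R : realType) (I : Type) (tri : I -> triangle R).

Definition tiling_graph : graph (plane R) :=
  Graph (tiling_vertex tri) (fun v w => `[< tiling_edge tri v w >]).

Definition color_graph (d : trajectory tri) (L : plane R -> bool) (k : bool) :
    graph (plane R) :=
  induced_subgraph tiling_graph [set v | traj_vertices d v /\ L v = k].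

End ColorGraphs.

(* Main.v *)
Require Import Defs.
From mathcomp Require Import all_boot all_order all_algebra.
From mathcomp Require Import all_classical all_reals trigo.
From mathcomp Require Import zify ring lra.
Require Import Defs.

Set Implicit Arguments.
Unset Strict Implicit.
Unset Printing Implicit Defensive.

(** Refraction with coefficient -1 makes it possible to fold the successive tiles
    onto triangles inscribed in one circle, so that the trajectory runs along a
    fixed chord. The tiles form a lattice, and the vertex [A0 + x1 u + x2 v] folds
    to the point of angle [t + x1 w1 + x2 w2], where [w1], [w2] and
    [w3 = 2 pi - w1 - w2] are the arcs cut out by a triangle. Its color tells on
    which side of the chord this point lies, that is, in which of two
    complementary arcs of lengths [W1] and [W0].

    The trajectory is periodic exactly when it meets finitely many tiles. In that
    case the sum modulo 2 of the boundaries of its tiles is a nonempty set of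
    monochromatic edges of even degrees, hence contains a cycle. Conversely, both
    the uniqueness of the cycle and the finiteness forced by a cycle are proved by
    descent. When every [wi] is smaller than [W1] and [W0], the color classes lift
    to connected slabs of Z^3 bounded by values of [n1 w1 + n2 w2 + n3 w3]; if [w1]
    is the smallest weight, the change of basis (e1, e2 - e1, e3 - e1) replaces
    (w1, w2, w3, W1, W0) by (w1, w2 - w1, w3 - w1, W1 - w1, W0 - w1) and shortens
    every cycle without destroying it. When some [wi] is not smaller than [W1] or
    [W0], the classes are so narrow that cycles are found by inspection. *)

(** * Cycles *)

(** No planar topology is used: the Jordan curve theorem is applied neither to the trajectory nor to
    a cycle. Two choices make the descent work. It acts on finite sets of edges with even degrees
    and not on cycles: contracting edges may pinch a simple cycle, whereas parity survives and even
    allows the contracted edges to be recovered. And it treats both classes at once, so that one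
    uniqueness statement about edge sets also shows that the two colors cannot both carry a cycle,
    since the two cycles would have the same edges. The weights are real numbers, so the repeated
    subtraction need not end by itself; the induction is on the number of edges of the chains that
    are compared. The lift to Z^3 turns an angle modulo 2 pi into an affine function, and the
    projection along (1, 1, 1) undoes it. *)

Section Cycles.
Variable T : eqType.
Implicit Types (h : rel T) (c s : seq T).

(** A path is prolonged at its head [x]: a neighbour other than the second vertex either is new or
    closes a cycle with an initial piece of the path. Since every vertex lies in [s], the first
    outcome cannot go on forever. *)
Lemma leafless_has_cycle h s x0 y0 :
  symmetric h -> irreflexive h -> (forall x y, h x y -> x \in s) ->
  (forall x y, h x y -> exists2 z, z != y & h x z) -> h x0 y0 ->
  exists c, (2 < size c)%N /\ ucycle h c.
Proof.
move=> hsym hirr hs hl h0; apply: contrapT => nocyc.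
suff long n : exists x p, [/\ size p = n.+1, path h x p & uniq (x :: p)].
  have [x [p [sp hp up]]] := long (size s).
  have sub : {subset x :: p <= s}.
    move=> y; rewrite inE => /orP[/eqP->|yp].
      by case: p sp hp up => // z p _ /= /andP[/hs].
    case/splitPr: yp hp {sp up} => p1 p2; rewrite cat_path /= => /and3P[_ + _].
    by rewrite hsym => /hs.
  by have := uniq_leq_size up sub; rewrite /= sp => /ltnW; rewrite ltnn.
elim: n => [|n [x [p [sp hp up]]]].
  exists x0, [:: y0]; split=> //=; first by rewrite h0.
  by rewrite !inE andbT; apply/negP => /eqP e; rewrite e hirr in h0.
case: p sp hp up => // y p [sp] hp up.
have hxy : h x y by case/andP: hp.
have [z zy hxz] := hl _ _ hxy.
have zx : z != x by apply/negP => /eqP e; rewrite e hirr in hxz.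
have [zp|zp] := boolP (z \in y :: p); last first.
  exists z, (x :: y :: p); split; rewrite /= ?sp //.
    by rewrite hsym hxz; case/andP: hp => ->.
  by rewrite inE negb_or zx zp.
rewrite inE (negPf zy) /= in zp.
case: nocyc; case/splitPr: zp hp up {sp} => p1 p2 hp up.
exists (x :: y :: rcons p1 z); split; first by rewrite /= size_rcons.
move: up hp; rewrite /ucycle /cycle -!rcons_cons -cat_rcons -!cat_cons cat_uniq.
move=> /and3P[-> _ _]; rewrite [path h x _]/= cat_path => /and3P[_ hp _].
by rewrite rcons_path /= hxy hp last_rcons hsym hxz.
Qed.

(** The undirected edges of the cyclic sequence [c]. They forget the starting point and the
    direction, which is what [same_cycle] ignores. *)
Definition cycle_edge c x y :=
  [&& x \in c, y \in c & (next c x == y) || (next c y == x)].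

Lemma next_neq_prev c x : uniq c -> (2 < size c)%N -> x \in c ->
  next c x != prev c x.
Proof.
move=> uc sc xc; have [i c' def] := rot_to xc.
have uc' : uniq (rot i c) by rewrite rot_uniq.
rewrite -(next_rot i uc) -(prev_rot i uc) def.
have sc' : (2 < size (rot i c))%N by rewrite size_rot.
rewrite {i xc}def in uc' sc'; case: c' uc' sc' => [|y [|z p]] // up _.
have n1 : next [:: x, y, z & p] x = y by rewrite /= eqxx.
apply/negP => /eqP /(congr1 (next [:: x, y, z & p])); rewrite next_prev // n1.
move: up; rewrite /= !inE !negb_or => /and3P[/and3P[xy xz _] _ _].
by rewrite ?[y == x]eq_sym ?(negPf xy) eqxx => e; rewrite e eqxx in xz.
Qed.

Lemma cycle_edgeE c x y : uniq c -> x \in c ->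
  cycle_edge c x y = (y == next c x) || (y == prev c x).
Proof.
move=> uc xc; rewrite /cycle_edge xc /= [next c x == y]eq_sym.
have [->|yx] /= := eqVneq y (next c x); first by rewrite mem_next xc.
apply/andP/eqP => [[yc /eqP <-]|->]; first by rewrite prev_next.
by rewrite mem_prev xc next_prev.
Qed.

Lemma cycle_edge_sym c : symmetric (cycle_edge c).
Proof. by move=> x y; rewrite /cycle_edge andbCA orbC. Qed.

Lemma cycle_edge_in c x y : cycle_edge c x y -> x \in c.
Proof. by case/and3P. Qed.

Lemma cycle_edge_next c x : x \in c -> cycle_edge c x (next c x).
Proof. by move=> xc; rewrite /cycle_edge mem_next xc eqxx. Qed.

Lemma cycle_edge_rel h c x y :
  symmetric h -> cycle h c -> cycle_edge c x y -> h x y.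
Proof.
move=> hsym hc /and3P[xc yc /orP[/eqP <-|/eqP <-]]; first exact: next_cycle.
by rewrite hsym; apply: next_cycle.
Qed.

(** A vertex has just two neighbours along a cycle, and one of them is where the traversal comes
    from; so once the first steps agree, all steps do. *)
Lemma eq_cycle_edge_next x0 p q : uniq (x0 :: p) -> uniq (x0 :: q) ->
  (2 < size (x0 :: p))%N ->
  cycle_edge (x0 :: p) =2 cycle_edge (x0 :: q) ->
  next (x0 :: p) x0 = next (x0 :: q) x0 -> p = q.
Proof.
set c := x0 :: p; set c' := x0 :: q => uc uc' sc e e0.
have mem : c =i c'.
  move=> x; apply/idP/idP => xc.
    by have := cycle_edge_next xc; rewrite e => /cycle_edge_in.
  by have := cycle_edge_next xc; rewrite -e => /cycle_edge_in.
have sz : size c = size c' by apply/eqP; rewrite -uniq_size_uniq ?uc' // => x; rewrite mem.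
have x0c : x0 \in c by rewrite mem_head.
have it k : iter k (next c) x0 = iter k (next c') x0 /\
            next c (iter k (next c) x0) = next c' (iter k (next c) x0).
  elim: k => [|k [IH1 IH2]] //; have IH3 : iter k.+1 (next c) x0 = iter k.+1 (next c') x0.
    by rewrite !iterS -IH1.
  split=> //; set b := iter k.+1 _ _; set a := iter k (next c) x0 in IH1 IH2.
  have ac : a \in c.
    by rewrite /a; elim: k {IH1 IH2 IH3 b a} => [|k IH] //; rewrite iterS mem_next.
  have defb : b = next c a by [].
  have bc : b \in c by rewrite defb mem_next.
  have := cycle_edge_next bc; rewrite e cycle_edgeE -?mem // => /orP[/eqP//|/eqP nb].
  have : next c b = a by rewrite nb defb IH2 prev_next.
  have /eqP := next_neq_prev uc sc bc; rewrite {2}defb prev_next //.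
(* A cyclic sequence without repetition is the orbit of its [next] function, so agreement of the
   iterates suffices. *)
have pt s : uniq (x0 :: s) -> s = traject (next (x0 :: s)) (next (x0 :: s) x0) (size s).
  move=> us; have := cycle_next us; rewrite /= rcons_path => /andP[/fpathP[n e1] _].
  have sn : size s = n by rewrite e1 size_traject.
  by rewrite sn -e1.
rewrite (pt p uc) (pt q uc') -/c -/c'.
have -> : size p = size q by move: sz; rewrite /c /c' /= => -[].
rewrite -[next c' x0]e0.
apply: (@eq_from_nth _ (next c x0)); rewrite !size_traject // => i il.
by rewrite !nth_traject // -iterSr e0 -iterSr; case: (it i.+1).
Qed.

(** Once [c'] is rotated to start at the head [x0] of [c], its first step goes to the successor or
    to the predecessor of [x0] in [c]; in the latter case [c] is reversed first. *)
Lemma eq_cycle_edge_rot c c' : uniq c -> uniq c' -> (2 < size c)%N ->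
  cycle_edge c =2 cycle_edge c' ->
  exists n, c' = rot n c \/ c' = rot n (rev c).
Proof.
move=> uc uc' sc e.
case: c uc sc e => // x0 p uc sc e; set c := x0 :: p in uc sc e *.
have x0c : x0 \in c by rewrite mem_head.
have x0c' : x0 \in c'.
  by have := cycle_edge_next x0c; rewrite e => /cycle_edge_in.
have [i q def] := rot_to x0c'.
have uq : uniq (x0 :: q) by rewrite -def rot_uniq.
have er : cycle_edge c =2 cycle_edge (x0 :: q).
  by move=> x y; rewrite e -def /cycle_edge !mem_rot !next_rot.
have rotE (s : seq T) : c' = rotr i s -> exists n, c' = rot n s by move=> ->; exists (size s - i).
have := cycle_edge_next x0c; rewrite er cycle_edgeE ?mem_head // => /orP[/eqP n0|/eqP n0].
  have pq : p = q by apply: (@eq_cycle_edge_next x0).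
  have [|n ->] := rotE c; first by rewrite /c pq -def rotK.
  by exists n; left.
have ur : uniq (x0 :: rev p) by move: uc; rewrite /= mem_rev rev_uniq.
have defr : rot (size p) (rev c) = x0 :: rev p.
  by rewrite /c rev_cons -cats1 -(size_rev p) rot_size_cat.
have err : cycle_edge (x0 :: rev p) =2 cycle_edge (x0 :: q).
  move=> x y; rewrite -er -defr /cycle_edge !mem_rot !mem_rev !next_rot ?rev_uniq //.
  congr [&& _, _ & _]; rewrite !next_rev // orbC.
  congr (_ || _); apply/eqP/eqP => <-; rewrite ?next_prev ?prev_next //.
have pq : rev p = q.
  apply: (@eq_cycle_edge_next x0) => //; first by move: sc; rewrite /= size_rev.
  rewrite -[X in next X]defr next_rot ?rev_uniq // next_rev //.
  have : cycle_edge c x0 (prev c x0) by rewrite cycle_edgeE // eqxx orbT.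
  rewrite er cycle_edgeE ?mem_head // => /orP[/eqP//|/eqP e1].
  by have := next_neq_prev uc sc x0c; rewrite e1 n0 eqxx.
have [|n defn] := rotE (rot (size p) (rev c)); first by rewrite defr pq -def rotK.
have [nl|nl] := leqP n (size (rev c)); last first.
  by exists (size p); right; rewrite defn rot_oversize // size_rot ltnW.
rewrite defn rot_add_mod ?size_rev ?leqnSn //; last by rewrite -(size_rev c).
by eexists; right.
Qed.

Lemma even_count_other (p : pred T) s y : uniq s -> odd (count p s) = false ->
  y \in s -> p y -> exists z, z <> y /\ p z.
Proof.
move=> us ev ys py; apply: contrapT => no.
suff e : count p s = count (pred1 y) s by move: ev; rewrite e count_uniq_mem // ys.
apply: eq_in_count => z _ /=; apply/idP/eqP => [pz|-> //].
by apply: contrapT => ne; apply: no; exists z.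
Qed.
End Cycles.

Import Order.TTheory GRing.Theory Num.Theory.
Local Open Scope ring_scope.

(** * Columns of the triangular lattice *)

Section Reach.
Variable T : Type.
Implicit Types (S : T -> Prop) (r : T -> T -> Prop).

Inductive reach S r x : T -> Prop :=
| reach_refl : reach S r x x
| reach_step y z : reach S r x y -> S z -> r y z -> reach S r x z.

Definition connected S r := forall x y, S x -> S y -> reach S r x y.

Lemma reach_trans S r x y z : reach S r x y -> reach S r y z -> reach S r x z.
Proof. by move=> xy; elim=> // u v _ xu Sv uv; apply: reach_step xu Sv uv. Qed.

Lemma reach_in S r x y : S x -> reach S r x y -> S y.
Proof. by move=> Sx; elim. Qed.
End Reach.

Lemma seq_argmax (T : eqType) (m : T -> int) (P : T -> Prop) (s : seq T) :
  (forall x, P x -> x \in s) -> (exists x, P x) ->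
  exists x, P x /\ forall y, P y -> m y <= m x.
Proof.
elim: s P => [|a s IH] P Ps [x0 Px0]; first by have := Ps _ Px0.
have [[y [Py ya]]|no] := pselect (exists y, P y /\ y <> a); last first.
  exists x0; split=> // y Py.
  have xa : x0 = a by apply: contrapT => ne; case: no; exists x0.
  suff -> : y = x0 by [].
  by rewrite xa; apply: contrapT => ne; case: no; exists y.
have [x [[Px xa] xmax]] : exists x, (P x /\ x <> a) /\ forall y, P y /\ y <> a -> m y <= m x.
  apply: (IH (fun z => P z /\ z <> a)); last by exists y.
  by move=> z [Pz za]; have := Ps _ Pz; rewrite inE => /orP[/eqP|].
have [le|gt] := lerP (m a) (m x).
  exists x; split=> // z Pz; have [->//|/eqP za] := eqVneq z a; exact: xmax.
have [Pa|nPa] := pselect (P a).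
  exists a; split=> // z Pz; have [->//|/eqP za] := eqVneq z a.
  by apply: le_trans (ltW gt); apply: xmax.
exists x; split=> // z Pz; apply: xmax; split=> // za; apply: nPa; by rewrite -za.
Qed.

Definition leafless (T : Type) (h : T -> T -> Prop) :=
  forall x y, h x y -> exists z, z <> y /\ h x z.

Section Columns.
Variables (T : eqType) (adj : T -> T -> Prop) (m s : T -> int).
Hypothesis adj_sym : forall x y, adj x y -> adj y x.
(** The triangular lattice seen along one of its three directions: [m] numbers the columns and [s]
    measures heights in half steps. *)
Hypothesis adj_pos : forall x y, adj x y ->
  ((m y = m x + 1 \/ m y = m x - 1) /\ (s y = s x + 1 \/ s y = s x - 1)) \/
  (m y = m x /\ (s y = s x + 2 \/ s y = s x - 2)).
Hypothesis pos_inj : forall x y, m x = m y -> s x = s y -> x = y.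

(** A connected set of this kind is a path that crosses the columns monotonically. *)
Definition staircase (B : T -> Prop) :=
  (forall x y, B x -> B y -> adj x y -> m x <> m y) /\
  (forall x y z, B x -> B y -> B z -> adj x y -> adj x z -> m y = m z -> y = z).

(** A vertex in the last column of the support has all its neighbours in the preceding column, where
    only one is available, so it is a leaf. *)
Lemma staircase_acyclic B h (l : seq T) : staircase B ->
  (forall x y, h x y -> [/\ B x, B y & adj x y]) ->
  (forall x y, h x y -> h y x) -> (forall x y, h x y -> x \in l) ->
  leafless h -> forall x y, ~ h x y.
Proof.
move=> [nv uni] hB hsym hl lf x0 y0 h0.
have [||x [[y hxy] xmax]] := @seq_argmax _ m (fun x => exists y, h x y) l.
- by move=> x [y]; apply: hl.
- by exists x0, y0.
have left z : h x z -> m z = m x - 1.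
  move=> hxz; have [Bx Bz a] := hB _ _ hxz.
  have zx := xmax z (ex_intro _ x (hsym _ _ hxz)).
  have := nv _ _ Bx Bz a; have := adj_pos a; lia.
have [z [zy hxz]] := lf _ _ hxy.
have [Bx By axy] := hB _ _ hxy; have [_ Bz axz] := hB _ _ hxz.
by apply: zy; apply: (uni x) => //; rewrite (left y) // (left z).
Qed.

Section Ring.
Variables (B E : T -> Prop).
Hypothesis Bstair : staircase B.
Hypothesis Bconn : connected B adj.
Hypothesis BE : forall x, B x -> E x -> False.
Hypothesis EB : forall w, E w -> exists b, B b /\ adj w b.

Fixpoint walk (d : int) k x y : Prop :=
  if k is k'.+1 then exists z, [/\ walk d k' x z, B y, adj z y & m y = m z + d]
  else x = y.

Lemma walk_in d k x y : B x -> walk d k x y -> B y.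
Proof. by case: k => [|k] Bx /= => [<-|[z []]]. Qed.

Lemma walk_m d k x y : walk d k x y -> m y = m x + d * k%:Z.
Proof.
elim: k y => [|k IH] y /=; first by move=> <-; rewrite mulr0 addr0.
by move=> [z [/IH e _ _ ->]]; rewrite e; lia.
Qed.

(** In a staircase a change of direction can only retrace the last step, and so cancels it. *)
Lemma reach_walk x y : B x -> B y -> exists k, walk 1 k x y \/ walk (-1) k x y.
Proof.
move=> Bx By; have := Bconn Bx By; elim => {y By} [|y z _ [k IH] Bz ayz].
  by exists 0%N; left.
have By : B y by case: IH; apply: walk_in.
suff step d : d = 1 \/ d = -1 -> walk d k x y ->
    exists k', walk d k' x z \/ walk (- d) k' x z.
  case: IH => /step; first by apply; left.
  by rewrite opprK => /(_ (or_intror erefl))[k' []]; exists k'; [right|left].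
move=> dE; have [nv uni] := Bstair.
have mz : m z = m y + d \/ m z = m y - d.
  have := nv _ _ By Bz ayz; have := adj_pos ayz; lia.
case: k IH => [_ /= xy|k _ /= [u [wu _ auy my]]].
  exists 1%N; case: mz => mz; [left|right]; by exists x; rewrite xy.
case: mz => mz.
  by exists k.+2; left; exists y; split=> //=; exists u.
exists k; left; suff -> : z = u by [].
by apply: (uni y) => //; [exact: walk_in wu | exact: adj_sym | lia].
Qed.

Lemma column_uniq x y : B x -> B y -> m x = m y -> x = y.
Proof.
move=> Bx By mxy; have [k wk] := reach_walk Bx By.
have k0 : k = 0%N by case: wk => /walk_m; lia.
by move: wk; rewrite k0 => -[].
Qed.

Lemma column_next x y : B x -> B y -> m y = m x + 1 -> adj x y.
Proof.
move=> Bx By mxy; have [k wk] := reach_walk Bx By.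
have k1 : k = 1%N by case: wk => /walk_m; lia.
move: wk; rewrite k1 /= => -[[z [<- _ a _]]|[z [<- _ _ e]]]; [exact: a | lia].
Qed.

Lemma column_between x y (c : int) : B x -> B y -> m x <= c <= m y ->
  exists z, B z /\ m z = c.
Proof.
move=> Bx By /andP[xc cy]; have [k wk] := reach_walk Bx By.
have {wk} [wk|le] : walk 1 k x y \/ m y <= m x.
- by case: wk => w; [left | right; have := walk_m w; lia].
- elim: k y By cy wk => [|k IH] y By cy /=.
    by move=> xy; exists x; split=> //; rewrite -xy in cy; lia.
  move=> [z [wz _ _ my]]; have [e|ne] := eqVneq c (m y); first by exists y.
  apply: (IH z (walk_in Bx wz) _ wz).
  by move/eqP in ne; lia.
- by exists x; split=> //; lia.
Qed.

(** The neighbour of [w] in [B] is [b] itself or adjacent to [b] on the path, so the heights of [w]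
    and [b] differ by 0 or 2, and disjointness excludes 0. *)
Lemma over_column w b : E w -> B b -> m w = m b ->
  s w = s b + 2 \/ s w = s b - 2.
Proof.
move=> Ew Bb mwb; have [c [Bc a]] := EB Ew.
have ne : s w <> s b by move=> swb; apply: (BE Bb); rewrite -(pos_inj mwb swb).
have := adj_pos a.
have [mcb|mcb] := eqVneq (m c) (m b).
  by rewrite (column_uniq Bc Bb mcb); lia.
have [mc1|mc1] := eqVneq (m c) (m b + 1).
  by have := adj_pos (column_next Bb Bc mc1); lia.
have [mc2|mc2] := eqVneq (m c) (m b - 1).
  have mbc : m b = m c + 1 by lia.
  by have := adj_pos (column_next Bc Bb mbc); lia.
by move: mcb mc1 mc2 => /eqP ? /eqP ? /eqP ?; lia.
Qed.

Lemma beside_column w : E w -> (forall b, B b -> m b <> m w) ->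
  exists b, [/\ B b, m w = m b + 1 \/ m w = m b - 1 & s w = s b + 1 \/ s w = s b - 1].
Proof.
move=> Ew no; have [c [Bc a]] := EB Ew; exists c; split=> //.
  by have := no _ Bc; have := adj_pos a; lia.
by have := no _ Bc; have := adj_pos a; lia.
Qed.

(** In a column met by the path [B], the points of [E] are just above and just below it, too far
    apart to be both adjacent to [w]. Beyond the ends of the path the last point of [B] gives
    similar bounds. *)
Lemma boundary_column w e f : E w -> E e -> E f -> adj w e -> adj w f ->
  m e = m f -> e = f.
Proof.
move=> Ew Ee Ef we wf mef; apply: pos_inj => //.
have pe := adj_pos we; have pf := adj_pos wf.
have [[b [Bb mb]]|nob] := pselect (exists b, B b /\ m b = m w).
  have sw := over_column Ew Bb (esym mb).
  have [mew|mew] := eqVneq (m e) (m w).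
    by have := over_column Ee Bb; lia.
  have [[b1 [Bb1 mb1]]|nob1] := pselect (exists b, B b /\ m b = m e).
    have := over_column Ee Bb1 (esym mb1).
    have mb1' : m f = m b1 by lia.
    have := over_column Ef Bb1 mb1'.
    have : s b1 = s b + 1 \/ s b1 = s b - 1.
      have [me1|me1] := eqVneq (m b1) (m b + 1).
        by have := adj_pos (column_next Bb Bb1 me1); lia.
      have me2 : m b = m b1 + 1 by move/eqP in mew; move/eqP in me1; lia.
      by have := adj_pos (column_next Bb1 Bb me2); lia.
    lia.
  have near x : E x -> m x = m e -> s x = s b + 1 \/ s x = s b - 1.
    move=> Ex mx; have [b' [Bb' mb' sb']] : exists b,
        [/\ B b, m x = m b + 1 \/ m x = m b - 1 & s x = s b + 1 \/ s x = s b - 1].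
      by apply: beside_column => // c Bc mc; apply: nob1; exists c; rewrite mc.
    have [mbb|mbb] := eqVneq (m b') (m b); first by rewrite -(column_uniq Bb' Bb mbb).
    case: nob1; move/eqP in mbb; move/eqP in mew.
    have [le|gt] := lerP (m b) (m b').
      by apply: (@column_between b b') => //; lia.
    by apply: (@column_between b' b) => //; lia.
  have := near _ Ee erefl; have := near _ Ef (esym mef); move/eqP in mew; lia.
have [b [Bb mb sb]] : exists b, [/\ B b, m w = m b + 1 \/ m w = m b - 1 & s w = s b + 1 \/ s w = s b - 1].
  by apply: beside_column => // c Bc mc; apply: nob; exists c.
have beyond c : B c -> (m w = m b + 1 -> m c < m w) /\ (m w = m b - 1 -> m w < m c).
  move=> Bc; split=> e1; rewrite ltNge; apply/negP => le; apply: nob.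
    by apply: (@column_between b c) => //; lia.
  by apply: (@column_between c b) => //; lia.
have [meb|meb] := eqVneq (m e) (m b).
  have := over_column Ee Bb meb; have mfb : m f = m b by lia.
  have := over_column Ef Bb mfb; lia.
have near x : E x -> adj w x -> m x = m e -> m x = m w /\ (s x = s b + 1 \/ s x = s b - 1).
  move=> Ex wx mx; move/eqP in meb; have px := adj_pos wx.
  have [b' [Bb' mb' sb']] : exists b,
        [/\ B b, m x = m b + 1 \/ m x = m b - 1 & s x = s b + 1 \/ s x = s b - 1].
    apply: beside_column => // c Bc mc; have := beyond _ Bc.
    lia.
  have mbb : m b' = m b by have := beyond _ Bb'; lia.
  by move: mb' sb'; rewrite (column_uniq Bb' Bb mbb); lia.
have := near _ Ee we erefl; have := near _ Ef wf (esym mef); lia.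
Qed.

(** Together with [boundary_column], this leaves [w] at most two neighbours inside [E]. *)
Lemma boundary_two_columns w : E w -> exists c1 c2,
  forall e, E e -> adj w e -> m e = c1 \/ m e = c2.
Proof.
move=> Ew.
have [[b [Bb mb]]|nob] := pselect (exists b, B b /\ m b = m w).
  exists (m w + 1), (m w - 1) => e Ee we.
  have := adj_pos we; have := over_column Ew Bb (esym mb); have := over_column Ee Bb; lia.
have [b [Bb mb sb]] : exists b, [/\ B b, m w = m b + 1 \/ m w = m b - 1 & s w = s b + 1 \/ s w = s b - 1].
  by apply: beside_column => // c Bc mc; apply: nob; exists c.
exists (m b), (m w) => e Ee we; apply: contrapT => ne.
have pe := adj_pos we.
have beyond c : B c -> (m w = m b + 1 -> m c < m w) /\ (m w = m b - 1 -> m w < m c).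
  move=> Bc; split=> e1; rewrite ltNge; apply/negP => le; apply: nob.
    by apply: (@column_between b c) => //; lia.
  by apply: (@column_between c b) => //; lia.
have [c [Bc ec]] := EB Ee; have pc := adj_pos ec; have bc := beyond _ Bc.
lia.
Qed.

(** A point of [E] has at most two neighbours in [E]. A leafless [h] uses two at each point that it
    visits, hence all of them, and so spreads over the connected set [E]. *)
Lemma ring_full h (l : seq T) x0 y0 : connected E adj ->
  (forall x y, h x y -> [/\ E x, E y & adj x y]) ->
  (forall x y, h x y -> h y x) -> (forall x y, h x y -> x \in l) ->
  leafless h -> h x0 y0 ->
  (forall x, E x -> x \in l) /\ forall x y, E x -> E y -> adj x y -> h x y.
Proof.
move=> Econn hE hsym hl lf h0.
have full w x y : h w x -> E y -> adj w y -> h w y.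
  move=> hwx Ey wy; have [Ew Ex wx] := hE _ _ hwx.
  have [z [zx hwz]] := lf _ _ hwx; have [_ Ez wz] := hE _ _ hwz.
  have [<-//|/eqP xy] := eqVneq x y; have [<-//|/eqP zy] := eqVneq z y.
  have [c1 [c2 two]] := boundary_two_columns Ew.
  have uni u v := @boundary_column w u v Ew.
  have cx := two _ Ex wx; have cy := two _ Ey wy; have cz := two _ Ez wz.
  have : [\/ m x = m y, m z = m y | m z = m x].
    by case: cx cy cz => -> [] -> [] ->; (try by constructor 1);
       (try by constructor 2); by constructor 3.
  case=> e.
  - by case: xy; apply: uni.
  - by case: zy; apply: uni.
  - by case: zx; apply: uni.
have [Ex0 _ _] := hE _ _ h0.
have supp x : E x -> exists y, h x y.
  move=> Ex; have := Econn _ _ Ex0 Ex; elim=> [|u v _ [y hy] Ev uv]; first by exists y0.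
  by exists u; apply: hsym; apply: full hy Ev uv.
split=> [x Ex|x y Ex Ey xy]; first by have [y] := supp x Ex; apply: hl.
by have [z hz] := supp x Ex; apply: full hz Ey xy.
Qed.
End Ring.
End Columns.

(** * Winding numbers of phases, and the base cases of the descent *)

Lemma winding_bound (R : realFieldType) (w S : R) (k : int) :
  0 < S -> 0 <= w -> w <= S -> - S < w + k%:~R * S -> w + k%:~R * S < S ->
  k = 0 \/ k = -1.
Proof.
move=> S0 w0 wS lo hi.
have k1 : k < 1.
  rewrite ltNge; apply/negP => k1; have : (1 : R) <= k%:~R by rewrite -[1]/(1%:~R) ler_int.
  nra.
have k2 : -2 < k.
  rewrite ltNge; apply/negP => k2; have : k%:~R <= (-2 : R) by rewrite -[-2 : R]/((-2)%:~R) ler_int.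
  nra.
lia.
Qed.

(** The length [L] of the window is at most [S - w], so a step by [w] combined with a turn back
    would leave it; a turn forward is even longer. *)
Lemma winding0 (R : realFieldType) (S L w w3 c t : R) (a b : int) :
  0 < S -> 0 <= w -> w <= S -> L <= w3 -> w3 <= S - w ->
  c <= t + a%:~R * S < c + L -> c <= t + w + b%:~R * S < c + L -> a = b.
Proof.
move=> S0 w_ge0 wS Lw ww /andP[lo hi] /andP[lo' hi'].
have bnd : - L < w + (b - a)%:~R * S /\ w + (b - a)%:~R * S < L.
  by rewrite rmorphB mulrBl; split; lra.
have [||k0|k0] := @winding_bound R w S (b - a) S0 w_ge0 wS; [lra | lra | |].
  by move: k0; clear; lia.
by move: bnd; rewrite k0 (_ : (-1)%:~R = -1 :> R) // mulN1r => -[lo1 _]; exfalso; lra.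
Qed.

(** Adding a turn to the step would make the net change [w3], which is at least the length of the
    window. *)
Lemma winding3 (R : realFieldType) (S L w3 c t : R) (a b : int) :
  0 < S -> 0 <= w3 -> w3 <= S -> L <= w3 ->
  c <= t + a%:~R * S < c + L -> c <= t - (S - w3) + b%:~R * S < c + L -> a = b.
Proof.
move=> S0 w_ge0 wS Lw /andP[lo hi] /andP[lo' hi'].
have bnd : - L < w3 + (b - a - 1)%:~R * S /\ w3 + (b - a - 1)%:~R * S < L.
  by rewrite !rmorphB !mulrBl mul1r; split; lra.
have [||k0|k0] := @winding_bound R w3 S (b - a - 1) S0 w_ge0 wS; [lra | lra | |].
  by move: bnd; rewrite k0 mul0r => -[_ hi1]; exfalso; lra.
by move: k0; clear; lia.
Qed.

Lemma winding_pos (R : realFieldType) (S u t : R) (a b : int) :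
  0 <= u -> u <= S -> 0 < t + u + b%:~R * S - (t + a%:~R * S) ->
  t + u + b%:~R * S - (t + a%:~R * S) < S -> a = b.
Proof.
move=> u0 uS lo hi; have S0 : 0 < S by lra.
have k1 : b - a < 1.
  rewrite ltNge; apply/negP => k1.
  have : (1 : R) <= (b - a)%:~R by rewrite -[1]/(1%:~R) ler_int.
  by rewrite rmorphB; nra.
have k2 : -1 < b - a.
  rewrite ltNge; apply/negP => k2.
  have : (b - a)%:~R <= (-1 : R) by rewrite -[-1 : R]/((-1)%:~R) ler_int.
  by rewrite rmorphB; nra.
by move: k1 k2; clear; lia.
Qed.

Lemma narrow_window (R : realFieldType) (t X c w : R) :
  c <= t + X -> t + w + X < c + w -> False.
Proof. lra. Qed.

(** A weak substitute for a monochromatic cycle, strong enough for the base cases. *)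
Definition mono_core (T : eqType) (adj : T -> T -> Prop) (B E : T -> Prop)
    (h : T -> T -> Prop) : Prop :=
  [/\ forall x y, h x y -> h y x,
      forall x y, h x y -> adj x y /\ ((B x /\ B y) \/ (E x /\ E y)),
      leafless h,
      exists l : seq T, forall x y, h x y -> x \in l &
      exists x y, h x y].

(* The second conclusion is what makes a cycle incompatible with a trajectory
   that is not periodic. *)
Definition unicyclic (T : eqType) (adj : T -> T -> Prop) (B E : T -> Prop) :=
  forall h1 h2, mono_core adj B E h1 -> mono_core adj B E h2 ->
    (forall x y, h1 x y <-> h2 x y) /\
    exists l : seq T, forall x, B x \/ E x -> x \in l.

Lemma mono_coreC (T : eqType) (adj : T -> T -> Prop) B E h :
  mono_core adj B E h -> mono_core adj E B h.
Proof.
by case=> ? hm ? ? ?; split=> // x y /hm[? [?|?]]; split=> //; [right|left].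
Qed.

Lemma unicyclic_sym (T : eqType) (adj : T -> T -> Prop) B E :
  unicyclic adj B E -> unicyclic adj E B.
Proof.
move=> u h1 h2 /mono_coreC m1 /mono_coreC m2; have [e [l hl]] := u _ _ m1 m2.
by split=> //; exists l => x [?|?]; apply: hl; [right|left].
Qed.

Section Unicyclic.
Variables (T : eqType) (adj : T -> T -> Prop) (m s : T -> int).
Hypothesis adj_sym : forall x y, adj x y -> adj y x.
Hypothesis adj_pos : forall x y, adj x y ->
  ((m y = m x + 1 \/ m y = m x - 1) /\ (s y = s x + 1 \/ s y = s x - 1)) \/
  (m y = m x /\ (s y = s x + 2 \/ s y = s x - 2)).
Hypothesis pos_inj : forall x y, m x = m y -> s x = s y -> x = y.
Variable nbrs : T -> seq T.
Hypothesis nbrsP : forall x y, adj x y -> y \in nbrs x.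

Lemma mono_core_staircase (B E : T -> Prop) h x y : (forall z, B z -> E z -> False) ->
  mono_core adj B E h -> staircase adj m B -> B x -> ~ h x y.
Proof.
move=> BE [hsym hm lf [l hl] _] st Bx.
have hB u v : h u v -> B u -> B v.
  by move=> /hm[_ [[]//|[Eu _]]] Bu; case: (BE _ Bu Eu).
move=> hxy; apply: (@staircase_acyclic _ adj m s adj_pos B (fun u v => h u v /\ B u) l st) (conj hxy Bx).
- by move=> u v [huv Bu]; split=> //; [exact: hB Bu | case: (hm _ _ huv)].
- by move=> u v [huv Bu]; split; [exact: hsym | exact: hB Bu].
- by move=> u v [/hl].
- by move=> u v [huv Bu]; have [z [zv huz]] := lf _ _ huv; exists z.
Qed.

Variables (B E : T -> Prop).
Hypothesis BE : forall x, B x -> E x -> False.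

(** Neither class carries a core, so the claim is vacuous. *)
Lemma unicyclic_staircase2 : staircase adj m B -> staircase adj m E ->
  unicyclic adj B E.
Proof.
move=> sB sE h1 h2 m1 _; have [_ hm _ _ [x [y hxy]]] := m1.
case: (hm _ _ hxy) => _ [[Bx _]|[Ex _]].
  by case: (mono_core_staircase BE m1 sB Bx hxy).
have EB x' : E x' -> B x' -> False by move=> Ex' /BE; apply.
by case: (mono_core_staircase EB (mono_coreC m1) sE Ex hxy).
Qed.

(** A core must lie in [E], where [ring_full] makes it the set of all edges. Finiteness of [B]
    follows, as each of its points has a neighbour in [E]. *)
Lemma unicyclic_ring : staircase adj m B -> connected B adj -> connected E adj ->
  (forall w, E w -> exists b, B b /\ adj w b) ->
  (forall b, B b -> exists w, E w /\ adj b w) -> unicyclic adj B E.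
Proof.
move=> sB cB cE EB Bl h1 h2 m1 m2.
have full h : mono_core adj B E h -> exists l : seq T,
  [/\ forall x, E x -> x \in l, forall x y, E x -> E y -> adj x y -> h x y &
      forall x y, h x y -> [/\ E x, E y & adj x y]].
  move=> mh; have [hsym hm lf [l hl] [x [y hxy]]] := mh.
  have hE u v : h u v -> [/\ E u, E v & adj u v].
    move=> huv; have [a [[Bu _]|[Eu Ev]]] := hm _ _ huv; last by [].
    by case: (mono_core_staircase BE mh sB Bu huv).
  exists l.
  by have [] := @ring_full _ adj m s adj_sym adj_pos pos_inj B E sB cB BE EB h l x y cE hE hsym hl lf hxy.
have [l [El f1 s1]] := full _ m1; have [_ [_ f2 s2]] := full _ m2.
split=> [x y|]; first by split=> [/s1|/s2] [? ? ?]; [apply: f2|apply: f1].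
exists (l ++ flatten [seq nbrs x | x <- l]) => x; rewrite mem_cat => -[Bx|Ex].
  have [w [Ew a]] := Bl _ Bx; apply/orP; right.
  apply/flatten_mapP; exists w; first exact: El.
  by apply: nbrsP; apply: adj_sym.
by rewrite El.
Qed.

Section Base.
Variables (R : realFieldType) (w1 w2 w3 S W1 W0 : R) (th : T -> R).
Variables st1 st2 st3 : T -> T -> Prop.
Hypothesis defS : S = w1 + w2 + w3.
Hypothesis adj_st : forall x y, adj x y ->
  [\/ st1 x y, st2 x y | st3 x y] \/ [\/ st1 y x, st2 y x | st3 y x].
Hypothesis st1P : forall x y, st1 x y ->
  [/\ m y = m x + 1, s y = s x + 1 & th y = th x + w1].
Hypothesis st2P : forall x y, st2 x y ->
  [/\ m y = m x - 1, s y = s x + 1 & th y = th x + w2].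
(** The third direction is minus the sum of the other two; its change of phase is [w3] minus a full
    turn [S]. *)
Hypothesis st3P : forall x y, st3 x y ->
  [/\ m y = m x, s y = s x - 2 & th y = th x - (w1 + w2)].
Hypotheses (w1_ge0 : 0 <= w1) (w2_ge0 : 0 <= w2) (w3_ge0 : 0 <= w3).
Hypotheses (W1_gt0 : 0 < W1) (W0_gt0 : 0 < W0) (W10 : W1 + W0 = S).
Hypothesis Bwin : forall x, B x -> exists n : int, 0 <= th x + n%:~R * S < W1.
Hypothesis Ewin : forall x, E x -> exists n : int, W1 <= th x + n%:~R * S < S.
Hypotheses (cB : connected B adj) (cE : connected E adj).
Hypothesis EB : forall w, E w -> exists b, B b /\ adj w b.
Hypothesis Bl : forall b, B b -> exists w, E w /\ adj b w.

Let S0 : 0 < S. Proof. by rewrite -W10 addr_gt0. Qed.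

Lemma adj_th x y : adj x y ->
  [\/ m y = m x + 1 /\ ((s y = s x + 1 /\ th y = th x + w1) \/
                        (s y = s x - 1 /\ th y = th x - w2)),
      m y = m x - 1 /\ ((s y = s x - 1 /\ th y = th x - w1) \/
                        (s y = s x + 1 /\ th y = th x + w2)) |
      m y = m x /\ (th y = th x - (w1 + w2) \/ th y = th x + (w1 + w2))].
Proof.
move=> xy; case: (adj_st xy) => -[] => [/st1P|/st2P|/st3P|/st1P|/st2P|/st3P] [mE sE tE].
- by constructor 1; split=> //; left.
- by constructor 2; split=> //; right.
- by constructor 3; split=> //; left.
- constructor 2; split; first by rewrite mE addrK.
  by left; rewrite sE tE !addrK.
- constructor 1; split; first by rewrite mE subrK.
  by right; rewrite sE tE !addrK.
- constructor 3; split; first by rewrite mE.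
  by right; rewrite tE subrK.
Qed.

(** A vertical edge changes the phase by [w1 + w2], and so does the passage between two neighbours
    of a point that share an adjacent column; neither fits into the half-open window. *)
Lemma narrow_staircase (P : T -> Prop) (n : int) (c : R) :
  (forall x, P x -> c <= th x + n%:~R * S < c + (w1 + w2)) -> staircase adj m P.
Proof.
move: (n%:~R * S) => X win.
have opp a b : P a -> P b -> th a = th b + (w1 + w2) -> False.
  by move=> /win/andP[_ a2] /win/andP[b1 _] e; rewrite e in a2; apply: narrow_window b1 a2.
split=> [x y Px Py axy mxy|x y z Px Py Pz axy axz myz].
  case: (adj_th axy) => -[my]; [by move: my mxy; clear; lia | by move: my mxy; clear; lia |].
  by case=> ty; [apply: (opp x y) => //; rewrite ty subrK | apply: (opp y x)].
have eqp : s y = s z -> y = z by apply: pos_inj.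
case: (adj_th axy) => -[my]; case: (adj_th axz) => -[mz];
  try by move: my mz myz; clear; lia.
- case=> -[sz tz]; case=> -[sy ty]; try by apply: eqp; rewrite sy sz.
    by case: (opp z y) => //; rewrite ty tz; ring.
  by case: (opp y z) => //; rewrite ty tz; ring.
- case=> -[sz tz]; case=> -[sy ty]; try by apply: eqp; rewrite sy sz.
    by case: (opp y z) => //; rewrite ty tz; ring.
  by case: (opp z y) => //; rewrite ty tz; ring.
- by move=> _ [] ty; [case: (opp x y) => //; rewrite ty subrK | case: (opp y x)].
Qed.

Lemma lift_step (c L : R) x y (a b : int) : L <= w3 -> adj x y ->
  c <= th x + a%:~R * S < c + L -> c <= th y + b%:~R * S < c + L -> a = b.
Proof.
move=> Lw xy wx wy.
have S0' := S0; have [p1 p2 p3 pS] := And4 w1_ge0 w2_ge0 w3_ge0 defS.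
have e1 : w1 <= S by lra.
have e2 : w2 <= S by lra.
have d0 : w3 <= S by lra.
have d1 : w3 <= S - w1 by lra.
have d2 : w3 <= S - w2 by lra.
have d3 : w1 + w2 = S - w3 by lra.
case: (adj_st xy) => -[] => [/st1P|/st2P|/st3P|/st1P|/st2P|/st3P] [_ _ e];
  rewrite e ?d3 in wx wy.
- exact: (winding0 S0 p1 e1 Lw d1 wx wy).
- exact: (winding0 S0 p2 e2 Lw d2 wx wy).
- exact: (winding3 S0 p3 d0 Lw wx wy).
- exact/esym/(winding0 S0 p1 e1 Lw d1 wy wx).
- exact/esym/(winding0 S0 p2 e2 Lw d2 wy wx).
- exact/esym/(winding3 S0 p3 d0 Lw wy wx).
Qed.

Lemma const_lift (P : T -> Prop) (c L : R) : L <= w3 -> connected P adj ->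
  (forall x, P x -> exists n : int, c <= th x + n%:~R * S < c + L) ->
  exists n : int, forall x, P x -> c <= th x + n%:~R * S < c + L.
Proof.
move=> Lw cP win.
have [[x0 Px0]|no] := pselect (exists x, P x); last by exists 0 => x Px; case: no; exists x.
have [n wn] := win _ Px0; exists n => x Px.
elim: (cP _ _ Px0 Px) => // y z xy wy Pz yz.
by have [n' wz] := win _ Pz; rewrite (lift_step Lw yz wy wz).
Qed.

(* The lift of the angle is constant on a color class whose arc is no longer
   than [w3]. So either [B] is a path, and [E] a ring around it, or both classes
   lie in strips of width [w1 + w2], which are too narrow for a cycle. *)
Lemma unicyclic_base : W1 <= w3 -> unicyclic adj B E.
Proof.
move=> W1w3.
have S0' := S0; have [p1 p2 p3 pS] := And4 w1_ge0 w2_ge0 w3_ge0 defS.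
have [q1 q0 q10] := And3 W1_gt0 W0_gt0 W10.
have winB x : B x -> exists n : int, 0 <= th x + n%:~R * S < 0 + W1.
  by rewrite add0r; apply: Bwin.
have [nB wB] := const_lift W1w3 cB winB; rewrite add0r in wB.
have [path|strip] := lerP W1 (w1 + w2).
  apply: unicyclic_ring => //; apply: (@narrow_staircase B nB 0) => x Bx.
  by have := wB _ Bx; rewrite add0r; lra.
have W0w3 : W0 <= w3 by lra.
have winE x : E x -> exists n : int, W1 <= th x + n%:~R * S < W1 + W0.
  by rewrite W10; apply: Ewin.
have [nE wE] := const_lift W0w3 cE winE; rewrite W10 in wE.
have [e1 e2] : w1 <= S /\ w2 <= S by split; lra.
have e12 : w1 + w2 <= S by lra.
(* An edge between the classes leaves the window of [B] either through its top, with equal winding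
   numbers, or through its bottom, the window of [E] being then seen one turn lower. *)
pose up b w := nE = nB /\ th w + nE%:~R * S <= th b + nB%:~R * S + (w1 + w2).
pose dn b w := nE = nB + 1 /\ th b + nB%:~R * S + S <= th w + nE%:~R * S + (w1 + w2).
have link b w : B b -> E w -> adj b w -> up b w \/ dn b w.
  move=> Bb Ew bw; have bB := wB _ Bb; have bE := wE _ Ew.
  have isup u : 0 <= u -> u <= w1 + w2 -> th w = th b + u -> up b w.
    move=> u0 u12 e; rewrite /up; have ab : nB = nE.
      apply: (@winding_pos R S u (th b)) => //; [lra | |]; rewrite -e; lra.
    by rewrite -ab e; split=> //; lra.
  have isdn u : 0 <= u -> u <= w1 + w2 -> th b = th w + u -> dn b w.
    move=> u0 u12 e; rewrite /dn; have ab : nE = nB + 1.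
      apply: (@winding_pos R S u (th w)) => //; first by lra.
        by rewrite -e rmorphD mulrDl mul1r; lra.
      by rewrite -e rmorphD mulrDl mul1r; lra.
    by rewrite ab rmorphD mulrDl mul1r e; split=> //; lra.
  case: (adj_st bw) => -[] => [/st1P|/st2P|/st3P|/st1P|/st2P|/st3P] [_ _ e].
  - by left; apply: (isup w1) => //; lra.
  - by left; apply: (isup w2) => //; lra.
  - by right; apply: (isdn (w1 + w2)) => //; lra.
  - by right; apply: (isdn w1) => //; lra.
  - by right; apply: (isdn w2) => //; lra.
  - by left; apply: (isup (w1 + w2)) => //; lra.
(* The winding numbers are constant, so all edges between the classes are of the same kind. As every
   point has a neighbour in the other class, each class is confined to a strip of width [w1 + w2]
   along one end of its window. *)
have [eqn|neqn] := eqVneq nE nB.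
  apply: unicyclic_staircase2.
    apply: (@narrow_staircase B nB (W1 - (w1 + w2))) => x Bx.
    have [w [Ew xw]] := Bl Bx; have := wE _ Ew; have := wB _ Bx.
    case: (link _ _ Bx Ew xw) => -[]; first by lra.
    by rewrite eqn => /eqP; rewrite -subr_eq0 opprD addNKr.
  apply: (@narrow_staircase E nE W1) => x Ex.
  have [b [Bb xb]] := EB Ex; have := wB _ Bb; have := wE _ Ex.
  case: (link _ _ Bb Ex (adj_sym xb)) => -[]; first by lra.
  by rewrite eqn => /eqP; rewrite -subr_eq0 opprD addNKr.
apply: unicyclic_staircase2.
  apply: (@narrow_staircase B nB 0) => x Bx.
  have [w [Ew xw]] := Bl Bx; have := wE _ Ew; have := wB _ Bx.
  by case: (link _ _ Bx Ew xw) => -[]; [move=> e; rewrite e eqxx in neqn | lra].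
apply: (@narrow_staircase E nE (S - (w1 + w2))) => x Ex.
have [b [Bb xb]] := EB Ex; have := wB _ Bb; have := wE _ Ex.
by case: (link _ _ Bb Ex (adj_sym xb)) => -[]; [move=> e; rewrite e eqxx in neqn | lra].
Qed.
End Base.
End Unicyclic.

(** * Color classes as windows of phases *)

Notation Z2 := (int * int)%type.

Definition hexadj (x y : Z2) : bool :=
  [|| (y.1 == x.1 + 1) && (y.2 == x.2), (y.1 == x.1 - 1) && (y.2 == x.2),
      (y.1 == x.1) && (y.2 == x.2 + 1), (y.1 == x.1) && (y.2 == x.2 - 1),
      (y.1 == x.1 - 1) && (y.2 == x.2 - 1) |
      (y.1 == x.1 + 1) && (y.2 == x.2 + 1)].

Lemma hexadj_sym x y : hexadj x y -> hexadj y x.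
Proof. rewrite /hexadj; lia. Qed.

Lemma Z2_eq (x y : Z2) : x.1 = y.1 -> x.2 = y.2 -> x = y.
Proof. by case: x y => [? ?] [? ?] /= -> ->. Qed.

Definition hex_nbrs (x : Z2) : seq Z2 :=
  [:: (x.1 + 1, x.2); (x.1 - 1, x.2); (x.1, x.2 + 1); (x.1, x.2 - 1);
      (x.1 - 1, x.2 - 1); (x.1 + 1, x.2 + 1)].

Lemma mem_hex_nbrs x y : hexadj x y -> y \in hex_nbrs x.
Proof. by case: x y => [a b] [c d]; rewrite /hexadj /hex_nbrs !inE !xpair_eqE. Qed.

(** This lemma and the two that follow give the columns along the first, second and third direction
    of the lattice. *)
Lemma hexadj_pos1 (x y : Z2) : hexadj x y ->
  ((y.2 = x.2 + 1 \/ y.2 = x.2 - 1) /\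
   ((y.2 - 2 * y.1) = (x.2 - 2 * x.1) + 1 \/ (y.2 - 2 * y.1) = (x.2 - 2 * x.1) - 1)) \/
  (y.2 = x.2 /\ ((y.2 - 2 * y.1) = (x.2 - 2 * x.1) + 2 \/ (y.2 - 2 * y.1) = (x.2 - 2 * x.1) - 2)).
Proof. by case: x y => [? ?] [? ?]; rewrite /hexadj /=; lia. Qed.

Lemma hexadj_pos2 (x y : Z2) : hexadj x y ->
  (((- y.1) = (- x.1) + 1 \/ (- y.1) = (- x.1) - 1) /\
   ((y.1 - 2 * y.2) = (x.1 - 2 * x.2) + 1 \/ (y.1 - 2 * y.2) = (x.1 - 2 * x.2) - 1)) \/
  ((- y.1) = (- x.1) /\ ((y.1 - 2 * y.2) = (x.1 - 2 * x.2) + 2 \/ (y.1 - 2 * y.2) = (x.1 - 2 * x.2) - 2)).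
Proof. by case: x y => [? ?] [? ?]; rewrite /hexadj /=; lia. Qed.

Lemma hexadj_pos3 (x y : Z2) : hexadj x y ->
  (((y.1 - y.2) = (x.1 - x.2) + 1 \/ (y.1 - y.2) = (x.1 - x.2) - 1) /\
   ((y.1 + y.2) = (x.1 + x.2) + 1 \/ (y.1 + y.2) = (x.1 + x.2) - 1)) \/
  ((y.1 - y.2) = (x.1 - x.2) /\ ((y.1 + y.2) = (x.1 + x.2) + 2 \/ (y.1 + y.2) = (x.1 + x.2) - 2)).
Proof. by case: x y => [? ?] [? ?]; rewrite /hexadj /=; lia. Qed.

Lemma hexadj_cases (x y : Z2) : hexadj x y ->
  let st1 (u v : Z2) := (v.1 == u.1 + 1) && (v.2 == u.2) in
  let st2 (u v : Z2) := (v.1 == u.1) && (v.2 == u.2 + 1) in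
  let st3 (u v : Z2) := (v.1 == u.1 - 1) && (v.2 == u.2 - 1) in
  [\/ st1 x y, st2 x y | st3 x y] \/ [\/ st1 y x, st2 y x | st3 y x].
Proof.
case: x y => [a b] [c d]; rewrite /hexadj /= => /or4P[->|h|->|/or3P[h|->|h]].
- by left; constructor 1.
- by right; constructor 1; lia.
- by left; constructor 2.
- by right; constructor 2; lia.
- by left; constructor 3.
- by right; constructor 3; lia.
Qed.

Section HexConfiguration.
Variable R : realFieldType.

(* [B] and [E] are two color classes: the lattice point [x] folds to the point of
   angle [t + x.1 w1 + x.2 w2] of a circle of length [S], on one or the other of
   the two arcs, of lengths [W1] and [W0], cut by the trajectory. *)
Record hexcfg (w1 w2 w3 S W1 W0 t : R) (B E : Z2 -> Prop) : Prop := HexCfg {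
  hc_ge0 : [/\ 0 <= w1, 0 <= w2 & 0 <= w3];
  hc_gt0 : 0 < W1 /\ 0 < W0;
  hc_sum : S = w1 + w2 + w3 /\ W1 + W0 = S;
  hc_B : forall x, B x -> exists n : int,
    0 <= t + x.1%:~R * w1 + x.2%:~R * w2 + n%:~R * S < W1;
  hc_E : forall x, E x -> exists n : int,
    W1 <= t + x.1%:~R * w1 + x.2%:~R * w2 + n%:~R * S < S;
  hc_connB : connected B hexadj;
  hc_connE : connected E hexadj;
  hc_BE : forall b, B b -> exists w, E w /\ hexadj b w;
  hc_EB : forall w, E w -> exists b, B b /\ hexadj w b }.

(** Angles are measured from the point where the arc of [E] begins. *)
Lemma hexcfg_swap w1 w2 w3 S W1 W0 t B E : hexcfg w1 w2 w3 S W1 W0 t B E ->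
  hexcfg w1 w2 w3 S W0 W1 (t - W1) E B.
Proof.
case=> h0 [g1 g0] [defS sumW] hB hE cB cE BE EB; split=> //.
- by split=> //; rewrite addrC.
- by move=> x /hE[n hn]; exists n; lra.
- move=> x /hB[n hn]; exists (n + 1); rewrite rmorphD mulrDl mul1r; lra.
Qed.

Lemma lift_disjoint (S W1 u : R) (a b : int) : W1 < S ->
  0 <= u + a%:~R * S < W1 -> W1 <= u + b%:~R * S < S -> False.
Proof.
move=> WS /andP[a1 a2] /andP[b1 b2].
have S0 : 0 < S by lra.
have ab : a = b.
  by apply: (@winding_pos R S 0 u); rewrite ?addr0 //; lra.
by rewrite ab in a1 a2; lra.
Qed.

Lemma hexcfg_disjoint w1 w2 w3 S W1 W0 t B E : hexcfg w1 w2 w3 S W1 W0 t B E ->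
  forall x, B x -> E x -> False.
Proof.
move=> c x /(hc_B c)[a ha] /(hc_E c)[b hb].
have [_ W10] := hc_sum c; have [_ W00] := hc_gt0 c.
apply: lift_disjoint ha hb; lra.
Qed.

Lemma hexcfg_base3 w1 w2 w3 S W1 W0 t B E : hexcfg w1 w2 w3 S W1 W0 t B E ->
  W1 <= w3 -> unicyclic hexadj B E.
Proof.
move=> c; have BE := hexcfg_disjoint c.
case: c => [[p1 p2 p3] [g1 g0] [defS sumW] hB hE cB cE Bl El].
apply: (@unicyclic_base _ hexadj (fun x => x.1 - x.2) (fun x => x.1 + x.2)
  hexadj_sym _ _ hex_nbrs mem_hex_nbrs B E BE R w1 w2 w3 S W1 W0
  (fun x => t + x.1%:~R * w1 + x.2%:~R * w2)
  (fun x y => (y.1 == x.1 + 1) && (y.2 == x.2))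
  (fun x y => (y.1 == x.1) && (y.2 == x.2 + 1))
  (fun x y => (y.1 == x.1 - 1) && (y.2 == x.2 - 1))) => //.
- exact: hexadj_pos3.
- by move=> [? ?] [? ?] /= e1 e2; congr (_, _); move: e1 e2; clear; lia.
- by move=> x y /hexadj_cases.
- move=> [a b] [c d] /= /andP[/eqP -> /eqP ->]; split; [by clear; lia|by clear; lia|].
  by rewrite rmorphD mulrDl mul1r; ring.
- move=> [a b] [c d] /= /andP[/eqP -> /eqP ->]; split; [by clear; lia|by clear; lia|].
  by rewrite rmorphD mulrDl mul1r; ring.
- move=> [a b] [c d] /= /andP[/eqP -> /eqP ->]; split; [by clear; lia|by clear; lia|].
  by rewrite !rmorphB !mulrBl !mul1r; ring.
Qed.

Lemma hexcfg_base1 w1 w2 w3 S W1 W0 t B E : hexcfg w1 w2 w3 S W1 W0 t B E ->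
  W1 <= w1 -> unicyclic hexadj B E.
Proof.
move=> c; have BE := hexcfg_disjoint c.
case: c => [[p1 p2 p3] [g1 g0] [defS sumW] hB hE cB cE Bl El].
(* The direction of weight [w1] takes the third place, so its phase is taken to be [w1 - S]; the
   missing turns are put back into the winding number. *)
apply: (@unicyclic_base _ hexadj (fun x => x.2) (fun x => x.2 - 2 * x.1)
  hexadj_sym _ _ hex_nbrs mem_hex_nbrs B E BE R w2 w3 w1 S W1 W0
  (fun x => t + x.1%:~R * (w1 - S) + x.2%:~R * w2)
  (fun x y => (y.1 == x.1) && (y.2 == x.2 + 1))
  (fun x y => (y.1 == x.1 - 1) && (y.2 == x.2 - 1))
  (fun x y => (y.1 == x.1 + 1) && (y.2 == x.2))) => //.
- exact: hexadj_pos1.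
- by move=> [? ?] [? ?] /= e1 e2; congr (_, _); move: e1 e2; clear; lia.
- by rewrite [LHS]defS; ring.
- by move=> x y /hexadj_cases[] [];
    [left; constructor 3|left; constructor 1|left; constructor 2|right; constructor 3|right; constructor 1|right; constructor 2].
- move=> [a b] [c d] /= /andP[/eqP -> /eqP ->]; split; [by clear; lia|by clear; lia|].
  by rewrite rmorphD mulrDl mul1r; ring.
- move=> [a b] [c d] /= /andP[/eqP -> /eqP ->]; split; [by clear; lia|by clear; lia|].
  by rewrite !rmorphB !mulrBl !mul1r defS; ring.
- move=> [a b] [c d] /= /andP[/eqP -> /eqP ->]; split; [by clear; lia|by clear; lia|].
  by rewrite !rmorphD !mulrDl !mul1r defS; ring.
- by move=> x /hB[n hn]; exists (n + x.1); move: hn; rewrite rmorphD mulrDl mulrBr; lra.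
- by move=> x /hE[n hn]; exists (n + x.1); move: hn; rewrite rmorphD mulrDl mulrBr; lra.
Qed.

Lemma hexcfg_base2 w1 w2 w3 S W1 W0 t B E : hexcfg w1 w2 w3 S W1 W0 t B E ->
  W1 <= w2 -> unicyclic hexadj B E.
Proof.
move=> c; have BE := hexcfg_disjoint c.
case: c => [[p1 p2 p3] [g1 g0] [defS sumW] hB hE cB cE Bl El].
apply: (@unicyclic_base _ hexadj (fun x => - x.1) (fun x => x.1 - 2 * x.2)
  hexadj_sym _ _ hex_nbrs mem_hex_nbrs B E BE R w3 w1 w2 S W1 W0
  (fun x => t + x.1%:~R * w1 + x.2%:~R * (w2 - S))
  (fun x y => (y.1 == x.1 - 1) && (y.2 == x.2 - 1))
  (fun x y => (y.1 == x.1 + 1) && (y.2 == x.2))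
  (fun x y => (y.1 == x.1) && (y.2 == x.2 + 1))) => //.
- exact: hexadj_pos2.
- by move=> [? ?] [? ?] /= e1 e2; congr (_, _); move: e1 e2; clear; lia.
- by rewrite [LHS]defS; ring.
- by move=> x y /hexadj_cases[] [];
    [left; constructor 2|left; constructor 3|left; constructor 1|right; constructor 2|right; constructor 3|right; constructor 1].
- move=> [a b] [c d] /= /andP[/eqP -> /eqP ->]; split; [by clear; lia|by clear; lia|].
  by rewrite !rmorphB !mulrBl !mul1r defS; ring.
- move=> [a b] [c d] /= /andP[/eqP -> /eqP ->]; split; [by clear; lia|by clear; lia|].
  by rewrite rmorphD mulrDl mul1r; ring.
- move=> [a b] [c d] /= /andP[/eqP -> /eqP ->]; split; [by clear; lia|by clear; lia|].
  by rewrite !rmorphD !mulrDl !mul1r defS; ring.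
- by move=> x /hB[n hn]; exists (n + x.2); move: hn; rewrite rmorphD mulrDl mulrBr; lra.
- by move=> x /hE[n hn]; exists (n + x.2); move: hn; rewrite rmorphD mulrDl mulrBr; lra.
Qed.

Lemma hexcfg_base w1 w2 w3 S W1 W0 t B E : hexcfg w1 w2 w3 S W1 W0 t B E ->
  [\/ W1 <= w1, W1 <= w2 | W1 <= w3] \/ [\/ W0 <= w1, W0 <= w2 | W0 <= w3] ->
  unicyclic hexadj B E.
Proof.
move=> c [[]|w].
- exact: hexcfg_base1 c.
- exact: hexcfg_base2 c.
- exact: hexcfg_base3 c.
apply: unicyclic_sym; move: w; have c' := hexcfg_swap c; case.
- exact: hexcfg_base1 c'.
- exact: hexcfg_base2 c'.
- exact: hexcfg_base3 c'.
Qed.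

(** A single point is a trivial staircase, and the other class surrounds it. *)
Lemma hexcfg_single w1 w2 w3 S W1 W0 t B E : hexcfg w1 w2 w3 S W1 W0 t B E ->
  (forall x y, B x -> B y -> x = y) -> unicyclic hexadj B E.
Proof.
move=> c one; have BE := hexcfg_disjoint c; case: c => _ _ _ _ _ cB cE Bl El.
apply: (@unicyclic_ring _ hexadj (fun x => x.1 - x.2) (fun x => x.1 + x.2)
  hexadj_sym _ _ hex_nbrs mem_hex_nbrs B E BE) => //.
- exact: hexadj_pos3.
- by move=> [? ?] [? ?] /= e1 e2; congr (_, _); move: e1 e2; clear; lia.
- split=> [x y Bx By|x y z _ By Bz _ _ _]; last exact: one.
  by rewrite (one _ _ Bx By) /hexadj; case: (y) => ? ? /=; clear; lia.
Qed.
End HexConfiguration.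

(** * Descent in slabs of the cubic lattice *)

Notation Z3 := (int * int * int)%type.

Definition s1 (x : Z3) : Z3 := (x.1.1 + 1, x.1.2, x.2).
Definition s2 (x : Z3) : Z3 := (x.1.1, x.1.2 + 1, x.2).
Definition s3 (x : Z3) : Z3 := (x.1.1, x.1.2, x.2 + 1).
Definition p1 (x : Z3) : Z3 := (x.1.1 - 1, x.1.2, x.2).
Definition p2 (x : Z3) : Z3 := (x.1.1, x.1.2 - 1, x.2).
Definition p3 (x : Z3) : Z3 := (x.1.1, x.1.2, x.2 - 1).

Lemma s1K x : p1 (s1 x) = x. Proof. by case: x => [[a b] c]; rewrite /p1 /s1 /= addrK. Qed.
Lemma s2K x : p2 (s2 x) = x. Proof. by case: x => [[a b] c]; rewrite /p2 /s2 /= addrK. Qed.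
Lemma s3K x : p3 (s3 x) = x. Proof. by case: x => [[a b] c]; rewrite /p3 /s3 /= addrK. Qed.
Lemma p1K x : s1 (p1 x) = x. Proof. by case: x => [[a b] c]; rewrite /p1 /s1 /= subrK. Qed.
Lemma p2K x : s2 (p2 x) = x. Proof. by case: x => [[a b] c]; rewrite /p2 /s2 /= subrK. Qed.
Lemma p3K x : s3 (p3 x) = x. Proof. by case: x => [[a b] c]; rewrite /p3 /s3 /= subrK. Qed.

Definition step3 (x y : Z3) : Prop :=
  [\/ y = s1 x, y = s2 x | y = s3 x] \/ [\/ x = s1 y, x = s2 y | x = s3 y].

(* Coordinates with respect to the basis [e1, e2 - e1, e3 - e1]. *)
Definition phi (x : Z3) : Z3 := (x.1.1 + x.1.2 + x.2, x.1.2, x.2).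
Definition psi (x : Z3) : Z3 := (x.1.1 - x.1.2 - x.2, x.1.2, x.2).

Lemma phiK : cancel phi psi.
Proof. by move=> [[a b] c]; rewrite /phi /psi /=; congr (_, _, _); ring. Qed.
Lemma psiK : cancel psi phi.
Proof. by move=> [[a b] c]; rewrite /phi /psi /=; congr (_, _, _); ring. Qed.
Lemma phi_s1 x : phi (s1 x) = s1 (phi x).
Proof. by rewrite /phi /s1 /=; congr (_, _, _); ring. Qed.
Lemma phi_s2 x : phi (s2 x) = s1 (s2 (phi x)).
Proof. by rewrite /phi /s1 /s2 /=; congr (_, _, _); ring. Qed.
Lemma phi_s3 x : phi (s3 x) = s1 (s3 (phi x)).
Proof. by rewrite /phi /s1 /s3 /=; congr (_, _, _); ring. Qed.
Lemma psi_p1 x : psi (p1 x) = p1 (psi x).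
Proof. by rewrite /psi /p1 /=; congr (_, _, _); ring. Qed.
Lemma psi_p2 x : psi (p2 x) = p2 (s1 (psi x)).
Proof. by rewrite /psi /p2 /s1 /=; congr (_, _, _); ring. Qed.
Lemma psi_p3 x : psi (p3 x) = p3 (s1 (psi x)).
Proof. by rewrite /psi /p3 /s1 /=; congr (_, _, _); ring. Qed.

(** A finite set of edges, sorted by direction and stored through the starting points. *)
Record chain3 := Chain3 { c1 : seq Z3; c2 : seq Z3; c3 : seq Z3 }.

(** The last clause says that all degrees are even: the chain is a cycle modulo 2. *)
Definition is_chain (P : Z3 -> Prop) C :=
  [/\ forall x, x \in c1 C -> P x /\ P (s1 x),
      forall x, x \in c2 C -> P x /\ P (s2 x),
      forall x, x \in c3 C -> P x /\ P (s3 x) &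
      forall x, (x \in c1 C) (+) (x \in c2 C) (+) (x \in c3 C) (+)
        (p1 x \in c1 C) (+) (p2 x \in c2 C) (+) (p3 x \in c3 C) = false].

Definition chain_size C := (size (c1 C) + size (c2 C) + size (c3 C))%N.

Definition eq_chain C D :=
  [/\ c1 C =i c1 D, c2 C =i c2 D & c3 C =i c3 D].

Section Slab.
Variable R : realFieldType.

Definition val3 (w1 w2 w3 t : R) (x : Z3) : R :=
  t + x.1.1%:~R * w1 + x.1.2%:~R * w2 + x.2%:~R * w3.

Lemma val_s1 w1 w2 w3 t x : val3 w1 w2 w3 t (s1 x) = val3 w1 w2 w3 t x + w1.
Proof. by rewrite /val3 /s1 /= rmorphD mulrDl mul1r; ring. Qed.
Lemma val_s2 w1 w2 w3 t x : val3 w1 w2 w3 t (s2 x) = val3 w1 w2 w3 t x + w2.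
Proof. by rewrite /val3 /s2 /= rmorphD mulrDl mul1r; ring. Qed.
Lemma val_s3 w1 w2 w3 t x : val3 w1 w2 w3 t (s3 x) = val3 w1 w2 w3 t x + w3.
Proof. by rewrite /val3 /s3 /= rmorphD mulrDl mul1r; ring. Qed.
Lemma val_p1 w1 w2 w3 t x : val3 w1 w2 w3 t (p1 x) = val3 w1 w2 w3 t x - w1.
Proof. by rewrite -{2}[x]p1K val_s1 addrK. Qed.
Lemma val_p2 w1 w2 w3 t x : val3 w1 w2 w3 t (p2 x) = val3 w1 w2 w3 t x - w2.
Proof. by rewrite -{2}[x]p2K val_s2 addrK. Qed.
Lemma val_p3 w1 w2 w3 t x : val3 w1 w2 w3 t (p3 x) = val3 w1 w2 w3 t x - w3.
Proof. by rewrite -{2}[x]p3K val_s3 addrK. Qed.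
Lemma val_phi w1 w2 w3 t x :
  val3 w1 (w2 - w1) (w3 - w1) t (phi x) = val3 w1 w2 w3 t x.
Proof. by rewrite /val3 /phi /= !rmorphD; ring. Qed.

Section Reduction.
Variables (w1 w2 w3 W t : R) (P : Z3 -> Prop).
Local Notation val := (val3 w1 w2 w3 t).
Hypotheses (w1_gt0 : 0 < w1) (w12 : w1 <= w2) (w13 : w1 <= w3).
Hypotheses (W12 : W < w1 + w2) (W13 : W < w1 + w3).
Hypothesis win : forall x, P x -> 0 <= val x < W.

(* Subtracting the smallest weight [w1] from the others and from the width of the
   slab contracts the edges in direction [e1] whose upper end lies in the top
   layer of height [w1], and no other edge. *)
Definition retract x := if W - w1 <= val x then p1 (phi x) else phi x.
Definition reduced y := exists x, P x /\ y = retract x.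
Definition reduce C := Chain3 (map phi [seq x <- c1 C | val (s1 x) < W - w1])
  (map phi (c2 C)) (map phi (c3 C)).

Lemma edge1 x : P x -> P (s1 x) -> val x < W - w1.
Proof. by move=> _ /win; rewrite val_s1; lra. Qed.
(** The slab is so thin that edges of the second and third directions always run from below the top
    layer into it; only edges of the first direction can stay below. *)
Lemma edge2 x : P x -> P (s2 x) -> val x < W - w1 /\ W - w1 <= val x + w2.
Proof. by have [? ?] := (w12, W12); move=> /win + /win; rewrite val_s2; lra. Qed.
Lemma edge3 x : P x -> P (s3 x) -> val x < W - w1 /\ W - w1 <= val x + w3.
Proof. by have [? ?] := (w13, W13); move=> /win + /win; rewrite val_s3; lra. Qed.

Lemma retract_low x : val x < W - w1 -> retract x = phi x.
Proof. by rewrite /retract ltNge => /negPf ->. Qed.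
Lemma retract_top x : W - w1 <= val x -> retract x = p1 (phi x).
Proof. by rewrite /retract => ->. Qed.

Lemma retract_edge1 x : P x -> P (s1 x) ->
  retract (s1 x) = retract x \/ retract (s1 x) = s1 (retract x).
Proof.
move=> Px Ps; rewrite (retract_low (edge1 Px Ps)) /retract phi_s1.
by case: ifP => _; [left; rewrite s1K | right].
Qed.
Lemma retract_edge2 x : P x -> P (s2 x) -> retract (s2 x) = s2 (retract x).
Proof.
move=> Px Ps; have [lo hi] := edge2 Px Ps.
by rewrite (retract_low lo) retract_top ?val_s2 // phi_s2 s1K.
Qed.
Lemma retract_edge3 x : P x -> P (s3 x) -> retract (s3 x) = s3 (retract x).
Proof.
move=> Px Ps; have [lo hi] := edge3 Px Ps.
by rewrite (retract_low lo) retract_top ?val_s3 // phi_s3 s1K.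
Qed.

Lemma reduced_window y : (forall x, P x -> w1 <= val x \/ val x < W - w1) ->
  reduced y -> 0 <= val3 w1 (w2 - w1) (w3 - w1) t y < W - w1.
Proof.
move=> noiso [x [Px ->]]; have := win Px; have [vx|vx] := noiso _ Px.
  by rewrite /retract; case: ifPn; rewrite ?val_p1 val_phi -?ltNge; lra.
by rewrite retract_low // val_phi; lra.
Qed.

Lemma reduced_connected : connected P step3 -> connected reduced step3.
Proof.
move=> cP _ _ [x [Px ->]] [y [Py ->]].
elim: {y Py} (cP _ _ Px Py) => [|u v xu IH Pv uv]; first exact: reach_refl.
have Pu : P u by apply: reach_in xu.
have Rv : reduced (retract v) by exists v.
have go : retract v = retract u \/ step3 (retract u) (retract v) ->
    reach reduced step3 (retract x) (retract v).
  by case=> [-> //|]; apply: reach_step.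
apply: go; case: uv Pu Pv => -[] -> Pu Pv.
- have [->|->] := retract_edge1 Pu Pv; [by left | right; left; by constructor 1].
- by right; left; constructor 2; apply: retract_edge2.
- by right; left; constructor 3; apply: retract_edge3.
- have [->|->] := retract_edge1 Pv Pu; [by left | right; right; by constructor 1].
- by right; right; constructor 2; apply: retract_edge2.
- by right; right; constructor 3; apply: retract_edge3.
Qed.

Lemma mem_map_phi y (c : seq Z3) : (y \in map phi c) = (psi y \in c).
Proof. by rewrite -{1}[y]psiK mem_map //; apply: can_inj phiK. Qed.

Section Chain.
Variable C : chain3.
Hypothesis Cc : is_chain P C.

Lemma chain_low2 x : val x < W - w1 -> p2 x \notin c2 C.
Proof.
move=> vx; apply/negP => xc; have [_ h2 _ _] := Cc.
have [Pp] := h2 _ xc; rewrite p2K => Px.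
have := (@edge2 (p2 x) Pp); rewrite p2K => /(_ Px); rewrite val_p2; lra.
Qed.
Lemma chain_low3 x : val x < W - w1 -> p3 x \notin c3 C.
Proof.
move=> vx; apply/negP => xc; have [_ _ h3 _] := Cc.
have [Pp] := h3 _ xc; rewrite p3K => Px.
have := (@edge3 (p3 x) Pp); rewrite p3K => /(_ Px); rewrite val_p3; lra.
Qed.
Lemma chain_top x : W - w1 <= val x -> [/\ x \notin c1 C, x \notin c2 C & x \notin c3 C].
Proof.
move=> vx; have [h1 h2 h3 _] := Cc; split; apply/negP.
- by move=> /h1[Px /(edge1 Px)]; lra.
- by move=> /h2[Px /(edge2 Px)]; lra.
- by move=> /h3[Px /(edge3 Px)]; lra.
Qed.

(** A low point [x] and the point [s1 x], if this lies in the top layer, are retracted to the same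
    point. Its degree is the sum of their degrees minus twice the contracted edge, hence even. *)
Lemma reduce_chain : is_chain reduced (reduce C).
Proof.
have [h1 h2 h3 par] := Cc; split=> y /=; rewrite ?mem_map_phi ?mem_filter.
- move=> /andP[lt /h1[Px Ps]]; have lo := edge1 Px Ps; split.
    by exists (psi y); rewrite retract_low // psiK.
  by exists (s1 (psi y)); rewrite retract_low // phi_s1 psiK.
- move=> /h2[Px Ps]; have [lo hi] := edge2 Px Ps; split.
    by exists (psi y); rewrite retract_low // psiK.
  by exists (s2 (psi y)); rewrite retract_edge2 // retract_low // psiK.
- move=> /h3[Px Ps]; have [lo hi] := edge3 Px Ps; split.
    by exists (psi y); rewrite retract_low // psiK.
  by exists (s3 (psi y)); rewrite retract_edge3 // retract_low // psiK.
rewrite psi_p1 psi_p2 psi_p3 p1K; move: (psi y) => {y} x.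
(* If [x] is in the top layer then [s1 x] is outside the slab, so no point is retracted to
   [phi x]. *)
have [top|low] := lerP (W - w1) (val x).
  have [/negPf -> /negPf -> /negPf ->] := chain_top top.
  rewrite !andbF /=; apply/negbTE; rewrite negb_add; apply/eqP.
  have no : ~ P (s1 x) by move=> /win; rewrite val_s1; lra.
  have -> : p2 (s1 x) \in c2 C = false.
    by apply/negP => /h2[_]; rewrite p2K.
  by apply/esym/negP => /h3[_]; rewrite p3K.
have := par x; have := par (s1 x); rewrite s1K.
rewrite (negPf (chain_low2 low)) (negPf (chain_low3 low)) andTb.
have [lowY|topY] := ltrP (val (s1 x)) (W - w1).
  rewrite (negPf (chain_low2 lowY)) (negPf (chain_low3 lowY)) andTb.
  by move=> _ ->.
have [/negPf -> /negPf -> /negPf ->] := chain_top topY; rewrite andFb.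
by do !case: (_ \in _).
Qed.

(* This is why the descent strictly shortens every nonempty even chain. *)
Lemma chain_top_edge x : x \in c1 C \/ x \in c2 C \/ x \in c3 C ->
  exists2 y, y \in c1 C & W - w1 <= val (s1 y).
Proof.
have [h1 h2 h3 par] := Cc => ne; apply: contrapT => no.
have low y : y \in c1 C -> val (s1 y) < W - w1.
  by move=> yc; rewrite ltNge; apply/negP => ge; apply: no; exists y.
(* The furthest edge of the first direction would end at a point of odd degree: too low for an edge
   of another direction to end there, too high for one to start. *)
have c1F y : y \notin c1 C.
  apply/negP => yc.
  have [z [zc zmax]] := @seq_argmax _ (fun z : Z3 => z.1.1) _ (c1 C) (fun z h => h)
    (ex_intro (fun z => z \in c1 C) y yc).
  have [Pz Psz] := h1 _ zc; have lz := low _ zc; have vz := win Pz.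
  have F2 : s1 z \in c2 C = false.
    by apply/negP => /h2[_ /win]; rewrite val_s2 val_s1; have := W12; lra.
  have F3 : s1 z \in c3 C = false.
    by apply/negP => /h3[_ /win]; rewrite val_s3 val_s1; have := W13; lra.
  have := par (s1 z); rewrite F2 F3 s1K zc (negPf (chain_low2 lz)) (negPf (chain_low3 lz)).
  rewrite !addbF addbT => /negbFE /zmax /=; clear; lia.
(* Without edges of the first direction, the chain alternates between going up in the second
   direction and down in the third, so that [x.1.2 - x.2] grows without bound. *)
have c2F y : y \notin c2 C.
  apply/negP => yc.
  have [z [zc zmax]] := @seq_argmax _ (fun z : Z3 => z.1.2 - z.2) _ (c2 C) (fun z h => h)
    (ex_intro (fun z => z \in c2 C) y yc).
  have [Pz Psz] := h2 _ zc; have [loz hiz] := edge2 Pz Psz.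
  have [|/negPf F1 /negPf F2 /negPf F3] := @chain_top (s2 z); first by rewrite val_s2.
  have := par (s2 z); rewrite F1 F2 F3 s2K zc (negPf (c1F _)) /= => /negbFE qc.
  have [Pq Psq] := h3 _ qc; rewrite p3K in Psq; have [loq _] := @edge3 _ Pq (eq_ind_r P Psq (p3K _)).
  have := par (p3 (s2 z)); rewrite qc !(negPf (c1F _)) (negPf (chain_low2 loq)) (negPf (chain_low3 loq)).
  by rewrite /= !addbF addbT => /negbFE /zmax /=; clear; lia.
have {ne} xc : x \in c3 C.
  by case: ne => [|[]] //; [rewrite (negPf (c1F _)) | rewrite (negPf (c2F _))].
have [Px Psx] := h3 _ xc; have [lo hi] := edge3 Px Psx.
have [|/negPf F1 /negPf F2 /negPf F3] := @chain_top (s3 x); first by rewrite val_s3.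
by have := par (s3 x); rewrite F1 F2 F3 s3K xc (negPf (c1F _)) (negPf (c2F _)).
Qed.

Lemma chain_size_gt0P : (0 < chain_size C)%N ->
  exists x, x \in c1 C \/ x \in c2 C \/ x \in c3 C.
Proof.
rewrite /chain_size; case: C => [[|x d1] [|y d2] [|z d3]] //= _;
  first [by exists x; left; rewrite mem_head | by exists y; right; left; rewrite mem_head
  | by exists z; right; right; rewrite mem_head].
Qed.

Lemma reduce_size_le : (chain_size (reduce C) <= chain_size C)%N.
Proof. by rewrite /chain_size /= !size_map !leq_add2r size_filter count_size. Qed.

Lemma reduce_size_lt : (0 < chain_size C)%N -> (chain_size (reduce C) < chain_size C)%N.
Proof.
move=> /chain_size_gt0P[x /chain_top_edge[y yc top]].
rewrite /chain_size /= !size_map -!addnA ltn_add2r size_filter.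
rewrite -(count_predC (fun x => val (s1 x) < W - w1)) -{1}[count _ _]addn0 ltn_add2l.
by rewrite -has_count; apply/hasP; exists y => //=; rewrite -leNgt.
Qed.

(** At the top end of a contracted edge, parity demands an edge of the second or third direction,
    and these survive. *)
Lemma reduce_size_gt0 : (0 < chain_size C)%N -> (0 < chain_size (reduce C))%N.
Proof.
move=> /chain_size_gt0P[x /chain_top_edge[y yc top]].
have [h1 h2 h3 par] := Cc.
have [/negPf F1 /negPf F2 /negPf F3] := chain_top top.
have := par (s1 y); rewrite F1 F2 F3 s1K yc /=.
rewrite /chain_size /= !size_map.
by case: (c2 C) => [|? ?]; case: (c3 C) => [|? ?] //=; rewrite addnS.
Qed.
End Chain.

(** Only the contracted edges are lost, and parity at their top ends recovers them from the edges of
    the other two directions. *)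
Lemma reduce_inj C D : is_chain P C -> is_chain P D ->
  eq_chain (reduce C) (reduce D) -> eq_chain C D.
Proof.
move=> Cc Dc [e1 e2 e3].
have E2 : c2 C =i c2 D by move=> x; have := e2 (phi x); rewrite !mem_map_phi phiK.
have E3 : c3 C =i c3 D by move=> x; have := e3 (phi x); rewrite !mem_map_phi phiK.
split=> // x; have := e1 (phi x); rewrite !mem_map_phi !mem_filter phiK.
have [low|top] := ltrP (val (s1 x)) (W - w1); first by [].
move=> _; have [_ _ _ parC] := Cc; have [_ _ _ parD] := Dc.
have := parC (s1 x); have := parD (s1 x); rewrite s1K !E2 !E3.
have [/negPf -> _ _] := chain_top Cc top.
by have [/negPf -> /negPf -> /negPf ->] := chain_top Dc top; do !case: (_ \in _).
Qed.
End Reduction.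
End Slab.

Definition add3 (x y : Z3) : Z3 := (x.1.1 + y.1.1, x.1.2 + y.1.2, x.2 + y.2).

(* The quotient of [Z^3] by [(1, 1, 1)]. *)
Definition proj3 (x : Z3) : Z2 := (x.1.1 - x.2, x.1.2 - x.2).

Lemma add3_s1 x o : add3 (s1 x) o = s1 (add3 x o).
Proof. by rewrite /add3 /s1 /=; congr (_, _, _); ring. Qed.
Lemma add3_s2 x o : add3 (s2 x) o = s2 (add3 x o).
Proof. by rewrite /add3 /s2 /=; congr (_, _, _); ring. Qed.
Lemma add3_s3 x o : add3 (s3 x) o = s3 (add3 x o).
Proof. by rewrite /add3 /s3 /=; congr (_, _, _); ring. Qed.

Lemma step3_hexadj x y : step3 x y -> hexadj (proj3 x) (proj3 y).
Proof.
by case: x y => [[a b] c] [[a' b'] c']; rewrite /hexadj /proj3 /=;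
  case=> -[] [-> -> ->]; lia.
Qed.

Definition link (o b w : Z3) : Prop := let q := add3 w o in
  [\/ q = s1 b, q = s2 b | q = s3 b] \/
  [\/ q = s1 (s2 b), q = s1 (s3 b) | q = s2 (s3 b)].

Lemma link_hexadj o b w : link o b w -> hexadj (proj3 b) (proj3 (add3 w o)).
Proof.
rewrite /link; move: (add3 w o) => [[a' b'] c'].
by case: b => [[a b] c]; rewrite /hexadj /proj3 /=; case=> -[] [-> -> ->]; lia.
Qed.

Lemma finite_preim (T U : eqType) (f : T -> U) (P : T -> Prop) (l : seq U) :
  (forall x y, P x -> P y -> f x = f y -> x = y) ->
  (forall x, P x -> f x \in l) -> exists l' : seq T, forall x, P x -> x \in l'.
Proof.
elim: l P => [|u l IH] P inj Pl; first by exists [::] => x /Pl.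
have [l' hl'] : exists l' : seq T, forall x, P x /\ f x <> u -> x \in l'.
  apply: IH => [x y [Px _] [Py _]|x [Px ne]]; first exact: inj.
  by have := Pl _ Px; rewrite inE => /orP[/eqP|].
have [[x [Px fx]]|no] := pselect (exists x, P x /\ f x = u).
  exists (x :: l') => y Py; rewrite inE; have [fy|/eqP fy] := eqVneq (f y) u.
    by rewrite (inj y x) ?eqxx // fx.
  by rewrite hl' ?orbT.
by exists l' => y Py; apply: hl'; split=> // fy; apply: no; exists y.
Qed.

Section EdgeRelation.
Variable C : chain3.

Definition erel (x y : Z3) : bool :=
  [|| (x \in c1 C) && (y == s1 x), (x \in c2 C) && (y == s2 x),
      (x \in c3 C) && (y == s3 x), (y \in c1 C) && (x == s1 y),
      (y \in c2 C) && (x == s2 y) | (y \in c3 C) && (x == s3 y)].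

Lemma erel_sym x y : erel x y -> erel y x.
Proof. by rewrite /erel => /or4P[->|->|->|/or3P[->|->|->]]; rewrite ?orbT. Qed.

Lemma erelP x y : erel x y ->
  [\/ x \in c1 C /\ y = s1 x, x \in c2 C /\ y = s2 x | x \in c3 C /\ y = s3 x] \/
  [\/ p1 x \in c1 C /\ y = p1 x, p2 x \in c2 C /\ y = p2 x | p3 x \in c3 C /\ y = p3 x].
Proof.
case/or4P => [/andP[h /eqP ->]|/andP[h /eqP ->]|/andP[h /eqP ->]|].
- by left; constructor 1.
- by left; constructor 2.
- by left; constructor 3.
case/or3P=> /andP[h /eqP ->]; right.
- by constructor 1; rewrite s1K.
- by constructor 2; rewrite s2K.
- by constructor 3; rewrite s3K.
Qed.

Lemma erel_s1 x : erel x (s1 x) = (x \in c1 C).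
Proof.
rewrite /erel eqxx andbT; case: x => [[a b] c]; rewrite /s1 /s2 /s3 /= !xpair_eqE.
by case: (_ \in _) => //=; apply/negbTE; do !case: (_ \in _) => /=; lia.
Qed.
Lemma erel_s2 x : erel x (s2 x) = (x \in c2 C).
Proof.
rewrite /erel eqxx andbT; case: x => [[a b] c]; rewrite /s1 /s2 /s3 /= !xpair_eqE.
case: (_ \in c2 C); first by rewrite orbT.
by apply/negbTE; do !case: (_ \in _) => /=; lia.
Qed.
Lemma erel_s3 x : erel x (s3 x) = (x \in c3 C).
Proof.
rewrite /erel eqxx andbT; case: x => [[a b] c]; rewrite /s1 /s2 /s3 /= !xpair_eqE.
case: (_ \in c3 C); first by rewrite !orbT.
by apply/negbTE; do !case: (_ \in _) => /=; lia.
Qed.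

Variable P : Z3 -> Prop.
Hypothesis Cc : is_chain P C.

Lemma erel_in x y : erel x y -> [/\ P x, P y & step3 x y].
Proof.
have [h1 h2 h3 _] := Cc.
case/erelP=> -[] [xc ->].
- by have [? ?] := h1 _ xc; split=> //; left; constructor 1.
- by have [? ?] := h2 _ xc; split=> //; left; constructor 2.
- by have [? ?] := h3 _ xc; split=> //; left; constructor 3.
- by have [? +] := h1 _ xc; rewrite p1K => ?; split=> //; right; constructor 1; rewrite p1K.
- by have [? +] := h2 _ xc; rewrite p2K => ?; split=> //; right; constructor 2; rewrite p2K.
- by have [? +] := h3 _ xc; rewrite p3K => ?; split=> //; right; constructor 3; rewrite p3K.
Qed.

Lemma erel_p1 x : erel x (p1 x) = (p1 x \in c1 C).
Proof. by rewrite -erel_s1 p1K; apply/idP/idP => /erel_sym. Qed.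
Lemma erel_p2 x : erel x (p2 x) = (p2 x \in c2 C).
Proof. by rewrite -erel_s2 p2K; apply/idP/idP => /erel_sym. Qed.
Lemma erel_p3 x : erel x (p3 x) = (p3 x \in c3 C).
Proof. by rewrite -erel_s3 p3K; apply/idP/idP => /erel_sym. Qed.

Lemma erel_leafless : leafless erel.
Proof.
have [_ _ _ par] := Cc => x y xy.
apply: (@even_count_other _ (erel x) [:: s1 x; s2 x; s3 x; p1 x; p2 x; p3 x] y) => //.
- by clear; case: x => [[a b] c]; rewrite /s1 /s2 /s3 /p1 /p2 /p3 /= !inE !xpair_eqE; lia.
- rewrite -[RHS](par x) /= erel_s1 erel_s2 erel_s3 erel_p1 erel_p2 erel_p3.
  by rewrite !oddD !oddb addbF !addbA.
- by case/erelP: xy => -[] [_ ->]; rewrite !inE eqxx ?orbT.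
Qed.

Lemma erel_finite : exists l : seq Z3, forall x y, erel x y -> x \in l.
Proof.
exists (c1 C ++ c2 C ++ c3 C ++ map s1 (c1 C) ++ map s2 (c2 C) ++ map s3 (c3 C)).
move=> x y /erelP h; rewrite !mem_cat; case: h => -[] [h _]; rewrite ?h ?orbT //.
- by rewrite -[x]p1K map_f ?orbT.
- by rewrite -[x]p2K map_f ?orbT.
- by rewrite -[x]p3K map_f ?orbT.
Qed.

Lemma erel_ex : (0 < chain_size C)%N -> exists x y, erel x y.
Proof.
move=> /chain_size_gt0P[x [h|[h|h]]]; exists x.
- by exists (s1 x); rewrite erel_s1.
- by exists (s2 x); rewrite erel_s2.
- by exists (s3 x); rewrite erel_s3.
Qed.
End EdgeRelation.

Section Slabs.
Variable R : realFieldType.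

(* The points of [E] are relative to the offset [o], which makes the two slabs
   transform by the same rule. *)
Record cfg3 (w1 w2 w3 W1 W0 t : R) (o : Z3) (B E : Z3 -> Prop) : Prop := Cfg3 {
  k_ge0 : [/\ 0 <= w1, 0 <= w2 & 0 <= w3];
  k_gt0 : 0 < W1 /\ 0 < W0;
  k_sum : W1 + W0 = w1 + w2 + w3;
  k_B : forall x, B x -> 0 <= val3 w1 w2 w3 t x < W1;
  k_E : forall x, E x -> 0 <= val3 w1 w2 w3 (val3 w1 w2 w3 t o - W1) x < W0;
  k_connB : connected B step3;
  k_connE : connected E step3;
  k_BE : forall b, B b -> exists w, E w /\ link o b w;
  k_EB : forall w, E w -> exists b, B b /\ link o b w }.

Lemma val_add3 (w1 w2 w3 t W : R) o x :
  val3 w1 w2 w3 (val3 w1 w2 w3 t o - W) x = val3 w1 w2 w3 t (add3 x o) - W.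
Proof. by rewrite /val3 /add3 /= !rmorphD; ring. Qed.

Lemma val_proj3 (w1 w2 w3 t : R) x : val3 w1 w2 w3 t x =
  t + (proj3 x).1%:~R * w1 + (proj3 x).2%:~R * w2 + x.2%:~R * (w1 + w2 + w3).
Proof. by rewrite /val3 /proj3 /= !rmorphB; ring. Qed.

Definition projB (B : Z3 -> Prop) p := exists x, B x /\ p = proj3 x.
Definition projE o (E : Z3 -> Prop) p := exists x, E x /\ p = proj3 (add3 x o).

Lemma reach_map (T U : Type) (f : T -> U) (P : T -> Prop) (Q : U -> Prop) r r' x y :
  (forall z, P z -> Q (f z)) -> (forall u v, r u v -> r' (f u) (f v)) ->
  reach P r x y -> reach Q r' (f x) (f y).
Proof.
move=> PQ rr; elim=> [|u v _ IH Pv uv]; first exact: reach_refl.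
by apply: reach_step IH (PQ _ Pv) (rr _ _ uv).
Qed.

Lemma cfg3_hexcfg w1 w2 w3 W1 W0 t o B E : cfg3 w1 w2 w3 W1 W0 t o B E ->
  hexcfg w1 w2 w3 (w1 + w2 + w3) W1 W0 t (projB B) (projE o E).
Proof.
case=> h0 g0 sumW hB hE cB cE BE EB; split=> //.
- by move=> _ [x [/hB h ->]]; exists x.2; rewrite -val_proj3.
- move=> _ [x [/hE h ->]]; exists (add3 x o).2; rewrite -val_proj3.
  by rewrite val_add3 in h; lra.
- move=> _ _ [x [Bx ->]] [y [By ->]].
  apply: (@reach_map _ _ proj3 _ _ _ _ _ _ _ step3_hexadj) (cB _ _ Bx By).
  by move=> z Bz; exists z.
- move=> _ _ [x [Ex ->]] [y [Ey ->]].
  apply: (@reach_map _ _ (fun z => proj3 (add3 z o)) _ _ _ _ _ _ _ _) (cE _ _ Ex Ey).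
    by move=> z Ez; exists z.
  move=> u v uv; apply: step3_hexadj.
  by case: uv => -[] ->; rewrite ?add3_s1 ?add3_s2 ?add3_s3;
    [left; constructor 1|left; constructor 2|left; constructor 3
    |right; constructor 1|right; constructor 2|right; constructor 3].
- move=> _ [b [Bb ->]]; have [w [Ew bw]] := BE _ Bb.
  by exists (proj3 (add3 w o)); split; [exists w | apply: link_hexadj].
- move=> _ [w [Ew ->]]; have [b [Bb bw]] := EB _ Ew.
  exists (proj3 b); split; first by exists b.
  exact/hexadj_sym/link_hexadj.
Qed.

(** The fibres of the projection have direction (1, 1, 1), along which the value changes by
    multiples of [w1 + w2 + w3], a number not below the width of the slab. *)
Lemma proj3_inj (w1 w2 w3 t c L : R) x y : 0 < w1 + w2 + w3 -> L <= w1 + w2 + w3 ->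
  c <= val3 w1 w2 w3 t x < c + L -> c <= val3 w1 w2 w3 t y < c + L ->
  proj3 x = proj3 y -> x = y.
Proof.
move=> S0 LS; rewrite !val_proj3 => hx hy e; rewrite e in hx.
have c3 : x.2 = y.2.
  by apply: (winding0 (w := 0) (w3 := L) S0 _ _ _ _ hx); rewrite ?addr0 ?subr0 //; lra.
case: x y e c3 {hx hy} => [[a b] c0] [[a' b'] c'] [] /= e1 e2 e3.
by rewrite e3 in e1 e2 *; move/addIr: e1 => ->; move/addIr: e2 => ->.
Qed.

(** Only the union of the chains of the two classes is required to be nonempty, so that cycles of
    different colors are compared as well. *)
Definition slab_unicyclic (B E : Z3 -> Prop) := forall CB CE DB DE,
  is_chain B CB -> is_chain E CE -> is_chain B DB -> is_chain E DE ->
  (0 < chain_size CB + chain_size CE)%N -> (0 < chain_size DB + chain_size DE)%N ->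
  [/\ eq_chain CB DB, eq_chain CE DE & exists l : seq Z3, forall x, E x -> x \in l].

Lemma eq_chain_erel C D : (forall x y, erel C x y <-> erel D x y) -> eq_chain C D.
Proof.
move=> h; split=> x.
- by rewrite -!erel_s1; apply/idP/idP => /h.
- by rewrite -!erel_s2; apply/idP/idP => /h.
- by rewrite -!erel_s3; apply/idP/idP => /h.
Qed.

(** The base cases are settled in the plane; the projection is injective on each slab and keeps them
    disjoint, so the result can be pulled back. *)
Lemma unicyclic_slab w1 w2 w3 W1 W0 t o B E : cfg3 w1 w2 w3 W1 W0 t o B E ->
  unicyclic hexadj (projB B) (projE o E) -> slab_unicyclic B E.
Proof.
move=> c uni CB CE DB DE CBc CEc DBc DEc nC nD.
have dis := hexcfg_disjoint (cfg3_hexcfg c).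
have [[p1 p2 p3] [g1 g0] sumW hB hE _ _ _ _] := c.
have S0 : 0 < w1 + w2 + w3 by lra.
have injB x y : B x -> B y -> proj3 x = proj3 y -> x = y.
  by move=> /hB hx /hB hy; apply: (@proj3_inj w1 w2 w3 t 0 W1) => //; lra.
have injE x y : E x -> E y -> proj3 (add3 x o) = proj3 (add3 y o) -> x = y.
  move=> /hE; rewrite val_add3 => hx /hE; rewrite val_add3 => hy e.
  suff : add3 x o = add3 y o.
    case: x y {hx hy e} => [[? ?] ?] [[? ?] ?]; rewrite /add3 /=.
    by case=> /addIr-> /addIr-> /addIr->.
  by apply: (@proj3_inj w1 w2 w3 t W1 W0) => //; lra.
pose h (X Y : chain3) p q :=
  (exists x y, [/\ erel X x y, p = proj3 x & q = proj3 y]) \/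
  (exists x y, [/\ erel Y x y, p = proj3 (add3 x o) & q = proj3 (add3 y o)]).
have core X Y : is_chain B X -> is_chain E Y -> (0 < chain_size X + chain_size Y)%N ->
    mono_core hexadj (projB B) (projE o E) (h X Y).
  move=> Xc Yc nXY; split.
  - by move=> p q [] [x [y [/erel_sym xy -> ->]]]; [left|right]; exists y, x.
  - move=> p q [] [x [y [xy -> ->]]].
      have [Bx By st] := erel_in Xc xy; split; first exact: step3_hexadj.
      by left; split; [exists x|exists y].
    have [Ex Ey st] := erel_in Yc xy; split.
      apply: step3_hexadj; case: st => -[] ->; rewrite ?add3_s1 ?add3_s2 ?add3_s3;
        by [left; constructor 1|left; constructor 2|left; constructor 3
           |right; constructor 1|right; constructor 2|right; constructor 3].
    by right; split; [exists x|exists y].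
  - move=> p q [] [x [y [xy -> ->]]].
      have [z [zy xz]] := erel_leafless Xc xy; exists (proj3 z); split; last by left; exists x, z.
      have [_ By _] := erel_in Xc xy; have [_ Bz _] := erel_in Xc xz.
      by move=> /(injB _ _ Bz By).
    have [z [zy xz]] := erel_leafless Yc xy; exists (proj3 (add3 z o)); split; last by right; exists x, z.
    have [_ Ey _] := erel_in Yc xy; have [_ Ez _] := erel_in Yc xz.
    by move=> /(injE _ _ Ez Ey).
  - have [l1 hl1] := erel_finite X; have [l2 hl2] := erel_finite Y.
    exists (map proj3 l1 ++ map (fun x => proj3 (add3 x o)) l2) => p q.
    rewrite mem_cat => -[] [x [y [xy -> _]]]; first by rewrite map_f // (hl1 _ _ xy).
    by rewrite (map_f (fun x => proj3 (add3 x o)) (hl2 _ _ xy)) orbT.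
  - have [X0|X0] := posnP (chain_size X).
      rewrite X0 add0n in nXY; have [x [y xy]] := erel_ex nXY.
      by exists (proj3 (add3 x o)), (proj3 (add3 y o)); right; exists x, y.
    have [x [y xy]] := erel_ex X0.
    by exists (proj3 x), (proj3 y); left; exists x, y.
have eqs X Y X' Y' : is_chain B X -> is_chain E Y -> is_chain B X' -> is_chain E Y' ->
   (forall p q, h X Y p q -> h X' Y' p q) ->
   (forall x y, erel X x y -> erel X' x y) /\ (forall x y, erel Y x y -> erel Y' x y).
  move=> Xc Yc Xc' Yc' sub; split=> x y xy.
    have [Bx By _] := erel_in Xc xy.
    have [|[x' [y' [xy' ex ey]]]|[x' [y' [xy' ex ey]]]] := sub (proj3 x) (proj3 y).
    - by left; exists x, y.
    - have [Bx' By' _] := erel_in Xc' xy'.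
      by rewrite (injB _ _ Bx Bx' ex) (injB _ _ By By' ey).
    - have [Ex' _ _] := erel_in Yc' xy'.
      by case: (dis (proj3 x)); [exists x | exists x'].
  have [Ex Ey _] := erel_in Yc xy.
  have [|[x' [y' [xy' ex ey]]]|[x' [y' [xy' ex ey]]]] := sub (proj3 (add3 x o)) (proj3 (add3 y o)).
  - by right; exists x, y.
  - have [Bx' _ _] := erel_in Xc' xy'.
    by case: (dis (proj3 x')); [exists x' | exists x].
  - have [Ex' Ey' _] := erel_in Yc' xy'.
    by rewrite (injE _ _ Ex Ex' ex) (injE _ _ Ey Ey' ey).
have [e [l hl]] := uni _ _ (core _ _ CBc CEc nC) (core _ _ DBc DEc nD).
have [f1 f2] := eqs _ _ _ _ CBc CEc DBc DEc (fun p q => (e p q).1).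
have [g1' g2] := eqs _ _ _ _ DBc DEc CBc CEc (fun p q => (e p q).2).
split.
- by apply: eq_chain_erel => x y; split; [apply: f1|apply: g1'].
- by apply: eq_chain_erel => x y; split; [apply: f2|apply: g2].
- apply: (finite_preim injE (l := l)) => x Ex; apply: hl; right; by exists x.
Qed.

Lemma slab_unicyclic_base w1 w2 w3 W1 W0 t o B E : cfg3 w1 w2 w3 W1 W0 t o B E ->
  [\/ W1 <= w1, W1 <= w2 | W1 <= w3] \/ [\/ W0 <= w1, W0 <= w2 | W0 <= w3] ->
  slab_unicyclic B E.
Proof.
by move=> c h; apply: unicyclic_slab (c) _; apply: hexcfg_base (cfg3_hexcfg c) h.
Qed.

Lemma isolated_single (P : Z3 -> Prop) x : connected P step3 -> P x ->
  (forall y, P y -> ~ step3 x y) -> forall y, P y -> y = x.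
Proof.
move=> cP Px no y Py; elim: (cP _ _ Px Py) => // u v _ -> Pv xv.
by case: (no _ Pv).
Qed.

(** Every step up from [x] leaves the slab through the top and every step down through the
    bottom. *)
Lemma isolated_in_window (w1 w2 w3 W t : R) (P : Z3 -> Prop) x :
  0 <= w1 -> w1 <= w2 -> w1 <= w3 ->
  (forall x, P x -> 0 <= val3 w1 w2 w3 t x < W) -> connected P step3 ->
  P x -> val3 w1 w2 w3 t x < w1 -> W - w1 <= val3 w1 w2 w3 t x ->
  forall y, P y -> y = x.
Proof.
move=> w0 w12 w13 win cP Px lo hi; apply: isolated_single => // y /win wy xy.
by move: wy; case: xy => -[] e; rewrite e ?val_s1 ?val_s2 ?val_s3 in lo hi *; lra.
Qed.

Lemma slab_unicyclic_single w1 w2 w3 W1 W0 t o B E : cfg3 w1 w2 w3 W1 W0 t o B E ->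
  ((exists x, forall y, B y -> y = x) \/ (exists x, forall y, E y -> y = x)) ->
  slab_unicyclic B E.
Proof.
move=> c h; apply: unicyclic_slab (c) _; case: h => -[x hx].
  apply: hexcfg_single (cfg3_hexcfg c) _ => _ _ [y [/hx -> ->]] [z [/hx -> ->]] //.
apply: unicyclic_sym.
apply: hexcfg_single (hexcfg_swap (cfg3_hexcfg c)) _ => _ _ [y [/hx -> ->]] [z [/hx -> ->]] //.
Qed.

Lemma phi_add3 x o : add3 (phi x) (p1 (phi o)) = p1 (phi (add3 x o)).
Proof. by rewrite /add3 /phi /p1 /=; congr (_, _, _); ring. Qed.

Lemma add3_p1 x o : add3 (p1 x) o = p1 (add3 x o).
Proof. by rewrite /add3 /p1 /=; congr (_, _, _); ring. Qed.

(** The difference between the two ends changes by [- e1] through the new offset, by [+ e1] if [b]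
    is in the top layer and by [- e1] if [w] is. Of the twenty-four combinations, those excluded by
    the windows and the absence of isolated points are discarded; the others give a link in the new
    basis. *)
Lemma retract_link (w1 w2 w3 W1 W0 t : R) o b w :
  0 < w1 -> w1 <= w2 -> w1 <= w3 -> W1 + W0 = w1 + w2 + w3 ->
  [/\ w1 < W1, w2 < W1 & w3 < W1] -> [/\ w1 < W0, w2 < W0 & w3 < W0] ->
  let t0 := val3 w1 w2 w3 t o - W1 in
  0 <= val3 w1 w2 w3 t b < W1 -> 0 <= val3 w1 w2 w3 t0 w < W0 ->
  (w1 <= val3 w1 w2 w3 t b \/ val3 w1 w2 w3 t b < W1 - w1) ->
  (w1 <= val3 w1 w2 w3 t0 w \/ val3 w1 w2 w3 t0 w < W0 - w1) ->
  link o b w ->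
  link (p1 (phi o)) (retract w1 w2 w3 W1 t b) (retract w1 w2 w3 W0 t0 w).
Proof.
move=> w1_gt0 w12 w13 sumW [a1 a2 a3] [b1 b2 b3] t0.
rewrite /retract {}/t0 val_add3 /link.
move: (erefl (add3 w o)); move: {-2}(add3 w o) => q qE hb hq ib iw.
have qlow : add3 (phi w) (p1 (phi o)) = p1 (phi q) by rewrite phi_add3 qE.
have qtop : add3 (p1 (phi w)) (p1 (phi o)) = p1 (p1 (phi q)) by rewrite add3_p1 qlow.
have eqs (x y : Z3) : x.1.1 = y.1.1 -> x.1.2 = y.1.2 -> x.2 = y.2 -> x = y.
  by case: x y => [[? ?] ?] [[? ?] ?] /= -> -> ->.
case: (lerP (W1 - w1) (val3 w1 w2 w3 t b)) => hb';
  case: (lerP (W0 - w1) (val3 w1 w2 w3 t q - W1)) => hq'; rewrite ?qlow ?qtop;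
  case=> -[] e; rewrite e ?val_s1 ?val_s2 ?val_s3 in hq iw hq' * => {e qE qlow qtop};
  try (by exfalso; lra).
- by left; constructor 2; apply: eqs => /=; ring.
- by left; constructor 3; apply: eqs => /=; ring.
- by right; constructor 1; apply: eqs => /=; ring.
- by right; constructor 2; apply: eqs => /=; ring.
- by left; constructor 1; apply: eqs => /=; ring.
- by right; constructor 1; apply: eqs => /=; ring.
- by right; constructor 2; apply: eqs => /=; ring.
- by left; constructor 2; apply: eqs => /=; ring.
- by left; constructor 3; apply: eqs => /=; ring.
- by right; constructor 3; apply: eqs => /=; ring.
- by left; constructor 2; apply: eqs => /=; ring.
- by left; constructor 3; apply: eqs => /=; ring.
- by right; constructor 1; apply: eqs => /=; ring.
- by right; constructor 2; apply: eqs => /=; ring.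
Qed.
End Slabs.

Definition slab_unicyclic_upto n (B E : Z3 -> Prop) := forall CB CE DB DE,
  is_chain B CB -> is_chain E CE -> is_chain B DB -> is_chain E DE ->
  (0 < chain_size CB + chain_size CE)%N -> (0 < chain_size DB + chain_size DE)%N ->
  (chain_size CB + chain_size CE + chain_size DB + chain_size DE <= n)%N ->
  [/\ eq_chain CB DB, eq_chain CE DE & exists l : seq Z3, forall x, E x -> x \in l].

(** A cyclic permutation of the directions, used to bring the smallest weight to the first place. *)
Definition rot3 (x : Z3) : Z3 := (x.1.2, x.2, x.1.1).
Definition unrot3 (x : Z3) : Z3 := (x.2, x.1.1, x.1.2).

Lemma rot3K : cancel rot3 unrot3. Proof. by case=> [[? ?] ?]. Qed.
Lemma unrot3K : cancel unrot3 rot3. Proof. by case=> [[? ?] ?]. Qed.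

Lemma mem_map_rot3 y (c : seq Z3) : (y \in map rot3 c) = (unrot3 y \in c).
Proof. by rewrite -{1}[y]unrot3K mem_map //; apply: can_inj rot3K. Qed.

Definition rot_chain C :=
  Chain3 (map rot3 (c2 C)) (map rot3 (c3 C)) (map rot3 (c1 C)).

Lemma is_chain_rot P C : is_chain P C -> is_chain (P \o unrot3) (rot_chain C).
Proof.
case=> h1 h2 h3 par; split=> x /=; rewrite ?mem_map_rot3; [exact: h2 | exact: h3 | exact: h1 |].
have := par (unrot3 x).
have -> : unrot3 (p1 x) = p2 (unrot3 x) by [].
have -> : unrot3 (p2 x) = p3 (unrot3 x) by [].
have -> : unrot3 (p3 x) = p1 (unrot3 x) by [].
by do !case: (_ \in _).
Qed.

Lemma rot_chain_size C : chain_size (rot_chain C) = chain_size C.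
Proof. by rewrite /chain_size /= !size_map addnC addnA. Qed.

Lemma rot_chain_inj C D : eq_chain (rot_chain C) (rot_chain D) -> eq_chain C D.
Proof.
by case=> e1 e2 e3; split=> x; [have := e3 (rot3 x) | have := e1 (rot3 x) | have := e2 (rot3 x)];
  rewrite /= !mem_map_rot3 rot3K.
Qed.

Lemma slab_unicyclic_upto_rot n B E :
  slab_unicyclic_upto n (B \o unrot3) (E \o unrot3) -> slab_unicyclic_upto n B E.
Proof.
move=> u CB CE DB DE /is_chain_rot c1' /is_chain_rot c2' /is_chain_rot c3' /is_chain_rot c4'.
rewrite -(rot_chain_size CB) -(rot_chain_size CE) -(rot_chain_size DB) -(rot_chain_size DE).
move=> n1 n2 n3; have [e1 e2 [l hl]] := u _ _ _ _ c1' c2' c3' c4' n1 n2 n3.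
split; [exact: rot_chain_inj | exact: rot_chain_inj |].
exists (map unrot3 l) => x Ex; rewrite -[x]rot3K map_f //; apply: hl.
by rewrite /= rot3K.
Qed.

Lemma step3_rot x y : step3 x y -> step3 (rot3 x) (rot3 y).
Proof.
by case=> -[] ->; [left; constructor 3|left; constructor 1|left; constructor 2
  |right; constructor 3|right; constructor 1|right; constructor 2].
Qed.

Lemma link_rot o b w : link o b w -> link (rot3 o) (rot3 b) (rot3 w).
Proof.
rewrite /link.
have -> : add3 (rot3 w) (rot3 o) = rot3 (add3 w o) by [].
by case=> -[] ->; [left; constructor 3|left; constructor 1|left; constructor 2
  |right; constructor 2|right; constructor 3|right; constructor 1].
Qed.

Section Descent.
Variable R : realFieldType.

Lemma val_rot (w1 w2 w3 t : R) x : val3 w2 w3 w1 t x = val3 w1 w2 w3 t (unrot3 x).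
Proof. by rewrite /val3 /unrot3 /=; ring. Qed.

Lemma connected_rot (P : Z3 -> Prop) : connected P step3 -> connected (P \o unrot3) step3.
Proof.
move=> cP x y Px Py; rewrite -[x]unrot3K -[y]unrot3K.
apply: (@reach_map _ _ rot3 P) (cP _ _ Px Py); last exact: step3_rot.
by move=> z Pz; rewrite /= rot3K.
Qed.

Lemma cfg3_rot (w1 w2 w3 W1 W0 t : R) o B E : cfg3 w1 w2 w3 W1 W0 t o B E ->
  cfg3 w2 w3 w1 W1 W0 t (rot3 o) (B \o unrot3) (E \o unrot3).
Proof.
case=> [[h1 h2 h3] g0 sumW hB hE cB cE BE EB]; split=> //.
- by rewrite sumW; ring.
- by move=> x /hB; rewrite -val_rot.
- by move=> x /hE; rewrite [val3 w2 w3 w1 t _]val_rot rot3K -val_rot.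
- exact: connected_rot.
- exact: connected_rot.
- move=> b /BE[w [Ew bw]]; exists (rot3 w); rewrite /= rot3K; split=> //.
  by rewrite -[b]unrot3K; apply: link_rot.
- move=> w /EB[b [Bb bw]]; exists (rot3 b); rewrite /= rot3K; split=> //.
  by rewrite -[w]unrot3K; apply: link_rot.
Qed.

Lemma cfg3_reduced (w1 w2 w3 W1 W0 t : R) o B E : cfg3 w1 w2 w3 W1 W0 t o B E ->
  0 < w1 -> w1 <= w2 -> w1 <= w3 ->
  [/\ w1 < W1, w2 < W1 & w3 < W1] -> [/\ w1 < W0, w2 < W0 & w3 < W0] ->
  (forall x, B x -> w1 <= val3 w1 w2 w3 t x \/ val3 w1 w2 w3 t x < W1 - w1) ->
  (forall x, E x -> w1 <= val3 w1 w2 w3 (val3 w1 w2 w3 t o - W1) x \/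
     val3 w1 w2 w3 (val3 w1 w2 w3 t o - W1) x < W0 - w1) ->
  cfg3 w1 (w2 - w1) (w3 - w1) (W1 - w1) (W0 - w1) t (p1 (phi o))
    (reduced w1 w2 w3 W1 t B)
    (reduced w1 w2 w3 W0 (val3 w1 w2 w3 t o - W1) E).
Proof.
move=> [h0 g0 sumW hB hE cB cE BE EB] w1_gt0 w12 w13 a b nB nE.
have [[a1 a2 a3] [b1 b2 b3]] := (a, b).
(* The step [p1] in the new offset compensates for the smaller [W1], so the values on [E] keep their
   origin. *)
have t0E : val3 w1 (w2 - w1) (w3 - w1) t (p1 (phi o)) - (W1 - w1) = val3 w1 w2 w3 t o - W1.
  by rewrite val_p1 val_phi; ring.
split.
- by split; lra.
- by split; lra.
- by lra.
- move=> y; apply: reduced_window => //; lra.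
- move=> y; rewrite t0E; apply: reduced_window => //; lra.
- by apply: reduced_connected => //; lra.
- by apply: reduced_connected => //; lra.
- move=> _ [x [Bx ->]]; have [w [Ew xw]] := BE _ Bx.
  exists (retract w1 w2 w3 W0 (val3 w1 w2 w3 t o - W1) w); split; first by exists w.
  by apply: retract_link => //; [exact: hB | exact: hE | exact: nB | exact: nE].
- move=> _ [w [Ew ->]]; have [x [Bx xw]] := EB _ Ew.
  exists (retract w1 w2 w3 W1 t x); split; first by exists x.
  by apply: retract_link => //; [exact: hB | exact: hE | exact: nB | exact: nE].
Qed.

(** A point has at most two preimages under the retraction, one below the top layer and one in
    it. *)
Lemma reduced_finite (w1 w2 w3 W t : R) P :
  (exists l : seq Z3, forall x, reduced w1 w2 w3 W t P x -> x \in l) ->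
  exists l : seq Z3, forall x, P x -> x \in l.
Proof.
case=> l hl; exists (map psi l ++ map psi (map s1 l)) => x Px; rewrite mem_cat.
have := hl _ (ex_intro _ x (conj Px erefl)); rewrite /retract; case: ifP => _ xl.
  by rewrite -[x in X in _ || X]phiK -[phi x]p1K !map_f ?orbT.
by rewrite -[x]phiK map_f.
Qed.

Lemma slab_unicyclic_step n (w1 w2 w3 W1 W0 t : R) o B E :
  (forall (w1 w2 w3 W1 W0 t : R) o B E, cfg3 w1 w2 w3 W1 W0 t o B E ->
     @slab_unicyclic_upto n B E) ->
  cfg3 w1 w2 w3 W1 W0 t o B E -> w1 <= w2 -> w1 <= w3 ->
  slab_unicyclic_upto n.+1 B E.
Proof.
move=> IH c w12 w13.
have full : slab_unicyclic B E -> slab_unicyclic_upto n.+1 B E.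
  by move=> u CB CE DB DE h1 h2 h3 h4 n1 n2 _; apply: u.
have [base|] := pselect ([\/ W1 <= w1, W1 <= w2 | W1 <= w3] \/ [\/ W0 <= w1, W0 <= w2 | W0 <= w3]).
  by apply: full; apply: slab_unicyclic_base c base.
move=> nobase.
have [[a1 a2 a3] [b1 b2 b3]] : [/\ w1 < W1, w2 < W1 & w3 < W1] /\ [/\ w1 < W0, w2 < W0 & w3 < W0].
  split; split; rewrite ltNge; apply/negP => le; apply: nobase;
  [left; by constructor 1|left; by constructor 2|left; by constructor 3
  |right; by constructor 1|right; by constructor 2|right; by constructor 3].
have [[h1 h2 h3] [g1 g0] sumW hB hE cB cE BE EB] := c.
(* Indeed [w1] is the sum of [W1 - w2] and [W0 - w3]. *)
have w1_gt0 : 0 < w1 by lra.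
set t0 := val3 w1 w2 w3 t o - W1 in hE.
(* A point of the top layer at height below [w1] would be retracted out of the slab. Such a point is
   isolated, hence its class is a single point and the claim is known. *)
have [nB|isoB] := pselect (forall x, B x -> w1 <= val3 w1 w2 w3 t x \/ val3 w1 w2 w3 t x < W1 - w1); last first.
  apply: full; apply: (slab_unicyclic_single c); left.
  have [x [Bx [lo hi]]] : exists x, B x /\ (val3 w1 w2 w3 t x < w1 /\ W1 - w1 <= val3 w1 w2 w3 t x).
    apply: contrapT => no; apply: isoB => x Bx; have [lo|hi] := lerP w1 (val3 w1 w2 w3 t x); first by left.
    by right; rewrite ltNge; apply/negP => ge; apply: no; exists x.
  by exists x; apply: (isolated_in_window h1 w12 w13 hB cB Bx lo hi).
have [nE|isoE] := pselect (forall x, E x -> w1 <= val3 w1 w2 w3 t0 x \/ val3 w1 w2 w3 t0 x < W0 - w1); last first.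
  apply: full; apply: (slab_unicyclic_single c); right.
  have [x [Ex [lo hi]]] : exists x, E x /\ (val3 w1 w2 w3 t0 x < w1 /\ W0 - w1 <= val3 w1 w2 w3 t0 x).
    apply: contrapT => no; apply: isoE => x Ex; have [lo|hi] := lerP w1 (val3 w1 w2 w3 t0 x); first by left.
    by right; rewrite ltNge; apply/negP => ge; apply: no; exists x.
  by exists x; apply: (isolated_in_window h1 w12 w13 hE cE Ex lo hi).
have c' := cfg3_reduced c w1_gt0 w12 w13 (And3 a1 a2 a3) (And3 b1 b2 b3) nB nE.
(* [W1] is [w1 + w2 + w3 - W0], and [W0] exceeds every weight. *)
have [q1 q2] : W1 < w1 + w2 /\ W1 < w1 + w3 by split; lra.
have [r1 r2] : W0 < w1 + w2 /\ W0 < w1 + w3 by split; lra.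
move=> CB CE DB DE hCB hCE hDB hDE nC nD le.
have k1 := reduce_chain w12 w13 q1 q2 hB hCB.
have k2 := reduce_chain w12 w13 r1 r2 hE hCE.
have k3 := reduce_chain w12 w13 q1 q2 hB hDB.
have k4 := reduce_chain w12 w13 r1 r2 hE hDE.
have l1 := reduce_size_le w1 w2 w3 W1 t CB.
have l2 := reduce_size_le w1 w2 w3 W0 t0 CE.
have l3 := reduce_size_le w1 w2 w3 W1 t DB.
have l4 := reduce_size_le w1 w2 w3 W0 t0 DE.
have [|||e1 e2 fin] := IH _ _ _ _ _ _ _ _ _ c' _ _ _ _ k1 k2 k3 k4.
- move: nC; rewrite addn_gt0 => /orP[] z; rewrite addn_gt0.
    by rewrite (reduce_size_gt0 w12 w13 q1 q2 hB hCB z).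
  by rewrite (reduce_size_gt0 w12 w13 r1 r2 hE hCE z) orbT.
- move: nD; rewrite addn_gt0 => /orP[] z; rewrite addn_gt0.
    by rewrite (reduce_size_gt0 w12 w13 q1 q2 hB hDB z).
  by rewrite (reduce_size_gt0 w12 w13 r1 r2 hE hDE z) orbT.
- rewrite -ltnS; apply: leq_trans le; move: nC; rewrite addn_gt0 => /orP[] z.
    have := reduce_size_lt w12 w13 q1 q2 hB hCB z; move: l2 l3 l4; clear; lia.
  have := reduce_size_lt w12 w13 r1 r2 hE hCE z; move: l1 l3 l4; clear; lia.
- split.
  + exact: (reduce_inj w12 w13 q1 q2 hB hCB hDB e1).
  + exact: (reduce_inj w12 w13 r1 r2 hE hCE hDE e2).
  + exact: reduced_finite fin.
Qed.

Lemma slab_unicyclic_all n (w1 w2 w3 W1 W0 t : R) o B E :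
  cfg3 w1 w2 w3 W1 W0 t o B E -> slab_unicyclic_upto n B E.
Proof.
elim: n w1 w2 w3 W1 W0 t o B E => [|n IH] w1 w2 w3 W1 W0 t o B E c.
  move=> CB CE DB DE _ _ _ _ nC _ le; exfalso; move: nC le; clear; lia.
have c' := cfg3_rot c; have c'' := cfg3_rot c'.
have [w12|w21] := lerP w1 w2; have [w13|w31] := lerP w1 w3.
- exact: slab_unicyclic_step c w12 w13.
- apply/slab_unicyclic_upto_rot/slab_unicyclic_upto_rot.
  apply: slab_unicyclic_step IH c'' _ _; lra.
- apply/slab_unicyclic_upto_rot; apply: slab_unicyclic_step IH c' _ _; lra.
- have [w23|w32] := lerP w2 w3.
    apply/slab_unicyclic_upto_rot; apply: slab_unicyclic_step IH c' _ _; lra.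
  apply/slab_unicyclic_upto_rot/slab_unicyclic_upto_rot.
  apply: slab_unicyclic_step IH c'' _ _; lra.
Qed.

Lemma cfg3_slab_unicyclic (w1 w2 w3 W1 W0 t : R) o B E :
  cfg3 w1 w2 w3 W1 W0 t o B E -> slab_unicyclic B E.
Proof.
move=> c CB CE DB DE h1 h2 h3 h4 n1 n2.
by apply: (slab_unicyclic_all c h1 h2 h3 h4 n1 n2 (leqnn _)).
Qed.
End Descent.

(** * Even sets of edges *)

Definition f1 (x : Z2) : Z2 := (x.1 + 1, x.2).
Definition f2 (x : Z2) : Z2 := (x.1, x.2 + 1).
Definition f3 (x : Z2) : Z2 := (x.1 - 1, x.2 - 1).
Definition g1 (x : Z2) : Z2 := (x.1 - 1, x.2).
Definition g2 (x : Z2) : Z2 := (x.1, x.2 - 1).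
Definition g3 (x : Z2) : Z2 := (x.1 + 1, x.2 + 1).

Lemma f3K x : g3 (f3 x) = x. Proof. by case: x => ? ?; rewrite /f3 /g3 /= !subrK. Qed.
Lemma g1K x : f1 (g1 x) = x. Proof. by case: x => ? ?; rewrite /f1 /g1 /= subrK. Qed.
Lemma g2K x : f2 (g2 x) = x. Proof. by case: x => ? ?; rewrite /f2 /g2 /= subrK. Qed.
Lemma g3K x : f3 (g3 x) = x. Proof. by case: x => ? ?; rewrite /f3 /g3 /= !addrK. Qed.

Lemma hexadjP x y : hexadj x y ->
  [\/ y = f1 x, y = f2 x | y = f3 x] \/ [\/ y = g1 x, y = g2 x | y = g3 x].
Proof.
case: y => c d; rewrite /hexadj /= => /or4P[/andP[/eqP-> /eqP->]|/andP[/eqP-> /eqP->]|/andP[/eqP-> /eqP->]|].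
- by left; constructor 1.
- by right; constructor 1.
- by left; constructor 2.
case/or3P=> /andP[/eqP-> /eqP->].
- by right; constructor 2.
- by left; constructor 3.
- by right; constructor 3.
Qed.

Definition around (x : Z2) : seq Z2 := [:: f1 x; f2 x; f3 x; g1 x; g2 x; g3 x].

Lemma around_uniq x : uniq (around x).
Proof.
case: x => a b; rewrite /around /f1 /f2 /f3 /g1 /g2 /g3 /= !inE !xpair_eqE; lia.
Qed.

Lemma mem_around x y : hexadj x y -> y \in around x.
Proof. by move/hexadjP=> -[] [] ->; rewrite /around !inE eqxx ?orbT. Qed.

Lemma xor_around (h : rel Z2) x :
  h x (f1 x) (+) h x (f2 x) (+) h x (f3 x) (+) h x (g1 x) (+) h x (g2 x) (+) h x (g3 x)
  = odd (count (h x) (around x)).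
Proof. by rewrite /= !oddD !oddb addbF !addbA. Qed.

Definition even_core (B E : Z2 -> Prop) (h : rel Z2) : Prop :=
  [/\ symmetric h,
      forall x y, h x y -> hexadj x y /\ ((B x /\ B y) \/ (E x /\ E y)),
      exists l : seq Z2, forall x y, h x y -> x \in l,
      exists x y, h x y &
      forall x, h x (f1 x) (+) h x (f2 x) (+) h x (f3 x) (+)
        h x (g1 x) (+) h x (g2 x) (+) h x (g3 x) = false].

Lemma even_core_leafless B E h : even_core B E h -> leafless h.
Proof.
case=> hsym hm _ _ par x y xy.
apply: (@even_count_other _ (h x) (around x) y) => //.
- exact: around_uniq.
- by rewrite -xor_around.
- by have [a _] := hm _ _ xy; apply: mem_around.
Qed.

Lemma even_core_mono B E h : even_core B E h -> mono_core hexadj B E h.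
Proof.
move=> ev; have lf := even_core_leafless ev.
by case: ev => hsym hm [l hl] ne par; split=> //; [move=> x y; rewrite hsym | exists l].
Qed.

Section Lift.
Variables (R : realFieldType) (w1 w2 w3 S t c L : R) (P : Z2 -> Prop) (n : Z2 -> int).
Let th (x : Z2) := t + x.1%:~R * w1 + x.2%:~R * w2.
Hypotheses (defS : S = w1 + w2 + w3) (w_gt0 : [/\ 0 < w1, 0 < w2 & 0 < w3]).
Hypothesis L_lt : [/\ L < S - w1, L < S - w2 & L < S - w3].
Hypothesis nP : forall x, P x -> c <= th x + (n x)%:~R * S < c + L.

(** The point over [x] whose value is the lifted phase, [n x] being its winding number. *)
Definition lift3 (x : Z2) : Z3 := (x.1 + n x, x.2 + n x, n x).

Lemma lift3K x : proj3 (lift3 x) = x.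
Proof. by case: x => a b; rewrite /proj3 /lift3 /= !addrK. Qed.

Lemma val_lift3 x : val3 w1 w2 w3 t (lift3 x) = th x + (n x)%:~R * S.
Proof. by rewrite val_proj3 lift3K defS. Qed.

Lemma lift3_f1 x : P x -> P (f1 x) -> lift3 (f1 x) = s1 (lift3 x).
Proof.
have [h1 h2 h3] := w_gt0; have [l1 l2 l3] := L_lt; have S0 : 0 < S by have := defS; lra.
move=> /nP hx /nP hy; suff e : n x = n (f1 x).
  by rewrite /lift3 /s1 -e /=; congr (_, _, _); ring.
apply: (winding0 (w := w1) (w3 := L) S0 _ _ _ _ hx); [lra|have := defS; lra|lra|lra|].
by move: hy; rewrite /th /f1 /= rmorphD mulrDl mul1r; lra.
Qed.

Lemma lift3_f2 x : P x -> P (f2 x) -> lift3 (f2 x) = s2 (lift3 x).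
Proof.
have [h1 h2 h3] := w_gt0; have [l1 l2 l3] := L_lt; have S0 : 0 < S by have := defS; lra.
move=> /nP hx /nP hy; suff e : n x = n (f2 x).
  by rewrite /lift3 /s2 -e /=; congr (_, _, _); ring.
apply: (winding0 (w := w2) (w3 := L) S0 _ _ _ _ hx); [lra|have := defS; lra|lra|lra|].
by move: hy; rewrite /th /f2 /= rmorphD mulrDl mul1r; lra.
Qed.

Lemma lift3_f3 x : P x -> P (f3 x) -> lift3 (f3 x) = s3 (lift3 x).
Proof.
have [h1 h2 h3] := w_gt0; have [l1 l2 l3] := L_lt; have S0 : 0 < S by have := defS; lra.
(* A step by [w3] is a step by [- (w1 + w2)] followed by a full turn, so the winding number grows by
   one. *)
move=> /nP hx /nP hy; suff e : n x = n (f3 x) - 1.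
  by rewrite /lift3 /s3 e /=; congr (_, _, _); ring.
apply: (winding0 (w := w3) (w3 := L) S0 _ _ _ _ hx); [lra|have := defS; lra|lra|lra|].
by move: hy; rewrite /th /f3 /= !rmorphB !mulrBl !mul1r; have := defS; lra.
Qed.

Lemma lift3_step x y : P x -> P y -> hexadj x y -> step3 (lift3 x) (lift3 y).
Proof.
move=> Px Py /hexadjP[] [] e; rewrite e in Py *.
- by left; constructor 1; apply: lift3_f1.
- by left; constructor 2; apply: lift3_f2.
- by left; constructor 3; apply: lift3_f3.
- by right; constructor 1; rewrite -{1}[x]g1K; apply: lift3_f1; rewrite ?g1K.
- by right; constructor 2; rewrite -{1}[x]g2K; apply: lift3_f2; rewrite ?g2K.
- by right; constructor 3; rewrite -{1}[x]g3K; apply: lift3_f3; rewrite ?g3K.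
Qed.

Definition lifted X := exists x, P x /\ X = lift3 x.

Lemma lifted_connected : connected P hexadj -> connected lifted step3.
Proof.
move=> cP _ _ [x [Px ->]] [y [Py ->]].
elim: {y Py} (cP _ _ Px Py) => [|u v xu IH Pv uv]; first exact: reach_refl.
have Pu : P u by apply: reach_in xu.
by apply: reach_step IH _ (lift3_step Pu Pv uv); exists v.
Qed.

Section LiftCore.
Variable h : rel Z2.
Variable l : seq Z2.
Hypothesis hsym : symmetric h.
Hypothesis hl : forall x y, h x y -> x \in l.
Hypothesis hP : forall x y, h x y -> P x -> P y.
Hypothesis par : forall x, h x (f1 x) (+) h x (f2 x) (+) h x (f3 x) (+)
        h x (g1 x) (+) h x (g2 x) (+) h x (g3 x) = false.

Definition lift_edges (f : Z2 -> Z2) := map lift3 [seq x <- l | `[< P x >] && h x (f x)].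

Definition lift_chain := Chain3 (lift_edges f1) (lift_edges f2) (lift_edges f3).

Lemma mem_lift_edges f X : reflect [/\ X = lift3 (proj3 X), P (proj3 X) & h (proj3 X) (f (proj3 X))]
  (X \in lift_edges f).
Proof.
apply: (iffP mapP) => [[x + ->]|[e PX hX]].
  by rewrite mem_filter lift3K => /andP[/andP[/asboolP Px hx] _].
exists (proj3 X) => //; rewrite mem_filter hX (hl hX) !andbT.
by apply/asboolP.
Qed.

Lemma lift_edges_lift f x : P x -> (lift3 x \in lift_edges f) = h x (f x).
Proof.
by move=> Px; apply/mem_lift_edges/idP; rewrite lift3K // => -[].
Qed.

Lemma lift_edges_p1 X : p1 X \in lift_edges f1 ->
  [/\ X = lift3 (proj3 X), P (proj3 X) & h (proj3 X) (g1 (proj3 X))].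
Proof.
have pE : proj3 (p1 X) = g1 (proj3 X) by rewrite /proj3 /g1 /p1 /=; congr (_, _); ring.
case/mem_lift_edges; rewrite pE g1K => e Pg hg; have Px := hP hg Pg.
split=> //; last by rewrite hsym.
by rewrite -{1}[X]p1K e -lift3_f1 ?g1K.
Qed.
Lemma lift_edges_p2 X : p2 X \in lift_edges f2 ->
  [/\ X = lift3 (proj3 X), P (proj3 X) & h (proj3 X) (g2 (proj3 X))].
Proof.
have pE : proj3 (p2 X) = g2 (proj3 X) by rewrite /proj3 /g2 /p2 /=; congr (_, _); ring.
case/mem_lift_edges; rewrite pE g2K => e Pg hg; have Px := hP hg Pg.
split=> //; last by rewrite hsym.
by rewrite -{1}[X]p2K e -lift3_f2 ?g2K.
Qed.
Lemma lift_edges_p3 X : p3 X \in lift_edges f3 ->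
  [/\ X = lift3 (proj3 X), P (proj3 X) & h (proj3 X) (g3 (proj3 X))].
Proof.
have pE : proj3 (p3 X) = g3 (proj3 X) by rewrite /proj3 /g3 /p3 /=; congr (_, _); ring.
case/mem_lift_edges; rewrite pE g3K => e Pg hg; have Px := hP hg Pg.
split=> //; last by rewrite hsym.
by rewrite -{1}[X]p3K e -lift3_f3 ?g3K.
Qed.

Lemma lift_is_chain : is_chain lifted lift_chain.
Proof.
split=> X /=.
- move=> /mem_lift_edges[e PX hX]; split; first by exists (proj3 X).
  by exists (f1 (proj3 X)); have Pf := hP hX PX; rewrite lift3_f1 // -e.
- move=> /mem_lift_edges[e PX hX]; split; first by exists (proj3 X).
  by exists (f2 (proj3 X)); have Pf := hP hX PX; rewrite lift3_f2 // -e.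
- move=> /mem_lift_edges[e PX hX]; split; first by exists (proj3 X).
  by exists (f3 (proj3 X)); have Pf := hP hX PX; rewrite lift3_f3 // -e.
have [[PX e]|no] := pselect (P (proj3 X) /\ X = lift3 (proj3 X)); last first.
  have F f : (X \in lift_edges f) = false.
    by apply/negP => /mem_lift_edges[e PX _]; apply: no.
  rewrite !F.
  have -> : (p1 X \in lift_edges f1) = false by apply/negP => /lift_edges_p1[e PX _]; apply: no.
  have -> : (p2 X \in lift_edges f2) = false by apply/negP => /lift_edges_p2[e PX _]; apply: no.
  by have -> : (p3 X \in lift_edges f3) = false by apply/negP => /lift_edges_p3[e PX _]; apply: no.
set x := proj3 X in PX e.
have E1 : (p1 X \in lift_edges f1) = h x (g1 x).
  apply/idP/idP => [/lift_edges_p1[]//|hx].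
  have Pg := hP hx PX; have eg : lift3 (g1 x) = p1 X.
    by rewrite e -{2}[x]g1K lift3_f1 ?g1K // s1K.
  by rewrite -eg lift_edges_lift // g1K hsym.
have E2 : (p2 X \in lift_edges f2) = h x (g2 x).
  apply/idP/idP => [/lift_edges_p2[]//|hx].
  have Pg := hP hx PX; have eg : lift3 (g2 x) = p2 X.
    by rewrite e -{2}[x]g2K lift3_f2 ?g2K // s2K.
  by rewrite -eg lift_edges_lift // g2K hsym.
have E3 : (p3 X \in lift_edges f3) = h x (g3 x).
  apply/idP/idP => [/lift_edges_p3[]//|hx].
  have Pg := hP hx PX; have eg : lift3 (g3 x) = p3 X.
    by rewrite e -{2}[x]g3K lift3_f3 ?g3K // s3K.
  by rewrite -eg lift_edges_lift // g3K hsym.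
by rewrite E1 E2 E3 e !lift_edges_lift // par.
Qed.

Lemma lift_chain_size x y : P x -> h x y -> hexadj x y -> (0 < chain_size lift_chain)%N.
Proof.
have pos (s : seq Z3) X : X \in s -> (0 < size s)%N by case: s.
have gt0 f z : P z -> h z (f z) -> (0 < size (lift_edges f))%N.
  by move=> Pz hz; apply: (pos _ (lift3 z)); rewrite lift_edges_lift.
move=> Px hxy; rewrite /chain_size /= !addn_gt0; have Py := hP hxy Px.
case/hexadjP=> -[] e; rewrite e in hxy Py.
- by rewrite (gt0 f1 x).
- by rewrite (gt0 f2 x) ?orbT.
- by rewrite (gt0 f3 x) ?orbT.
- by rewrite (gt0 f1 (g1 x)) // g1K hsym.
- by rewrite (gt0 f2 (g2 x)) ?orbT // g2K hsym.
- by rewrite (gt0 f3 (g3 x)) ?orbT // g3K hsym.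
Qed.
End LiftCore.

Lemma lift_chain_eq (h h' : rel Z2) (l l' : seq Z2) x y :
  symmetric h -> symmetric h' ->
  (forall x y, h x y -> x \in l) -> (forall x y, h' x y -> x \in l') ->
  (forall x y, h x y -> P x -> P y) ->
  eq_chain (lift_chain h l) (lift_chain h' l') ->
  P x -> hexadj x y -> h x y -> h' x y.
Proof.
move=> hs hs' hl hl' hP [e1 e2 e3] Px xy hxy; have Py := hP _ _ hxy Px.
case/hexadjP: xy => -[] e; rewrite e in hxy Py *.
- by rewrite -(lift_edges_lift hl' f1 Px) -e1 lift_edges_lift.
- by rewrite -(lift_edges_lift hl' f2 Px) -e2 lift_edges_lift.
- by rewrite -(lift_edges_lift hl' f3 Px) -e3 lift_edges_lift.
- by rewrite hs' -{2}[x]g1K -(lift_edges_lift hl' f1 Py) -e1 lift_edges_lift // g1K hs.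
- by rewrite hs' -{2}[x]g2K -(lift_edges_lift hl' f2 Py) -e2 lift_edges_lift // g2K hs.
- by rewrite hs' -{2}[x]g3K -(lift_edges_lift hl' f3 Py) -e3 lift_edges_lift // g3K hs.
Qed.
End Lift.

Section EvenUnique.
Variable R : realFieldType.

Lemma hexcfg_cfg3 (w1 w2 w3 S W1 W0 t : R) B E (nB nE : Z2 -> int) :
  hexcfg w1 w2 w3 S W1 W0 t B E -> [/\ 0 < w1, 0 < w2 & 0 < w3] ->
  [/\ w1 < W1, w2 < W1 & w3 < W1] -> [/\ w1 < W0, w2 < W0 & w3 < W0] ->
  (forall x, B x -> 0 <= t + x.1%:~R * w1 + x.2%:~R * w2 + (nB x)%:~R * S < W1) ->
  (forall x, E x -> W1 <= t + x.1%:~R * w1 + x.2%:~R * w2 + (nE x)%:~R * S < S) ->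
  cfg3 w1 w2 w3 W1 W0 t (0, 0, 0) (lifted B nB) (lifted E nE).
Proof.
move=> c [h1 h2 h3] [a1 a2 a3] [b1 b2 b3] hB hE.
have [_ g0 [defS sumW] _ _ cB cE BE EB] := c.
have add30 x : add3 x (0, 0, 0) = x.
  by case: x => [[? ?] ?]; rewrite /add3 /= !addr0.
have hB' x : B x -> 0 <= t + x.1%:~R * w1 + x.2%:~R * w2 + (nB x)%:~R * S < 0 + W1.
  by rewrite add0r; apply: hB.
have hE' x : E x -> W1 <= t + x.1%:~R * w1 + x.2%:~R * w2 + (nE x)%:~R * S < W1 + W0.
  by rewrite sumW; apply: hE.
have wgt : [/\ 0 < w1, 0 < w2 & 0 < w3] by [].
have LB : [/\ W1 < S - w1, W1 < S - w2 & W1 < S - w3] by split; lra.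
have LE : [/\ W0 < S - w1, W0 < S - w2 & W0 < S - w3] by split; lra.
(* From [B] to [E] the lifted phase increases by less than [S], which determines the winding number
   of the neighbour. The increase is the weight of the direction, or [S] minus it for a step against
   the direction. *)
have lk x y : B x -> E y -> hexadj x y -> link (0, 0, 0) (lift3 nB x) (lift3 nE y).
  move=> Bx Ey xy; have hx := hB _ Bx; have hy := hE _ Ey; rewrite /link add30.
  have S0 : 0 < S by lra.
  have [s1' [s2' s3']] : w1 <= S /\ w2 <= S /\ w3 <= S by split; [lra|split; lra].
  case/hexadjP: xy => -[] e; rewrite e {e Ey} in hy *.
  - left; constructor 1; have e : nB x = nE (f1 x).
      apply: (@winding_pos R S w1 (t + x.1%:~R * w1 + x.2%:~R * w2)); [lra|lra| |];
      move: hy; rewrite /f1 /= rmorphD mulrDl mul1r; lra.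
    by rewrite /lift3 /s1 -e /=; congr (_, _, _); ring.
  - left; constructor 2; have e : nB x = nE (f2 x).
      apply: (@winding_pos R S w2 (t + x.1%:~R * w1 + x.2%:~R * w2)); [lra|lra| |];
      move: hy; rewrite /f2 /= rmorphD mulrDl mul1r; lra.
    by rewrite /lift3 /s2 -e /=; congr (_, _, _); ring.
  - left; constructor 3; have e : nB x = nE (f3 x) - 1.
      apply: (@winding_pos R S w3 (t + x.1%:~R * w1 + x.2%:~R * w2)); [lra|lra| |];
      move: hy; rewrite /f3 /= !rmorphB !mulrBl !mul1r; lra.
    by rewrite /lift3 /s3 e /=; congr (_, _, _); ring.
  - right; constructor 3; have e : nB x = nE (g1 x) - 1.
      apply: (@winding_pos R S (S - w1) (t + x.1%:~R * w1 + x.2%:~R * w2)); [lra|lra| |];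
      move: hy; rewrite /g1 /= !rmorphB !mulrBl !mul1r; lra.
    by rewrite /lift3 /s2 /s3 e /=; congr (_, _, _); ring.
  - right; constructor 2; have e : nB x = nE (g2 x) - 1.
      apply: (@winding_pos R S (S - w2) (t + x.1%:~R * w1 + x.2%:~R * w2)); [lra|lra| |];
      move: hy; rewrite /g2 /= !rmorphB !mulrBl !mul1r; lra.
    by rewrite /lift3 /s1 /s3 e /=; congr (_, _, _); ring.
  - right; constructor 1; have e : nB x = nE (g3 x).
      apply: (@winding_pos R S (S - w3) (t + x.1%:~R * w1 + x.2%:~R * w2)); [lra|lra| |];
      move: hy; rewrite /g3 /= !rmorphD !mulrDl !mul1r; lra.
    by rewrite /lift3 /s1 /s2 -e /=; congr (_, _, _); ring.
split.
- by split; lra.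
- by [].
- by rewrite sumW.
- by move=> _ [x [Bx ->]]; rewrite (val_lift3 _ _ defS); apply: hB.
- move=> _ [x [Ex ->]]; rewrite val_add3 add30 (val_lift3 _ _ defS).
  by have := hE _ Ex; lra.
- exact: (lifted_connected defS wgt LB hB' cB).
- exact: (lifted_connected defS wgt LE hE' cE).
- move=> _ [x [Bx ->]]; have [y [Ey xy]] := BE _ Bx.
  by exists (lift3 nE y); split; [exists y | apply: lk].
- move=> _ [y [Ey ->]]; have [x [Bx yx]] := EB _ Ey.
  by exists (lift3 nB x); split; [exists x | apply/lk/hexadj_sym].
Qed.

Lemma hexcfg_even_unique (w1 w2 w3 S W1 W0 t : R) B E h h' :
  hexcfg w1 w2 w3 S W1 W0 t B E -> [/\ 0 < w1, 0 < w2 & 0 < w3] ->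
  even_core B E h -> even_core B E h' ->
  h =2 h' /\ exists l : seq Z2, forall x, B x \/ E x -> x \in l.
Proof.
move=> c wgt ev ev'; have dis := hexcfg_disjoint c.
have [base|nobase] := pselect ([\/ W1 <= w1, W1 <= w2 | W1 <= w3] \/ [\/ W0 <= w1, W0 <= w2 | W0 <= w3]).
  have [e fin] := hexcfg_base c base (even_core_mono ev) (even_core_mono ev').
  by split=> // x y; apply/idP/idP => /e.
have [a b] : [/\ w1 < W1, w2 < W1 & w3 < W1] /\ [/\ w1 < W0, w2 < W0 & w3 < W0].
  split; split; rewrite ltNge; apply/negP => le; apply: nobase;
  [left; by constructor 1|left; by constructor 2|left; by constructor 3
  |right; by constructor 1|right; by constructor 2|right; by constructor 3].
(* The winding number is chosen at every lattice point, with default value 0 outside the class. *)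
have [nB hB] : {nB : Z2 -> int & forall x, B x ->
    0 <= t + x.1%:~R * w1 + x.2%:~R * w2 + (nB x)%:~R * S < W1}.
  apply: (@choice _ _ (fun x n => B x -> 0 <= t + x.1%:~R * w1 + x.2%:~R * w2 + n%:~R * S < W1)) => x.
  by have [/(hc_B c)[n hn]|no] := pselect (B x); [exists n | exists 0].
have [nE hE] : {nE : Z2 -> int & forall x, E x ->
    W1 <= t + x.1%:~R * w1 + x.2%:~R * w2 + (nE x)%:~R * S < S}.
  apply: (@choice _ _ (fun x n => E x -> W1 <= t + x.1%:~R * w1 + x.2%:~R * w2 + n%:~R * S < S)) => x.
  by have [/(hc_E c)[n hn]|no] := pselect (E x); [exists n | exists 0].
have c3' := hexcfg_cfg3 c wgt a b hB hE.
have [_ _ [defS sumW] _ _ _ _ BE _] := c.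
have hB' x : B x -> 0 <= t + x.1%:~R * w1 + x.2%:~R * w2 + (nB x)%:~R * S < 0 + W1.
  by rewrite add0r; apply: hB.
have hE' x : E x -> W1 <= t + x.1%:~R * w1 + x.2%:~R * w2 + (nE x)%:~R * S < W1 + W0.
  by rewrite sumW; apply: hE.
have LB : [/\ W1 < S - w1, W1 < S - w2 & W1 < S - w3] by case: b => ? ? ?; split; lra.
have LE : [/\ W0 < S - w1, W0 < S - w2 & W0 < S - w3] by case: a => ? ? ?; split; lra.
have [hs hm [l hl] [x0 [y0 h0]] par] := ev.
have [hs' hm' [l' hl'] [x0' [y0' h0']] par'] := ev'.
have hPB x y : h x y -> B x -> B y by move=> /hm[_ [[]//|[Ex _]]] Bx; case: (dis x).
have hPE x y : h x y -> E x -> E y by move=> /hm[_ [[Bx _]|[]//]] Ex; case: (dis x).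
have hPB' x y : h' x y -> B x -> B y by move=> /hm'[_ [[]//|[Ex _]]] Bx; case: (dis x).
have hPE' x y : h' x y -> E x -> E y by move=> /hm'[_ [[Bx _]|[]//]] Ex; case: (dis x).
have k1 := lift_is_chain defS wgt LB hB' hs hl hPB par.
have k2 := lift_is_chain defS wgt LE hE' hs hl hPE par.
have k3 := lift_is_chain defS wgt LB hB' hs' hl' hPB' par'.
have k4 := lift_is_chain defS wgt LE hE' hs' hl' hPE' par'.
have [||e1 e2 [l3 hl3]] := cfg3_slab_unicyclic c3' k1 k2 k3 k4.
- have [xy [[Bx _]|[Ex _]]] := hm _ _ h0; rewrite addn_gt0.
    by rewrite (lift_chain_size nB hs hl hPB Bx h0 xy).
  by rewrite (lift_chain_size nE hs hl hPE Ex h0 xy) orbT.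
- have [xy [[Bx _]|[Ex _]]] := hm' _ _ h0'; rewrite addn_gt0.
    by rewrite (lift_chain_size nB hs' hl' hPB' Bx h0' xy).
  by rewrite (lift_chain_size nE hs' hl' hPE' Ex h0' xy) orbT.
have e1' : eq_chain (lift_chain B nB h' l') (lift_chain B nB h l).
  by case: e1 => u v w; split=> x; rewrite ?u ?v ?w.
have e2' : eq_chain (lift_chain E nE h' l') (lift_chain E nE h l).
  by case: e2 => u v w; split=> x; rewrite ?u ?v ?w.
split.
  move=> x y; apply/idP/idP => hxy.
    have [xy [[Bx _]|[Ex _]]] := hm _ _ hxy.
      exact: (lift_chain_eq hs hs' hl hl' hPB e1 Bx xy hxy).
    exact: (lift_chain_eq hs hs' hl hl' hPE e2 Ex xy hxy).
  have [xy [[Bx _]|[Ex _]]] := hm' _ _ hxy.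
    exact: (lift_chain_eq hs' hs hl' hl hPB' e1' Bx xy hxy).
  exact: (lift_chain_eq hs' hs hl' hl hPE' e2' Ex xy hxy).
have El x : E x -> x \in map proj3 l3.
  by move=> Ex; rewrite -[x](lift3K nE) map_f //; apply: hl3; exists x.
exists (map proj3 l3 ++ flatten [seq hex_nbrs x | x <- map proj3 l3]) => x.
rewrite mem_cat => -[Bx|/El->//].
have [w [/El wl xw]] := BE _ Bx; apply/orP; right.
by apply/flatten_mapP; exists w => //; apply/mem_hex_nbrs/hexadj_sym.
Qed.
End EvenUnique.

(** * Lattice paths *)

(* The two common neighbours of adjacent points: the rotation of the lattice by
   a sixth of a turn is [(a, b) |-> (a - b, a)]. *)
Definition ccw (x y : Z2) : Z2 := (x.1 + (y.1 - x.1) - (y.2 - x.2), x.2 + (y.1 - x.1)).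
Definition cw (x y : Z2) : Z2 := (x.1 + (y.2 - x.2), x.2 + (y.2 - x.2) - (y.1 - x.1)).

Lemma ccwC x y : ccw y x = cw x y.
Proof. by case: x y => [? ?] [? ?]; rewrite /ccw /cw /=; congr (_, _); ring. Qed.
Lemma cwC x y : cw y x = ccw x y.
Proof. by rewrite -ccwC. Qed.

Definition opposite (x y u : Z2) : Z2 := (x.1 + y.1 - u.1, x.2 + y.2 - u.2).

Lemma opposite_ccw x y : opposite x y (ccw x y) = cw x y.
Proof. by case: x y => [? ?] [? ?]; rewrite /opposite /ccw /cw /=; congr (_, _); ring. Qed.
Lemma opposite_cw x y : opposite x y (cw x y) = ccw x y.
Proof. by case: x y => [? ?] [? ?]; rewrite /opposite /ccw /cw /=; congr (_, _); ring. Qed.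

Lemma common_nbr x y u : hexadj x y -> hexadj x u -> hexadj y u ->
  u = ccw x y \/ u = cw x y.
Proof.
case: x y u => [a b] [c d] [e f]; rewrite /hexadj /ccw /cw /= => h1 h2 h3.
have : ((e == a + (c - a) - (d - b)) && (f == b + (c - a))) ||
       ((e == a + (d - b)) && (f == b + (d - b) - (c - a))) by move: h1 h2 h3; clear; lia.
by case/orP=> /andP[/eqP -> /eqP ->]; [left|right].
Qed.

Lemma hexadj_irr x : hexadj x x = false.
Proof. by case: x => a b; rewrite /hexadj /=; lia. Qed.

Lemma hexadj_ccw x y : hexadj x y -> hexadj x (ccw x y) /\ hexadj y (ccw x y).
Proof. by case: x y => [a b] [c d]; rewrite /hexadj /ccw /=; split; lia. Qed.
Lemma hexadj_cw x y : hexadj x y -> hexadj x (cw x y) /\ hexadj y (cw x y).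
Proof. by case: x y => [a b] [c d]; rewrite /hexadj /cw /=; split; lia. Qed.

(** A vertex of the cycle has exactly two neighbours along it, the successor and the predecessor;
    any other vertex has none. *)
Lemma cycle_even_core (B E P : Z2 -> Prop) c : P = B \/ P = E ->
  (2 < size c)%N -> ucycle (fun x y => hexadj x y && `[< P x >] && `[< P y >]) c ->
  even_core B E (cycle_edge c).
Proof.
move=> PE sc /andP[cc uc].
have rsym : symmetric (fun x y => hexadj x y && `[< P x >] && `[< P y >]).
  move=> x y; rewrite andbAC; congr (_ && _ && _).
  by apply/idP/idP; apply: hexadj_sym.
have edgeP x y : cycle_edge c x y -> [/\ hexadj x y, P x & P y].
  by move=> /(cycle_edge_rel rsym cc) /andP[/andP[a /asboolP Px] /asboolP Py].
split.
- exact: cycle_edge_sym.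
- move=> x y /edgeP[a Px Py]; split=> //.
  by case: PE => e; rewrite e in Px Py; [left|right].
- by exists c => x y; apply: cycle_edge_in.
- case: c {cc uc edgeP} sc => // x c _.
  by exists x, (next (x :: c) x); apply: cycle_edge_next; rewrite mem_head.
move=> x; rewrite xor_around.
have [xc|xc] := boolP (x \in c); last first.
  rewrite (eq_count (a2 := pred0)) ?count_pred0 // => y.
  by apply/negP => /cycle_edge_in; apply/negP.
have np := next_neq_prev uc sc xc.
rewrite (eq_count (a2 := predU (pred1 (next c x)) (pred1 (prev c x)))); last first.
  by move=> y; rewrite cycle_edgeE.
have an : next c x \in around x by apply/mem_around; have [] := edgeP _ _ (cycle_edge_next xc).
have ap : prev c x \in around x.
  have e : cycle_edge c x (prev c x) by rewrite cycle_edgeE // eqxx orbT.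
  by apply/mem_around; have [] := edgeP _ _ e.
have := count_predUI (pred1 (next c x)) (pred1 (prev c x)) (around x).
rewrite !count_uniq_mem ?around_uniq // an ap [count (predI _ _) _](eq_count (a2 := pred0)).
  by rewrite count_pred0 addn0 => ->.
by move=> y /=; apply/negP => /andP[/eqP-> /eqP]; apply/eqP.
Qed.

Lemma int_ind2 (P : int -> Prop) : P 0 -> (forall j, P j -> P (j + 1)) ->
  (forall j, P (j + 1) -> P j) -> forall j, P j.
Proof.
move=> P0 up dn; elim/int_ind => [//|n IH|n IH].
  by rewrite -addn1 PoszD; apply: up.
by apply: dn; rewrite -addn1 PoszD opprD subrK.
Qed.

(** The combinatorial trace of a colored trajectory: [w j] and [b j] are the ends of a crossed edge
    and [z j] is the third vertex of the tile entered through it. *)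
Record lattice_path (w b z : int -> Z2) : Prop := LatticePath {
  lp_tri : forall j, [/\ hexadj (w j) (b j), hexadj (w j) (z j) & hexadj (b j) (z j)];
  lp_step : forall j,
    [/\ w (j + 1) = w j, b (j + 1) = z j & z (j + 1) = opposite (w j) (z j) (b j)] \/
    [/\ b (j + 1) = b j, w (j + 1) = z j & z (j + 1) = opposite (b j) (z j) (w j)] }.

Lemma lattice_pathC w b z : lattice_path w b z -> lattice_path b w z.
Proof.
case=> tr st; split=> j; last by case: (st j); [right|left].
by have [wb wz bz] := tr j; split=> //; apply: hexadj_sym.
Qed.

Lemma path_connected_b w b z : lattice_path w b z ->
  connected (fun x => exists j, x = b j) hexadj.
Proof.
move=> lp; set B := (B in connected B _).
suff c0 j : reach B hexadj (b 0) (b j) /\ reach B hexadj (b j) (b 0).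
  by move=> _ _ [i ->] [j ->]; apply: (reach_trans (c0 i).2 (c0 j).1).
have st i : reach B hexadj (b i) (b (i + 1)) /\ reach B hexadj (b (i + 1)) (b i).
  have [_ _ a] := lp_tri lp i.
  case: (lp_step lp i) => -[e e' _]; last by rewrite e; split; exact: reach_refl.
  rewrite e'; split; first by apply: reach_step (reach_refl _ _ _) _ a; exists (i + 1); rewrite e'.
  by apply: reach_step (reach_refl _ _ _) _ (hexadj_sym a); exists i.
elim/int_ind2: j => [|j [h1 h2]|j [h1 h2]]; first by split; exact: reach_refl.
  by split; [apply: reach_trans h1 (st j).1 | apply: reach_trans (st j).2 h2].
by split; [apply: reach_trans h1 (st j).2 | apply: reach_trans (st j).1 h2].
Qed.

Lemma path_connected_w w b z : lattice_path w b z ->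
  connected (fun x => exists j, x = w j) hexadj.
Proof. by move/lattice_pathC/path_connected_b. Qed.

Section LatticePath.
Variables (w b z : int -> Z2).
Hypothesis lp : lattice_path w b z.
Let B x := exists j, x = b j.
Let E x := exists j, x = w j.
Hypothesis BE : forall x, B x -> E x -> False.

Definition tile_pts j : seq Z2 := [:: w j; b j; z j].

Lemma path_opposite j : z j = ccw (w j) (b j) \/ z j = cw (w j) (b j).
Proof. by have [h1 h2 h3] := lp_tri lp j; apply: common_nbr. Qed.

Lemma prev_tile j : opposite (w (j + 1)) (b (j + 1)) (z (j + 1)) \in tile_pts j.
Proof.
rewrite /tile_pts !inE.
case: (lp_step lp j) => -[-> -> ->]; apply/or3P;
  [apply: Or32 | apply: Or31]; rewrite /opposite; apply/eqP;
  case: (w j) (b j) (z j) => [? ?] [? ?] [? ?] /=; congr (_, _); ring.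
Qed.

Definition in_path (x y u : Z2) : bool :=
  `[< exists j, [&& x \in tile_pts j, y \in tile_pts j & u \in tile_pts j] >].

Lemma in_pathC x y u : in_path x y u = in_path y x u.
Proof. by apply/asboolP/asboolP => -[j /and3P[h1 h2 h3]]; exists j; rewrite h1 h2. Qed.
Lemma in_pathCA x y u : in_path x y u = in_path x u y.
Proof. by apply/asboolP/asboolP => -[j /and3P[h1 h2 h3]]; exists j; rewrite h1 h2 h3. Qed.

(** One of the two triangles is the tile entered through the edge, the other is the tile of index
    [j - 1], which is left there. *)
Lemma crossed_both j : in_path (w j) (b j) (ccw (w j) (b j)) && in_path (w j) (b j) (cw (w j) (b j)).
Proof.
have here : in_path (w j) (b j) (z j).
  by apply/asboolP; exists j; rewrite /tile_pts !inE !eqxx ?orbT.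
have there : in_path (w j) (b j) (opposite (w j) (b j) (z j)).
  apply/asboolP; exists (j - 1); have := prev_tile (j - 1); rewrite subrK => ->.
  rewrite andbT /tile_pts !inE; have := lp_step lp (j - 1); rewrite subrK.
  by case=> -[-> -> _]; rewrite !eqxx ?orbT.
case: (path_opposite j) => e; rewrite e ?opposite_ccw ?opposite_cw in here there.
  by rewrite here there.
by rewrite here there.
Qed.

(* The sum modulo 2 of the boundaries of the tiles of the path. *)
Definition path_boundary (x y : Z2) : bool :=
  hexadj x y && (in_path x y (ccw x y) (+) in_path x y (cw x y)).

Lemma path_boundary_sym : symmetric path_boundary.
Proof.
move=> x y; rewrite /path_boundary (ccwC x y) (cwC x y) ![in_path y x _]in_pathC [in RHS]addbC.
by congr (_ && _); apply/idP/idP; apply: hexadj_sym.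
Qed.

Lemma path_boundary_crossed j : path_boundary (w j) (b j) = false.
Proof. by rewrite /path_boundary; have /andP[-> ->] := crossed_both j; rewrite andbF. Qed.

(** Two sides of a tile of the path are crossed, and there the boundary cancels; the third side
    joins vertices of the same color. *)
Lemma path_boundary_mono x y : path_boundary x y -> (B x /\ B y) \/ (E x /\ E y).
Proof.
move=> xy.
have zcol j : [/\ B (z j), z j = b (j + 1) & w (j + 1) = w j] \/ [/\ E (z j), z j = w (j + 1) & b (j + 1) = b j].
  by case: (lp_step lp j) => -[e1 e2 _]; [left|right]; split=> //; exists (j + 1).
have half : exists j, (x \in tile_pts j) && (y \in tile_pts j).
  have := xy; rewrite /path_boundary => /andP[_].
  case: (boolP (in_path x y (ccw x y))) => [/asboolP[j /and3P[h1 h2 _]] _|_ /asboolP[j /and3P[h1 h2 _]]];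
    by exists j; rewrite h1 h2.
have nxy : x != y by apply/eqP => e; move: xy; rewrite e /path_boundary hexadj_irr.
have Bb j : B (b j) by exists j.
have Ew j : E (w j) by exists j.
case: half => j; rewrite /tile_pts !inE.
case/andP=> /or3P[] /eqP ex /or3P[] /eqP ey; rewrite ex ey ?eqxx // in xy nxy *.
- by rewrite path_boundary_crossed in xy.
- case: (zcol j) => -[c e1 e2]; last by right.
  by rewrite e1 -e2 path_boundary_crossed in xy.
- by rewrite path_boundary_sym path_boundary_crossed in xy.
- case: (zcol j) => -[c e1 e2]; first by left.
  by rewrite e1 -e2 path_boundary_sym path_boundary_crossed in xy.
- case: (zcol j) => -[c e1 e2]; last by right.
  by rewrite e1 -e2 path_boundary_sym path_boundary_crossed in xy.
- case: (zcol j) => -[c e1 e2]; first by left.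
  by rewrite e1 -e2 path_boundary_crossed in xy.
Qed.

(** Each of the six triangles around [x] has two sides through [x], so it is counted twice. *)
Lemma path_boundary_even x : path_boundary x (f1 x) (+) path_boundary x (f2 x) (+)
  path_boundary x (f3 x) (+) path_boundary x (g1 x) (+) path_boundary x (g2 x) (+)
  path_boundary x (g3 x) = false.
Proof.
have e : ((ccw x (f1 x) = g3 x) * (cw x (f1 x) = g2 x) * (ccw x (f2 x) = g1 x) *
          (cw x (f2 x) = g3 x) * (ccw x (f3 x) = g2 x) * (cw x (f3 x) = g1 x)) *
         ((ccw x (g1 x) = f3 x) * (cw x (g1 x) = f2 x) * (ccw x (g2 x) = f1 x) *
          (cw x (g2 x) = f3 x) * (ccw x (g3 x) = f2 x) * (cw x (g3 x) = f1 x)).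
  by do !split; rewrite /ccw /cw /f1 /f2 /f3 /g1 /g2 /g3 /=; congr (_, _); ring.
have ad : [/\ hexadj x (f1 x), hexadj x (f2 x) & hexadj x (f3 x)] /\
          [/\ hexadj x (g1 x), hexadj x (g2 x) & hexadj x (g3 x)].
  by rewrite /hexadj /f1 /f2 /f3 /g1 /g2 /g3 /= !eqxx !orbT.
rewrite /path_boundary; case: ad => -[-> -> ->] [-> -> ->].
rewrite !e.
rewrite [in_path x (g3 x) (f1 x)]in_pathCA [in_path x (g2 x) (f1 x)]in_pathCA.
rewrite [in_path x (g3 x) (f2 x)]in_pathCA [in_path x (g1 x) (f2 x)]in_pathCA.
rewrite [in_path x (g2 x) (f3 x)]in_pathCA [in_path x (g1 x) (f3 x)]in_pathCA.
move: (in_path x (f1 x) (g3 x)) (in_path x (f1 x) (g2 x)) (in_path x (f2 x) (g1 x))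
  (in_path x (f2 x) (g3 x)) (in_path x (f3 x) (g2 x)) (in_path x (f3 x) (g1 x)).
by clear=> -[] [] [] [] [] [].
Qed.
End LatticePath.

Lemma uniq_infinite (T : eqType) (p : nat -> T) (l : seq T) :
  injective p -> ~ forall k, p k \in l.
Proof.
move=> inj pl; have u : uniq (map p (iota 0 (size l).+1)).
  by rewrite map_inj_uniq // iota_uniq.
have sub : {subset map p (iota 0 (size l).+1) <= l} by move=> _ /mapP[k _ ->].
by have := uniq_leq_size u sub; rewrite size_map size_iota ltnn.
Qed.

Lemma opposite_hexadj x y u : hexadj x y -> hexadj x u -> hexadj y u ->
  hexadj x (opposite x y u) /\ hexadj y (opposite x y u).
Proof.
move=> xy xu yu; case: (common_nbr xy xu yu) => ->; rewrite ?opposite_ccw ?opposite_cw.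
  exact: hexadj_cw.
exact: hexadj_ccw.
Qed.

Definition periodic_path (w b : int -> Z2) := exists n : nat, (0 < n)%N /\
  forall j, w (j + n%:Z) = w j /\ b (j + n%:Z) = b j.

Section Finite.
Variables (w b z : int -> Z2).
Hypothesis lp : lattice_path w b z.
Let B x := exists j, x = b j.
Let E x := exists j, x = w j.
Hypothesis BE : forall x, B x -> E x -> False.

(* If the boundaries cancelled, every neighbour of a tile of the path would be a
   tile of the path, which would fill a whole line of the lattice. *)
Lemma path_boundary_ex (l : seq Z2) : (forall x, B x \/ E x -> x \in l) ->
  exists x y, path_boundary w b z x y.
Proof.
move=> fin; apply: contrapT => no.
pose Q x y u := [/\ hexadj x y, hexadj x u, hexadj y u & in_path w b z x y u].
have flip x y u : Q x y u -> Q x y (opposite x y u).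
  move=> [xy xu yu i]; have [a1 a2] := opposite_hexadj xy xu yu; split=> //.
  have e : in_path w b z x y (ccw x y) = in_path w b z x y (cw x y).
    apply/eqP; rewrite -negb_add; apply/negP => d; apply: no; exists x, y.
    by rewrite /path_boundary xy.
  move: i; case: (common_nbr xy xu yu) => ->; rewrite ?opposite_ccw ?opposite_cw.
    by rewrite e.
  by rewrite -e.
have rotQ x y u : Q x y u -> Q y u x.
  move=> [xy xu yu i]; split=> //; try exact: hexadj_sym.
  by rewrite in_pathCA in_pathC.
have [h1 h2 h3] := lp_tri lp 0.
have Q0 : Q (z 0) (b 0) (w 0).
  split; try exact: hexadj_sym.
  by apply/asboolP; exists 0; rewrite /tile_pts !inE !eqxx ?orbT.
(* The lattice line through the edge of index 0: successive flips find a tile of the path on each of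
   its unit segments. *)
pose p (k : nat) : Z2 := ((w 0).1 + k%:Z * ((b 0).1 - (w 0).1), (w 0).2 + k%:Z * ((b 0).2 - (w 0).2)).
have Qp k : exists x, Q x (p k.+1) (p k).
  elim: k => [|k [x Qx]].
    exists (z 0); have -> : p 1%N = b 0.
      by rewrite /p; case: (b 0) => ? ?; congr (_, _) => /=; ring.
    by have -> : p 0%N = w 0 by rewrite /p; case: (w 0) => ? ?; congr (_, _) => /=; ring.
  have Q1 := rotQ _ _ _ (rotQ _ _ _ (flip _ _ _ Qx)).
  have Q2 := rotQ _ _ _ (flip _ _ _ (rotQ _ _ _ (rotQ _ _ _ Q1))).
  exists (opposite x (p k.+1) (p k)).
  have -> : p k.+2 = opposite (p k.+1) (opposite x (p k.+1) (p k)) x.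
    rewrite /p /opposite /= -[k.+2]addn2 -[k.+1]addn1 !PoszD.
    by congr (_, _); ring.
  by have [q1 q2 q3 q4] := Q2; split=> //; exact: hexadj_sym.
apply: (@uniq_infinite _ p l).
  move=> i j; rewrite /p => -[e1 e2].
  have : b 0 <> w 0 by move=> e; rewrite e hexadj_irr in h1.
  case: (b 0) (w 0) e1 e2 => [b1 b2] [w1 w2] /= e1 e2 ne.
  have [e|e] := eqVneq b1 w1; last by nia.
  have [e'|e'] := eqVneq b2 w2; last by nia.
  by case: ne; rewrite e e'.
move=> k; have [x [_ _ _ /asboolP[j /and3P[_ _]]]] := Qp k.
rewrite /tile_pts !inE => /or3P[/eqP->|/eqP->|/eqP->]; apply: fin.
- by right; exists j.
- by left; exists j.
- by case: (lp_step lp j) => -[_ <- _]; [left|right]; exists (j + 1).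
Qed.

Lemma ccw_neq_cw x y : hexadj x y -> ccw x y <> cw x y.
Proof.
case: x y => [x1 x2] [y1 y2]; rewrite /hexadj /ccw /cw /= => h [e1 e2].
by move: h e1 e2; clear; lia.
Qed.

Lemma path_ccw_step j :
  (z j = ccw (w j) (b j) -> z (j + 1) = ccw (w (j + 1)) (b (j + 1))) /\
  (z j = cw (w j) (b j) -> z (j + 1) = cw (w (j + 1)) (b (j + 1))).
Proof.
by case: (lp_step lp j) => -[-> -> ->]; split=> ->;
  rewrite /opposite /ccw /cw; case: (w j) (b j) => [? ?] [? ?] /=; congr (_, _); ring.
Qed.

(** Passing to the next edge preserves the side on which the third vertex lies, so the pair of ends
    alone determines the tile entered. *)
Lemma path_orientation :
  (forall j, z j = ccw (w j) (b j)) \/ (forall j, z j = cw (w j) (b j)).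
Proof.
have adj j : hexadj (w j) (b j) by have [] := lp_tri lp j.
case: (path_opposite lp 0) => e0; [left|right]; elim/int_ind2 => // j e.
- exact: (path_ccw_step j).1.
- case: (path_opposite lp j) => // /(path_ccw_step j).2; rewrite e.
  by move/ccw_neq_cw: (adj (j + 1)).
- exact: (path_ccw_step j).2.
- case: (path_opposite lp j) => // /(path_ccw_step j).1; rewrite e => e'.
  by case: (ccw_neq_cw (adj (j + 1))).
Qed.

Lemma path_same_z i j : w i = w j -> b i = b j -> z i = z j.
Proof. by move=> ew eb; case: path_orientation => o; rewrite !o ew eb. Qed.

(** The color of the vertex that changes decides which end is replaced, forwards and backwards
    alike; disjointness of the classes excludes that two equal states move differently. *)
Lemma path_determined i j : w i = w j -> b i = b j ->
  forall k, w (i + k) = w (j + k) /\ b (i + k) = b (j + k).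
Proof.
move=> ew eb; elim/int_ind2 => [|k [ek1 ek2]|k]; first by rewrite !addr0.
  have ez := path_same_z ek1 ek2; rewrite !addrA.
  case: (lp_step lp (i + k)) (lp_step lp (j + k)) => -[i1 i2 i3] [] [j1 j2 j3].
  - by rewrite i1 i2 j1 j2.
  - by case: (@BE (z (i + k))); [exists (i + k + 1) | exists (j + k + 1); rewrite ez].
  - by case: (@BE (z (i + k))); [exists (j + k + 1); rewrite ez | exists (i + k + 1)].
  - by rewrite i1 i2 j1 j2.
rewrite !addrA => -[ek1 ek2]; have ez := path_same_z ek1 ek2.
have opp (x y u v : Z2) : v = opposite x y u -> u = opposite x y v.
  by move=> ->; case: x y u => [? ?] [? ?] [? ?]; rewrite /opposite /=; congr (_, _); ring.
have oppC x y u : opposite x y u = opposite y x u.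
  by rewrite /opposite; congr (_, _); ring.
case: (lp_step lp (i + k)) (lp_step lp (j + k)) => -[i1 i2 /opp i3] [] [j1 j2 /opp j3].
- by rewrite i3 j3 -i1 -j1 -i2 -j2 ek1 ek2 ez.
- case: (@BE (b (i + k))); [by exists (i + k) | exists (j + k)].
  by rewrite i3 j3 oppC -i1 -i2 -j1 -j2 ek1 ek2 ez.
- case: (@BE (w (i + k))); [exists (j + k) | by exists (i + k)].
  by rewrite i3 j3 oppC -i1 -i2 -j1 -j2 ek1 ek2 ez.
- by rewrite i3 j3 -i1 -j1 -i2 -j2 ek1 ek2 ez.
Qed.

Lemma finite_periodic (l : seq Z2) : (forall x, B x \/ E x -> x \in l) ->
  periodic_path w b.
Proof.
move=> fin; pose st (k : nat) := (w k%:Z, b k%:Z).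
pose N := (size [seq (x, y) | x <- l, y <- l]).+1.
have nu : ~~ uniq (map st (iota 0 N)).
  apply/negP => u.
  have sub : {subset map st (iota 0 N) <= [seq (x, y) | x <- l, y <- l]}.
    move=> _ /mapP[k _ ->]; apply/allpairsP; exists (st k); split=> //; apply: fin.
      by right; exists k%:Z.
    by left; exists k%:Z.
  by have := uniq_leq_size u sub; rewrite size_map size_iota ltnn.
have [i [j [ij]]] := uniqPn (st 0%N) nu.
rewrite size_map size_iota => jN; have iN := ltn_trans ij jN.
rewrite !(nth_map 0%N) ?size_iota // !nth_iota // !add0n => -[ew eb].
exists (j - i)%N; split; first by rewrite subn_gt0.
move=> k; have := path_determined ew eb (k - i%:Z).
rewrite [i%:Z + _]addrC subrK => -[-> ->]; rewrite -subzn ?(ltnW ij) //.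
by rewrite !addrA [k + _]addrC -addrA.
Qed.

Lemma periodic_finite : periodic_path w b ->
  exists l : seq Z2, forall x, B x \/ E x -> x \in l.
Proof.
case=> n [n0 per].
have perk (k : nat) j : w (j + (k * n)%N%:Z) = w j /\ b (j + (k * n)%N%:Z) = b j.
  elim: k => [|k [IH1 IH2]]; first by rewrite mul0n addr0.
  by rewrite mulSn PoszD addrA addrAC; have [-> ->] := per (j + (k * n)%N%:Z).
have red (j : int) : exists2 i : nat, (i < n)%N & w j = w i%:Z /\ b j = b i%:Z.
  have [q [r [rn e]]] : exists q r : nat, (r < n)%N /\
     (j = r%:Z + (q * n)%N%:Z \/ r%:Z = j + (q * n)%N%:Z).
    have n0' : n%:Z != 0 by rewrite eqz_nat -lt0n.
    have r0 := modz_ge0 j n0'; have rn : (j %% n%:Z)%Z < n%:Z by apply: ltz_pmod; lia.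
    have := divz_eq j n%:Z; move: (j %/ n%:Z)%Z (j %% n%:Z)%Z r0 rn => q [r|//] _ rn e.
    exists `|q|%N, r; split; first by lia.
    by rewrite PoszM; have [q0|q0] := lerP 0 q; [left|right]; rewrite e; nia.
  exists r => //; case: e => ->; first by have [-> ->] := perk q r%:Z.
  by have [-> ->] := perk q j.
exists ([seq w i%:Z | i <- iota 0 n] ++ [seq b i%:Z | i <- iota 0 n]) => x.
have inl (f : int -> Z2) i : (i < n)%N -> f i%:Z \in [seq f k%:Z | k : nat <- iota 0 n].
  by move=> il; apply/mapP; exists i; rewrite ?mem_iota.
rewrite mem_cat => -[] [j ->]; have [i il [ew eb]] := red j.
  by rewrite eb inl ?orbT.
by rewrite ew inl.
Qed.
End Finite.

(** * Cycles and periodicity for lattice paths *)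

Definition induced_hex (P : Z2 -> Prop) : rel Z2 :=
  fun x y => hexadj x y && `[< P x >] && `[< P y >].

Definition hex_cycle (P : Z2 -> Prop) c := (2 < size c)%N /\ ucycle (induced_hex P) c.

Definition on_path (b : int -> Z2) (x : Z2) : Prop := exists j, x = b j.

(** The last clause also compares cycles of different colors; as the classes are disjoint, it
    prevents both from carrying a cycle. *)
Definition cycle_dichotomy (w b : int -> Z2) : Prop :=
  [/\ periodic_path w b -> (exists c, hex_cycle (on_path b) c) \/ (exists c, hex_cycle (on_path w) c),
      ~ periodic_path w b -> forall P c, P = on_path b \/ P = on_path w -> ~ hex_cycle P c &
      forall P P' c c', P = on_path b \/ P = on_path w -> P' = on_path b \/ P' = on_path w ->
        hex_cycle P c -> hex_cycle P' c' -> cycle_edge c =2 cycle_edge c'].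

Lemma cycle_dichotomy_swap w b : cycle_dichotomy w b -> cycle_dichotomy b w.
Proof.
have perC u v : periodic_path u v -> periodic_path v u.
  by case=> n [n0 p]; exists n; split=> // j; have [? ?] := p j.
case=> h1 h2 h3; split.
- by move=> /perC/h1[]; [right|left].
- move=> np P c PE; apply: h2; first by move/perC.
  by case: PE; [right|left].
- by move=> P P' c c' [] e [] e'; apply: h3; [right|right|right|left|left|right|left|left].
Qed.

Lemma hex_cycle_ex (P Q : Z2 -> Prop) (h : rel Z2) (l : seq Z2) x y :
  (forall x, P x -> Q x -> False) ->
  symmetric h -> (forall x y, h x y -> hexadj x y) -> leafless h ->
  (forall x y, h x y -> (P x /\ P y) \/ (Q x /\ Q y)) ->
  (forall x y, h x y -> x \in l) -> h x y -> P x -> exists c, hex_cycle P c.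
Proof.
move=> PQ hs ha lf hm hl hxy Px.
pose h' u v := h u v && `[< P u >].
have hP u v : h u v -> P u -> P v.
  by move=> /hm[[]//|[Qu _]] Pu; case: (PQ u).
have [|||||c [sc /andP[cc uc]]] := @leafless_has_cycle _ h' l x y.
- move=> u v; apply/andP/andP => -[huv /asboolP Pu];
    by split; [rewrite hs | apply/asboolP; apply: hP Pu; rewrite // hs].
- by move=> u; apply/negP => /andP[/ha]; rewrite hexadj_irr.
- by move=> u v /andP[/hl].
- move=> u v /andP[huv Pu]; have [z [zv huz]] := lf _ _ huv.
  by exists z; [apply/eqP | rewrite /h' huz].
- by rewrite /h' hxy; apply/asboolP.
exists c; split=> //; rewrite /ucycle uc andbT.
apply: sub_cycle cc => u v /andP[huv /asboolP Pu]; rewrite /induced_hex (ha _ _ huv) /=.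
by apply/andP; split; apply/asboolP => //; apply: hP huv Pu.
Qed.

Section Dichotomy.
Variable R : realFieldType.

Lemma lattice_path_dichotomy (w1 w2 w3 S W1 W0 t : R) w b z :
  lattice_path w b z -> [/\ 0 < w1, 0 < w2 & 0 < w3] ->
  hexcfg w1 w2 w3 S W1 W0 t (on_path b) (on_path w) -> cycle_dichotomy w b.
Proof.
move=> lp wgt c; have BE := hexcfg_disjoint c.
have ev P cy : P = on_path b \/ P = on_path w -> hex_cycle P cy ->
    even_core (on_path b) (on_path w) (cycle_edge cy).
  by move=> PE [sc uc]; apply: (cycle_even_core PE sc uc).
split.
- move=> per; have [l hl] := periodic_finite per.
  have [x [y xy]] := path_boundary_ex lp hl.
  have hs := path_boundary_sym w b z.
  have hm u v := @path_boundary_mono w b z lp u v.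
  have ha u v : path_boundary w b z u v -> hexadj u v by case/andP.
  have hf u v : path_boundary w b z u v -> u \in l.
    by move=> /hm[[Bu _]|[Eu _]]; apply: hl; [left|right].
  have core : even_core (on_path b) (on_path w) (path_boundary w b z).
    split=> //; [by move=> u v uv; split; [exact: ha | exact: hm] | by exists l | by exists x, y | ].
    exact: path_boundary_even.
  have lf := even_core_leafless core.
  have [[Bx _]|[Ex _]] := hm _ _ xy.
    by left; apply: (hex_cycle_ex BE hs ha lf hm hf xy Bx).
  right; apply: (@hex_cycle_ex _ (on_path b) _ _ _ _ _ hs ha lf _ hf xy Ex).
    by move=> u Eu Bu; apply: BE Bu Eu.
  by move=> u v /hm[]; [right|left].
- move=> np P cy PE hc; apply: np.
  have [_ [l hl]] := hexcfg_even_unique c wgt (ev _ _ PE hc) (ev _ _ PE hc).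
  exact: finite_periodic lp BE l hl.
- move=> P P' cy cy' PE PE' hc hc'.
  by have [] := hexcfg_even_unique c wgt (ev _ _ PE hc) (ev _ _ PE' hc').
Qed.
End Dichotomy.

(** * Angles and arcs of the circle *)

Section Angles.
Variable R : realType.
Implicit Types t u : R.

Lemma angle_mod (t : R) : exists n : int, - pi <= t + n%:~R * (pi *+ 2) < pi.
Proof.
have p0 := pi_gt0 R; pose n := Num.floor ((t + pi) / (pi *+ 2)).
have d0 : 0 < pi *+ 2 :> R by rewrite mulr2n; lra.
exists (- n); have lo : n%:~R <= (t + pi) / (pi *+ 2) by apply: Num.Theory.floor_le.
have hi : (t + pi) / (pi *+ 2) < (n + 1)%:~R by apply: Num.Theory.floorD1_gt.
rewrite ler_pdivlMr // in lo; rewrite ltr_pdivrMr // rmorphD mulrDl mul1r in hi.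
by rewrite rmorphN mulNr; move: lo hi; rewrite mulr2n; lra.
Qed.

Lemma cos_turns t (n : int) : cos (t + n%:~R * (pi *+ 2)) = cos t.
Proof.
have p u (k : nat) : cos (u + k%:R * (pi *+ 2)) = cos u.
  by rewrite mulr_natl periodicn //; apply: cosD2pi.
case: n => k; first by rewrite -pmulrn p.
by rewrite NegzE rmorphN /= mulNr -(p (t - _) k.+1) subrK.
Qed.

Lemma sin_turns t (n : int) : sin (t + n%:~R * (pi *+ 2)) = sin t.
Proof.
have p u (k : nat) : sin (u + k%:R * (pi *+ 2)) = sin u.
  by rewrite mulr_natl periodicn //; apply: sinD2pi.
case: n => k; first by rewrite -pmulrn p.
by rewrite NegzE rmorphN /= mulNr -(p (t - _) k.+1) subrK.
Qed.

Lemma cos_norm t : cos `|t| = cos t.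
Proof. by case: (ger0P t) => _ //; rewrite cosN. Qed.

(** The hypothesis says that [t] is closer to 0 than [a], modulo turns; the shift by [a] makes the
    arc begin at 0, as [hexcfg] expects. *)
Lemma cos_window_gt t a : 0 < a < pi -> cos a < cos t ->
  exists n : int, 0 <= t + a + n%:~R * (pi *+ 2) < a *+ 2.
Proof.
move=> /andP[a0 ap] lt; have p0 := pi_gt0 R; have [n /andP[lo hi]] := angle_mod t.
exists n; move: lt; rewrite -(cos_turns t n); set u := t + _ in lo hi *.
have -> : t + a + n%:~R * (pi *+ 2) = u + a by rewrite /u addrAC.
rewrite -(cos_norm u) => ua.
have iu : `|u| \in `[0, pi] by rewrite in_itv /= normr_ge0 ler_norml lo ltW.
have ia : a \in `[0, pi] by rewrite in_itv /= !ltW.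
rewrite ltr_cos // in ua.
by move: ua; rewrite ltr_norml mulr2n; lra.
Qed.

Lemma cos_window_lt t a : 0 < a < pi -> cos t < cos a ->
  exists n : int, a *+ 2 <= t + a + n%:~R * (pi *+ 2) < pi *+ 2.
Proof.
move=> /andP[a0 ap] lt; have p0 := pi_gt0 R; have [n /andP[lo hi]] := angle_mod t.
move: lt; rewrite -(cos_turns t n); set u := t + _ in lo hi *.
rewrite -(cos_norm u) => ua.
have iu : `|u| \in `[0, pi] by rewrite in_itv /= normr_ge0 ler_norml lo ltW.
have ia : a \in `[0, pi] by rewrite in_itv /= !ltW.
rewrite ltr_cos // in ua.
have [u0|u0] := lerP 0 u.
  exists n; rewrite ger0_norm // in ua.
  have -> : t + a + n%:~R * (pi *+ 2) = u + a by rewrite /u addrAC.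
  by move: ua; rewrite !mulr2n; lra.
exists (n + 1); rewrite ltr0_norm // in ua.
have -> : t + a + (n + 1)%:~R * (pi *+ 2) = u + a + pi *+ 2.
  by rewrite /u rmorphD mulrDl mul1r; ring.
by move: ua; rewrite !mulr2n; lra.
Qed.

Lemma angle_ex (x y t0 : R) : x ^+ 2 + y ^+ 2 = 1 ->
  exists t, [/\ t0 <= t, t < t0 + pi *+ 2, cos t = x & sin t = y].
Proof.
move=> xy; have x1 : -1 <= x <= 1.
  by apply/andP; split; nra.
have [u [cu su]] : exists u, cos u = x /\ sin u = y.
  have sa := sin_acos x1; rewrite -xy addrAC subrr add0r sqrtr_sqr in sa.
  have ca : cos (acos x) = x by rewrite acosK // in_itv.
  have [y0|y0] := lerP 0 y.
    by exists (acos x); rewrite ca sa ger0_norm.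
  by exists (- acos x); rewrite cosN sinN ca sa ltr0_norm // opprK.
have [n /andP[lo hi]] := angle_mod (u - t0 - pi).
exists (u + n%:~R * (pi *+ 2)); rewrite cos_turns sin_turns; split=> //.
  by lra.
by move: hi; rewrite mulr2n; lra.
Qed.
End Angles.

Local Open Scope classical_set_scope.
Local Open Scope ring_scope.

(** * The lattice of tiles *)

Section Plane.
Variable R : realType.
Implicit Types (a b c e o p q u v : plane R) (t : triangle R).

Definition px p : R := p 0 0.
Definition py p : R := p 0 1.

Lemma plane_eq p q : px p = px q -> py p = py q -> p = q.
Proof.
move=> ex ey; apply/rowP => -[[|[|//]] Hi].
  by have -> : Ordinal Hi = 0 by apply: val_inj.
by have -> : Ordinal Hi = 1 by apply: val_inj.
Qed.

Lemma pxD p q : px (p + q) = px p + px q. Proof. by rewrite /px mxE. Qed.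
Lemma pyD p q : py (p + q) = py p + py q. Proof. by rewrite /py mxE. Qed.
Lemma pxN p : px (- p) = - px p. Proof. by rewrite /px mxE. Qed.
Lemma pyN p : py (- p) = - py p. Proof. by rewrite /py mxE. Qed.
Lemma pxZ (k : R) p : px (k *: p) = k * px p. Proof. by rewrite /px mxE. Qed.
Lemma pyZ (k : R) p : py (k *: p) = k * py p. Proof. by rewrite /py mxE. Qed.
Lemma px0 : px 0 = 0. Proof. by rewrite /px mxE. Qed.
Lemma py0 : py 0 = 0. Proof. by rewrite /py mxE. Qed.
Definition pE := (pxD, pyD, pxN, pyN, pxZ, pyZ, px0, py0).

Lemma dotE u v : dot u v = px u * px v + py u * py v.
Proof.
rewrite /dot mxE big_ord_recl big_ord_recl big_ord0 addr0 !mxE.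
by rewrite /px /py; congr (_ * _ + _ * _); congr (_ _ _); apply: val_inj.
Qed.

Definition det2 u v : R := px u * py v - py u * px v.

Definition vertices3 t a b c := exists i j k : 'I_3,
  [/\ uniq [:: i; j; k], a = t i, b = t j & c = t k].

Lemma vertices3C t a b c : vertices3 t a b c -> vertices3 t b a c.
Proof.
case=> i [j [k [u ea eb ec]]]; exists j, i, k; split=> //.
by move: u; rewrite /= !inE !negb_or !andbT [j == i]eq_sym => /andP[/andP[-> ->] ->].
Qed.

Lemma vertices3CA t a b c : vertices3 t a b c -> vertices3 t b c a.
Proof.
case=> i [j [k [u ea eb ec]]]; exists j, k, i; split=> //.
by move: u; rewrite /= !inE !negb_or !andbT [j == i]eq_sym [k == i]eq_sym => /andP[/andP[-> ->] ->].
Qed.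

Lemma vertices3AC t a b c : vertices3 t a b c -> vertices3 t a c b.
Proof. by move=> /vertices3C/vertices3CA. Qed.

Lemma sum3 (V : nmodType) (F : 'I_3 -> V) (i j k : 'I_3) : uniq [:: i; j; k] ->
  \sum_x F x = F i + F j + F k.
Proof.
move=> u; rewrite -big_enum /= (perm_big [:: i; j; k]) /=.
  by rewrite !big_cons big_nil addr0 addrA.
apply: uniq_perm; rewrite ?enum_uniq // => x.
have sub : {subset [:: i; j; k] <= enum 'I_3} by move=> y _; rewrite mem_enum.
have [|_ ->//] := uniq_min_size u sub; by rewrite -cardE card_ord.
Qed.

Lemma third_index (i j : 'I_3) : i != j -> exists k, uniq [:: i; j; k].
Proof.
case: i j => [i Hi] [j Hj]; rewrite -val_eqE /= => ij.
exists (inord (3 - i - j)); rewrite /= !inE -!val_eqE /= inordK; lia.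
Qed.

Lemma sideP t a b : side t a b <-> exists c, vertices3 t a b c.
Proof.
split=> [[i [j [ij -> ->]]]|[c [i [j [k [u -> -> _]]]]]].
  by have [k u] := third_index ij; exists (t k), i, j, k.
exists i, j; split=> //; by move: u; rewrite /= inE negb_or => /andP[/andP[]].
Qed.

Lemma vertices3_in t a b c (i : 'I_3) : vertices3 t a b c ->
  [\/ t i = a, t i = b | t i = c].
Proof.
case=> i0 [j [k [u -> -> ->]]].
have sub : {subset [:: i0; j; k] <= enum 'I_3} by move=> y _; rewrite mem_enum.
have [|_ e] := uniq_min_size u sub; first by rewrite -cardE card_ord.
have : i \in [:: i0; j; k] by rewrite e mem_enum.
by rewrite !inE => /or3P[/eqP->|/eqP->|/eqP->]; [constructor 1|constructor 2|constructor 3].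
Qed.

Lemma side_in t a b c x y : vertices3 t a b c -> side t x y ->
  [\/ x = a, x = b | x = c] /\ [\/ y = a, y = b | y = c].
Proof. by move=> v [i [j [_ -> ->]]]; split; apply: vertices3_in. Qed.

(** The predicate [Q] serves both the closed and the open triangle. *)
Lemma barycentricE (Q : R -> Prop) t a b c p : vertices3 t a b c ->
  (exists l : 'I_3 -> R, [/\ forall i, Q (l i), \sum_i l i = 1 & p = \sum_i l i *: t i]) <->
  exists l1 l2 l3 : R, [/\ [/\ Q l1, Q l2 & Q l3], l1 + l2 + l3 = 1 &
    p = l1 *: a + l2 *: b + l3 *: c].
Proof.
case=> i [j [k [u -> -> ->]]]; split.
  case=> l [l0 l1 ->]; exists (l i), (l j), (l k); split=> //.
    by rewrite -(sum3 l u).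
  by rewrite (sum3 (fun x => l x *: t x) u).
case=> l1 [l2 [l3 [[h1 h2 h3] s1 ->]]].
pose l x := if x == i then l1 else if x == j then l2 else l3.
have [li lj lk] : [/\ l i = l1, l j = l2 & l k = l3].
  move: u; rewrite /= !inE negb_or => /andP[/andP[ij ik] /andP[jk _]].
  by rewrite /l eqxx ![_ == i]eq_sym (negPf ij) (negPf ik) eqxx eq_sym (negPf jk).
exists l; rewrite (sum3 l u) (sum3 (fun x => l x *: t x) u) li lj lk; split=> // x.
by rewrite /l; case: ifP => // _; case: ifP.
Qed.

Lemma regionE t a b c p : vertices3 t a b c -> region t p <->
  exists l1 l2 l3 : R, [/\ [/\ 0 <= l1, 0 <= l2 & 0 <= l3], l1 + l2 + l3 = 1 &
    p = l1 *: a + l2 *: b + l3 *: c].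
Proof. exact: (barycentricE (fun l => 0 <= l)). Qed.

Lemma insideE t a b c p : vertices3 t a b c -> inside t p <->
  exists l1 l2 l3 : R, [/\ [/\ 0 < l1, 0 < l2 & 0 < l3], l1 + l2 + l3 = 1 &
    p = l1 *: a + l2 *: b + l3 *: c].
Proof. exact: (barycentricE (fun l => 0 < l)). Qed.

Lemma nondegenerate_det t : Defs.nondegenerate t ->
  det2 (t 1 - t 0) (t 2%:R - t 0) != 0.
Proof.
rewrite /Defs.nondegenerate; move: (t 1 - t 0) (t 2%:R - t 0) => u v rf.
apply/eqP => d0.
have lin (k l : R) : k *: u + l *: v = 0 -> k = 0 /\ l = 0.
  move=> e; have : row_mx k%:M l%:M *m col_mx u v = 0 *m col_mx u v.
    by rewrite mul_row_col !mul_scalar_mx e mul0mx.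
  move/(row_free_inj rf) => e0.
  have := congr1 (fun M => lsubmx M) e0; have := congr1 (fun M => rsubmx M) e0.
  rewrite row_mxKl row_mxKr linear0 linear0 => e2 e1.
  have := congr1 (fun M : 'M_1 => M 0 0) e1; have := congr1 (fun M : 'M_1 => M 0 0) e2.
  by rewrite !mxE eqxx !mulr1n => -> ->.
have [x0 y0] : px u = 0 /\ py u = 0.
  have [|h1 h2] := @lin (- py v) (py u).
    by apply: plane_eq; rewrite !pE; move: d0; rewrite /det2; lra.
  have [|h3 h4] := @lin (- px v) (px u).
    by apply: plane_eq; rewrite !pE; move: d0; rewrite /det2; lra.
  by [].
have [|h _] := @lin 1 0.
- by apply: plane_eq; rewrite !pE ?x0 ?y0; ring.
- by move/eqP: h; rewrite oner_eq0.
Qed.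

Lemma det_vertices3 t a b c : Defs.nondegenerate t -> vertices3 t a b c ->
  det2 (b - a) (c - a) != 0.
Proof.
move=> nd [i [j [k [u ea eb ec]]]]; have := nondegenerate_det nd.
have eqi (x y : 'I_3) : val x = val y -> t x = t y by move=> /val_inj ->.
have d1 : det2 (b - a) (c - a) = det2 (t 1 - t 0) (t 2%:R - t 0) \/
          det2 (b - a) (c - a) = - det2 (t 1 - t 0) (t 2%:R - t 0).
  rewrite {}ea {}eb {}ec /det2 !pE.
  case: i j k u => [[|[|[|//]]] Hi] [[|[|[|//]]] Hj] [[|[|[|//]]] Hk] //= u;
  rewrite ?(eqi (Ordinal Hi) 0 erefl) ?(eqi (Ordinal Hi) 1 erefl) ?(eqi (Ordinal Hi) 2%:R erefl)
    ?(eqi (Ordinal Hj) 0 erefl) ?(eqi (Ordinal Hj) 1 erefl) ?(eqi (Ordinal Hj) 2%:R erefl)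
    ?(eqi (Ordinal Hk) 0 erefl) ?(eqi (Ordinal Hk) 1 erefl) ?(eqi (Ordinal Hk) 2%:R erefl);
    try (by left; ring); by right; ring.
by case: d1 => ->; rewrite ?oppr_eq0.
Qed.
End Plane.

Section Lattice.
Variables (R : realType) (I : Type) (tri : I -> triangle R).
Hypothesis Htiling : periodic_triangle_tiling tri.
Implicit Types (a b c p q : plane R) (T : I) (x y : Z2).

Lemma tile_nondegenerate T a b c : vertices3 (tri T) a b c -> det2 (b - a) (c - a) != 0.
Proof. by have [[nd _ _ _] _] := Htiling; apply: det_vertices3. Qed.

(** The symmetry is given for regions only, so the third vertex has to be recovered. The weight [l3]
    of the reflected [c'] at [c] and the weight [m3] of [a + b - c] at [c'] are at most 1, and
    comparing determinants shows that their product is 1. *)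
Lemma neighbour_vertices T T' a b c : shared_side tri T T' a b ->
  vertices3 (tri T) a b c -> vertices3 (tri T') a b (a + b - c).
Proof.
move=> sh v; have [_ [_ sym]] := Htiling; have rE := sym _ _ _ _ sh.
have [_ _ /sideP[c' v']] := sh.
suff -> : a + b - c = c' by [].
have D0 := tile_nondegenerate v.
have : region (tri T') c'.
  by apply/(regionE _ v'); exists 0, 0, 1; split=> //; rewrite ?add0r // !scale0r !add0r scale1r.
rewrite rE => -[p /(regionE _ v)[l1 [l2 [l3 [[h1 h2 h3] s1 ->]]]] ec].
have : region (tri T') (a + b - c).
  rewrite rE; exists c => //; apply/(regionE _ v); exists 0, 0, 1; split=> //.
    by rewrite !add0r.
  by rewrite !scale0r !add0r scale1r.
move/(regionE _ v')=> [m1 [m2 [m3 [[k1 k2 k3] s2 ed]]]].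
have ex := congr1 (@px R) ec; have ey := congr1 (@py R) ec.
have fx := congr1 (@px R) ed; have fy := congr1 (@py R) ed.
rewrite !pE in ex ey fx fy.
move: D0; rewrite /det2 !pE => D0.
have l1E : l1 = 1 - l2 - l3 by lra.
have m1E : m1 = 1 - m2 - m3 by lra.
move: D0; set d := _ - _ => D0.
pose d' := (px b - px a) * (py c' - py a) - (py b - py a) * (px c' - px a).
have E1 : - d = m3 * d'.
  have -> : - d = (px b - px a) * (py a + py b - py c - py a) -
                  (py b - py a) * (px a + px b - px c - px a) by rewrite /d; ring.
  by rewrite fx fy /d' m1E; ring.
have E2 : d' = - l3 * d by rewrite /d' /d -ex -ey l1E; ring.
have prod : (l3 * m3 - 1) * d = 0.
  have -> : (l3 * m3 - 1) * d = - d - m3 * (- l3 * d) by ring.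
  by rewrite -E2 E1 subrr.
move/eqP: prod; rewrite mulf_eq0 (negPf D0) orbF subr_eq0 => /eqP lm.
have l3E : l3 = 1 by nra.
have [l1_0 l2_0] : l1 = 0 /\ l2 = 0 by split; lra.
by rewrite -ec l1_0 l2_0 l3E !scale0r !add0r scale1r.
Qed.

Lemma neighbour_ex T a b c : vertices3 (tri T) a b c ->
  exists T', T <> T' /\ vertices3 (tri T') a b (a + b - c).
Proof.
move=> v; have [_ [ex _]] := Htiling.
have [|T' sh] := ex T a b; first by apply/sideP; exists c.
by exists T'; split; [case: sh | apply: neighbour_vertices sh v].
Qed.

Variables (T0 : I) (A0 A1 A2 : plane R).
Hypothesis base : vertices3 (tri T0) A0 A1 A2.
Let u := A1 - A0.
Let v := A2 - A1.

(** With steps along two consecutive sides, the base tile gets the coordinates (0, 0), (1, 0), (1,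
    1), and the sides of tiles become the edges of [hexadj]. *)
Definition lat x : plane R := A0 + x.1%:~R *: u + x.2%:~R *: v.

Lemma lat_opposite x y z : lat x + lat y - lat z = lat (opposite x y z).
Proof.
rewrite /lat /opposite /=; apply: plane_eq; rewrite !pE !rmorphB !rmorphD; ring.
Qed.

Definition up_tile x T := vertices3 (tri T) (lat x) (lat (f1 x)) (lat (g3 x)).
Definition down_tile x T := vertices3 (tri T) (lat x) (lat (f2 x)) (lat (g3 x)).

Lemma lat_nbr T x y z : vertices3 (tri T) (lat x) (lat y) (lat z) ->
  exists T', vertices3 (tri T') (lat x) (lat y) (lat (opposite x y z)).
Proof. by move=> /neighbour_ex[T' [_]]; rewrite lat_opposite; exists T'. Qed.

Lemma up_down x T : up_tile x T -> exists T', down_tile x T'.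
Proof.
move=> /vertices3AC/lat_nbr[T']; have -> : opposite x (g3 x) (f1 x) = f2 x.
  by rewrite /opposite /g3 /f1 /f2 /=; congr (_, _); ring.
by move=> /vertices3AC; exists T'.
Qed.

Lemma down_up x T : down_tile x T -> exists T', up_tile x T'.
Proof.
move=> /vertices3AC/lat_nbr[T']; have -> : opposite x (g3 x) (f2 x) = f1 x.
  by rewrite /opposite /g3 /f1 /f2 /=; congr (_, _); ring.
by move=> /vertices3AC; exists T'.
Qed.

Lemma up_f1 x T : up_tile x T -> exists T', up_tile (f1 x) T'.
Proof.
move=> /vertices3CA/lat_nbr[T']; have -> : opposite (f1 x) (g3 x) x = g3 (f1 x).
  by rewrite /opposite /g3 /f1 /=; congr (_, _); ring.
by move=> h; apply: (@down_up _ T'); rewrite /down_tile; have -> : f2 (f1 x) = g3 x by [].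
Qed.

Lemma up_g1 x T : up_tile x T -> exists T', up_tile (g1 x) T'.
Proof.
move=> /up_down[T1] /lat_nbr[T']; have -> : opposite x (f2 x) (g3 x) = g1 x.
  by rewrite /opposite /g3 /f2 /g1 /=; congr (_, _); ring.
move=> /vertices3CA/vertices3CA h; exists T'; rewrite /up_tile g1K.
by have -> : g3 (g1 x) = f2 x by rewrite /g3 /g1 /f2 /= subrK.
Qed.

Lemma up_f2 x T : up_tile x T -> exists T', up_tile (f2 x) T'.
Proof.
move=> /up_down[T1] /vertices3CA/lat_nbr[T'].
have -> : opposite (f2 x) (g3 x) x = g3 (f2 x).
  by rewrite /opposite /g3 /f2 /=; congr (_, _); ring.
by exists T'; rewrite /up_tile; have -> : f1 (f2 x) = g3 x by [].
Qed.

Lemma up_g2 x T : up_tile x T -> exists T', up_tile (g2 x) T'.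
Proof.
move=> /lat_nbr[T']; have -> : opposite x (f1 x) (g3 x) = g2 x.
  by rewrite /opposite /g3 /f1 /g2 /=; congr (_, _); ring.
move=> /vertices3CA/vertices3CA h; apply: (@down_up _ T'); rewrite /down_tile g2K.
by have -> : g3 (g2 x) = f1 x by rewrite /g3 /g2 /f1 /= subrK.
Qed.

Lemma all_up x : exists T, up_tile x T.
Proof.
case: x => x1 x2; elim/int_ind2: x1 => [|x1 [T h]|x1 [T h]].
- elim/int_ind2: x2 => [|x2 [T h]|x2 [T h]].
  + exists T0; rewrite /up_tile /lat /g3 /f1 /= !add0r !scale0r !addr0 !scale1r.
    have -> : A0 + u = A1 by rewrite /u addrC subrK.
    by have -> : A1 + v = A2 by rewrite /v addrC subrK.
  + exact: up_f2 h.
  + have -> : (0, x2) = g2 (0, x2 + 1) :> Z2 by rewrite /g2 /= addrK.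
    exact: up_g2 h.
- exact: up_f1 h.
- have -> : (x1, x2) = g1 (x1 + 1, x2) :> Z2 by rewrite /g1 /= addrK.
  exact: up_g1 h.
Qed.

Lemma all_down x : exists T, down_tile x T.
Proof. by have [T /up_down] := all_up x. Qed.

Let D := det2 u v.

Lemma D_neq0 : D != 0.
Proof.
have := tile_nondegenerate base; rewrite /D /u /v /det2 !pE.
by apply: contra_neq => e; rewrite -[RHS]e; ring.
Qed.

(** Coordinates with respect to [u] and [v], by Cramer's rule. *)
Definition ca p : R := det2 (p - A0) v / D.
Definition cb p : R := det2 u (p - A0) / D.

Lemma coordK p : p = A0 + ca p *: u + cb p *: v.
Proof.
have D0 := D_neq0; rewrite /ca /cb.
suff e : D *: (p - A0) = det2 (p - A0) v *: u + det2 u (p - A0) *: v.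
  rewrite ![_ / D]mulrC -!scalerA -addrA -scalerDr -e scalerA mulVf // scale1r.
  by rewrite addrC subrK.
by apply: plane_eq; rewrite /D /det2 !pE; ring.
Qed.

Lemma ca_lat x : ca (lat x) = x.1%:~R.
Proof.
apply/eqP; rewrite /ca -(inj_eq (mulIf D_neq0)) divfK ?D_neq0 //; apply/eqP.
by rewrite /lat /D /det2 !pE; ring.
Qed.
Lemma cb_lat x : cb (lat x) = x.2%:~R.
Proof.
apply/eqP; rewrite /cb -(inj_eq (mulIf D_neq0)) divfK ?D_neq0 //; apply/eqP.
by rewrite /lat /D /det2 !pE; ring.
Qed.

Lemma lat_inj : injective lat.
Proof.
move=> x y e; apply: Z2_eq; apply: (@intr_inj R).
  by rewrite -!ca_lat e.
by rewrite -!cb_lat e.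
Qed.

Lemma ca_comb (k l m : R) a b c : k + l + m = 1 ->
  ca (k *: a + l *: b + m *: c) = k * ca a + l * ca b + m * ca c.
Proof.
move=> e; have -> : k = 1 - l - m by lra.
by rewrite /ca /det2 !pE; ring.
Qed.
Lemma cb_comb (k l m : R) a b c : k + l + m = 1 ->
  cb (k *: a + l *: b + m *: c) = k * cb a + l * cb b + m * cb c.
Proof.
move=> e; have -> : k = 1 - l - m by lra.
by rewrite /cb /det2 !pE; ring.
Qed.

Lemma coord_inj p q : ca p = ca q -> cb p = cb q -> p = q.
Proof. by move=> e1 e2; rewrite [p]coordK [q]coordK e1 e2. Qed.

Lemma inside_up x T p : up_tile x T ->
  inside (tri T) p <-> [/\ 0 < cb p - x.2%:~R, cb p - x.2%:~R < ca p - x.1%:~R & ca p - x.1%:~R < 1].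
Proof.
move=> h; split=> [/(insideE _ h)[k [l [m [[k0 l0 m0] s ->]]]]|[h1 h2 h3]].
  rewrite ca_comb ?cb_comb // !ca_lat !cb_lat /= !rmorphD /=.
  by have -> : k = 1 - l - m; [lra | split; lra].
apply/(insideE _ h); exists (1 - (ca p - x.1%:~R)), (ca p - x.1%:~R - (cb p - x.2%:~R)), (cb p - x.2%:~R).
split; [by split; lra | by lra |].
by apply: coord_inj; rewrite ?ca_comb ?cb_comb // ?ca_lat ?cb_lat /= ?rmorphD /=; ring.
Qed.

Lemma inside_down x T p : down_tile x T ->
  inside (tri T) p <-> [/\ 0 < ca p - x.1%:~R, ca p - x.1%:~R < cb p - x.2%:~R & cb p - x.2%:~R < 1].
Proof.
move=> h; split=> [/(insideE _ h)[k [l [m [[k0 l0 m0] s ->]]]]|[h1 h2 h3]].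
  rewrite ca_comb ?cb_comb // !ca_lat !cb_lat /= !rmorphD /=.
  by have -> : k = 1 - l - m; [lra | split; lra].
apply/(insideE _ h); exists (1 - (cb p - x.2%:~R)), (cb p - x.2%:~R - (ca p - x.1%:~R)), (ca p - x.1%:~R).
split; [by split; lra | by lra |].
by apply: coord_inj; rewrite ?ca_comb ?cb_comb // ?ca_lat ?cb_lat /= ?rmorphD /=; ring.
Qed.
End Lattice.

Section Small.
Variable R : realType.

Lemma small4 (a b c e : R) : 0 < a -> 0 < b -> 0 < c -> 0 < e ->
  exists t : R, [/\ 0 < t, t < a, t < b & t < c /\ t < e].
Proof.
move=> a0 b0 c0 e0; pose m := Num.min (Num.min a b) (Num.min c e).
have m0 : 0 < m by rewrite !lt_min a0 b0 c0 e0.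
have : m <= m by [].
rewrite {2}/m !le_min => /andP[/andP[ma mb] /andP[mc me]].
by exists (m / 2); split; [| | |split]; lra.
Qed.

Lemma int_in01 (m : int) (s : R) : 0 < s < 1 -> s = m%:~R -> False.
Proof. by move=> /andP[h1 h2] e; move: h1 h2; rewrite e ltr0z ltrz1; lia. Qed.

Lemma int_lt1 (m : int) : -1 < m%:~R :> R -> m%:~R < 1 :> R -> m = 0.
Proof. by have -> : -1 = (-1)%:~R :> R; [rewrite rmorphN1 | rewrite ltr_int ltrz1; lia]. Qed.
End Small.

Section Lattice.
Variables (R : realType) (I : Type) (tri : I -> triangle R).
Hypothesis Htiling : periodic_triangle_tiling tri.
Implicit Types (a b c p q : plane R) (T : I) (x y : Z2).
Variables (T0 : I) (A0 A1 A2 : plane R).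
Hypothesis base : vertices3 (tri T0) A0 A1 A2.
Local Notation lat := (lat A0 A1 A2).
Local Notation ca := (ca A0 A1 A2).
Local Notation cb := (cb A0 A1 A2).

(** The tiles spread from the base tile fill the plane up to their sides, so every tile overlaps one
    of them, and distinct tiles have disjoint interiors. *)
Lemma tile_lattice T : exists x, up_tile tri A0 A1 A2 x T \/ down_tile tri A0 A1 A2 x T.
Proof.
pose a := tri T 0; pose b := tri T 1; pose c := tri T 2%:R.
have vT : vertices3 (tri T) a b c by exists 0, 1, 2%:R.
have cab k l m := ca_comb A0 A1 A2 (k := k) (l := l) (m := m) a b c.
have cbb k l m := cb_comb A0 A1 A2 (k := k) (l := l) (m := m) a b c.
have D0 := tile_nondegenerate Htiling vT.
have D1 := D_neq0 Htiling base.
pose u := A1 - A0; pose v := A2 - A1.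
(* Along [2 u + v] the functions [ca], [cb] and [ca - cb] all increase, so a small shift leaves
   every wall. Its coordinates in the sides of [T] are [k] and [l]. *)
pose k := det2 (2 *: u + v) (c - a) / det2 (b - a) (c - a).
pose l := det2 (b - a) (2 *: u + v) / det2 (b - a) (c - a).
have kl : k *: (b - a) + l *: (c - a) = 2 *: u + v.
  suff e : det2 (2 *: u + v) (c - a) *: (b - a) + det2 (b - a) (2 *: u + v) *: (c - a)
      = det2 (b - a) (c - a) *: (2 *: u + v).
    by rewrite /k /l ![_ / det2 _ _]mulrC -!scalerA -scalerDr e scalerA mulVf // scale1r.
  by apply: plane_eq; rewrite /det2 !pE; ring.
(* [p t] is a point of [T] none of whose coordinates [ca], [cb] and [ca - cb] is
   an integer, hence lies inside a tile of the lattice. *)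
pose p0 : plane R := 3^-1 *: a + 3^-1 *: b + 3^-1 *: c.
pose p (t : R) := p0 + t *: (2 *: u + v).
have caE q : ca q * det2 u v = det2 (q - A0) v by rewrite divfK.
have cbE q : cb q * det2 u v = det2 u (q - A0) by rewrite divfK.
have cap t : ca (p t) = ca p0 + 2 * t.
  apply: (mulIf D1); rewrite mulrDl !caE /p /u /v /det2 !pE; ring.
have cbp t : cb (p t) = cb p0 + t.
  apply: (mulIf D1); rewrite mulrDl !cbE /p /u /v /det2 !pE; ring.
pose x : Z2 := (Num.floor (ca p0), Num.floor (cb p0)).
have fl1 := Num.Theory.floor_le (ca p0); have fg1 := Num.Theory.floorD1_gt (ca p0).
have fl2 := Num.Theory.floor_le (cb p0); have fg2 := Num.Theory.floorD1_gt (cb p0).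
rewrite rmorphD /= in fg1; rewrite rmorphD /= in fg2.
set r1 := ca p0 in fl1 fg1 cap; set r2 := cb p0 in fl2 fg2 cbp.
set n1 := (Num.floor r1)%:~R in fl1 fg1; set n2 := (Num.floor r2)%:~R in fl2 fg2.
pose dlt := if r1 - n1 - (r2 - n2) < 0 then - (r1 - n1 - (r2 - n2)) else 1.
have dlt0 : 0 < dlt by rewrite /dlt; case: ifP => // h; lra.
(* The first two bounds keep the integer parts of [ca] and [cb], the third keeps the side of the
   diagonal (1 is a default value), and the last keeps the barycentric coordinates in [T]
   positive. *)
have [||||t [t0 t1 t2 [t3 t4]]] := @small4 R ((1 - (r1 - n1)) / 2) (1 - (r2 - n2)) dlt
    (3 * (1 + `|k| + `|l|))^-1; [lra | lra | by [] | |].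
  by rewrite invr_gt0; have := normr_ge0 k; have := normr_ge0 l; lra.
have ins : inside (tri T) (p t).
  apply/(insideE _ vT); exists (3^-1 - t * k - t * l), (3^-1 + t * k), (3^-1 + t * l).
  have t4' : t * (1 + `|k| + `|l|) < 3^-1.
    have pos : 0 < 1 + `|k| + `|l| by have := normr_ge0 k; have := normr_ge0 l; lra.
    by rewrite -ltr_pdivlMr // -invfM.
  have tk : `|t * k| = t * `|k| by rewrite normrM gtr0_norm.
  have tl : `|t * l| = t * `|l| by rewrite normrM gtr0_norm.
  have [k1 k2] := (ler_norm (t * k), ler_norm (- (t * k))).
  have [l1 l2] := (ler_norm (t * l), ler_norm (- (t * l))).
  rewrite normrN tk in k2; rewrite normrN tl in l2; rewrite tk in k1; rewrite tl in l1.
  rewrite !mulrDr mulr1 in t4'; have tk0 := normr_ge0 (t * k); have tl0 := normr_ge0 (t * l).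
  rewrite tk in tk0; rewrite tl in tl0; split; [split; lra | by lra |].
  by rewrite /p -kl /p0; apply: plane_eq; rewrite !pE; ring.
exists x.
have same T' : inside (tri T') (p t) -> T' = T.
  have [[_ _ _ dis] _] := Htiling => h; apply: contrapT => ne.
  by have := dis T' T ne; move/seteqP => [/(_ (p t))] ; case.
case: (ltrP (r1 - n1 + 2 * t) (r2 - n2 + t)) => h.
- right; have [T' dT] := all_down Htiling base x.
  rewrite -(same T') //; apply/(inside_down Htiling base _ dT).
  by rewrite cap cbp /= -/n1 -/n2; split; lra.
- left; have [T' dT] := all_up Htiling base x.
  rewrite -(same T') //; apply/(inside_up Htiling base _ dT).
  rewrite cap cbp /= -/n1 -/n2; split; try lra.
  by move: h t3; rewrite /dlt; case: ifP => h'; lra.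
Qed.

Lemma lat_tile_distinct T x y z : vertices3 (tri T) (lat x) (lat y) (lat z) ->
  hexadj x y -> hexadj x z -> hexadj y z ->
  exists g : 'I_3 -> Z2, (forall i, tri T i = lat (g i)) /\
    forall i j, i != j -> hexadj (g i) (g j).
Proof.
move=> h xy xz yz.
have /boolp.choice[g gE] i : exists x', tri T i = lat x' /\ [\/ x' = x, x' = y | x' = z].
  case: (vertices3_in i h) => ->.
  - by exists x; split=> //; constructor 1.
  - by exists y; split=> //; constructor 2.
  - by exists z; split=> //; constructor 3.
exists g; split=> [i|i j ij]; first by have [] := gE i.
have ne : g i <> g j.
  move=> e; have [k u] := third_index ij.
  have v : vertices3 (tri T) (tri T i) (tri T j) (tri T k) by exists i, j, k.
  have := tile_nondegenerate Htiling v.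
  have [-> _] := gE i; have [-> _] := gE j.
  by rewrite e subrr /det2 !pE !mul0r subrr eqxx.
have [_ ei] := gE i; have [_ ej] := gE j.
by case: ei ne => ->; case: ej => -> //; move=> _ //; apply: hexadj_sym.
Qed.

Lemma tile_lat T : exists g : 'I_3 -> Z2, (forall i, tri T i = lat (g i)) /\
  forall i j, i != j -> hexadj (g i) (g j).
Proof.
have [x [h|h]] := tile_lattice T; apply: lat_tile_distinct h _ _ _;
  by clear; case: x => x1 x2; rewrite /hexadj /f1 /f2 /g3 /= ?eqxx ?orbT.
Qed.

Lemma tile_vertices_lat T a b c : vertices3 (tri T) a b c -> exists x y z,
  [/\ a = lat x, b = lat y & c = lat z] /\ [/\ hexadj x y, hexadj x z & hexadj y z].
Proof.
have [g [gE gh]] := tile_lat T.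
move=> [i [j [k [/= u -> -> ->]]]]; exists (g i), (g j), (g k); split; first by rewrite !gE.
by move: u; rewrite !inE negb_or => /andP[/andP[ij ik] /andP[jk _]]; split; apply: gh.
Qed.

Lemma tiling_edge_lat a b : tiling_edge tri a b -> exists x y,
  [/\ a = lat x, b = lat y & hexadj x y].
Proof.
by move=> [T /sideP[c /tile_vertices_lat[x [y [z [[-> -> _] [h _ _]]]]]]]; exists x, y.
Qed.

Lemma lat_edge x y : hexadj x y -> tiling_edge tri (lat x) (lat y).
Proof.
have up w := all_up Htiling base w; have down w := all_down Htiling base w.
have sd t a b : side t a b -> side t b a.
  by move=> /sideP[c h]; apply/sideP; exists c; apply: vertices3C.
move=> /hexadjP[[]|[]] ->.
- by have [T h] := up x; exists T; apply/sideP; eexists; exact: h.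
- by have [T h] := down x; exists T; apply/sideP; eexists; exact: h.
- have [T h] := up (f3 x); exists T; apply: sd; apply/sideP; exists (lat (f1 (f3 x))).
  by move: h; rewrite /up_tile f3K => /vertices3AC.
- have [T h] := up (g1 x); exists T; apply: sd; apply/sideP.
  by eexists; move: h; rewrite /up_tile g1K; exact.
- have [T h] := down (g2 x); exists T; apply: sd; apply/sideP.
  by eexists; move: h; rewrite /down_tile g2K; exact.
- by have [T h] := up x; exists T; apply/sideP; eexists; exact: (vertices3AC h).
Qed.

Lemma tiling_vertex_lat x : tiling_vertex tri (lat x).
Proof.
have [T [i [j [k [_ e _ _]]]]] := all_up Htiling base x.
by exists T, i.
Qed.
End Lattice.

Definition up_edge x y := [\/ y = f1 x, y = f2 x | y = g3 x].

Lemma up_edge_ex x y : hexadj x y -> up_edge x y \/ up_edge y x.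
Proof.
move=> /hexadjP[[]|[]] ->; [left|left|right|right|right|left].
- by constructor 1.
- by constructor 2.
- by constructor 3; rewrite f3K.
- by constructor 1; rewrite g1K.
- by constructor 2; rewrite g2K.
- by constructor 3.
Qed.

Section MeetUp.
Variable R : realType.

(** On an edge one of the two coordinates or their difference is an integer, which fails inside an
    edge of another direction. Parallel edges that meet in this way differ by an integer less than 1
    in absolute value. *)
Lemma up_edge_meet (x y x' y' : Z2) (s s' : R) : up_edge x y -> up_edge x' y' ->
  0 < s < 1 -> 0 <= s' <= 1 ->
  x.1%:~R + s * (y.1%:~R - x.1%:~R) = x'.1%:~R + s' * (y'.1%:~R - x'.1%:~R) ->
  x.2%:~R + s * (y.2%:~R - x.2%:~R) = x'.2%:~R + s' * (y'.2%:~R - x'.2%:~R) ->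
  x = x' /\ y = y'.
Proof.
move=> u u' s01 s01' e1 e2.
have bad (m : int) : s = m%:~R -> False by apply: int_in01.
have same (m m' : int) : m%:~R + s = m'%:~R + s' -> m = m'.
  move=> e; apply/eqP; rewrite -subr_eq0; apply/eqP; apply: (@int_lt1 R); rewrite rmorphB /=;
    by move/andP: s01 => [? ?]; move/andP: s01' => [? ?]; lra.
have eqI (m m' : int) : m%:~R = m'%:~R :> R -> m = m' by apply: intr_inj.
case: x x' u u' e1 e2 => [x1 x2] [a1 a2] [] -> [] -> /=;
  rewrite !rmorphD /= => e1 e2.
- have -> : x1 = a1 by apply: same; lra.
  by have -> : x2 = a2 by apply: eqI; lra.
- by case: (bad (a1 - x1)); rewrite rmorphB /=; lra.
- by case: (bad (a1 - x1 + x2 - a2)); rewrite !(rmorphB, rmorphD) /=; lra.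
- by case: (bad (a2 - x2)); rewrite rmorphB /=; lra.
- have -> : x1 = a1 by apply: eqI; lra.
  by have -> : x2 = a2 by apply: same; lra.
- by case: (bad (a2 - x2 + x1 - a1)); rewrite !(rmorphB, rmorphD) /=; lra.
- by case: (bad (a2 - x2)); rewrite rmorphB /=; lra.
- by case: (bad (a1 - x1)); rewrite rmorphB /=; lra.
- have -> : x1 = a1 by apply: same; lra.
  by have -> : x2 = a2 by apply: same; lra.
Qed.
End MeetUp.

Section Segments.
Variable R : realType.
Implicit Types (a b p : plane R).
Lemma on_lineC a b (s : R) : on_line a b s = on_line b a (1 - s).
Proof. by rewrite /on_line; apply: plane_eq; rewrite !pE; ring. Qed.

Lemma segmentC a b p : segment a b p -> segment b a p.
Proof. by case=> s [/andP[s0 s1] ->]; exists (1 - s); rewrite on_lineC; split=> //; lra. Qed.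

Lemma open_segmentC a b p : open_segment a b p -> open_segment b a p.
Proof. by case=> s [/andP[s0 s1] ->]; exists (1 - s); rewrite on_lineC; split=> //; lra. Qed.

Lemma open_segment_segment a b p : open_segment a b p -> segment a b p.
Proof. by case=> s [/andP[s0 s1] ->]; exists s; rewrite !ltW. Qed.

Lemma segment_split a b p : segment a b p -> [\/ p = a, p = b | open_segment a b p].
Proof.
case=> s [/andP[s0 s1] ->].
have [->|n0] := eqVneq s 0; first by constructor 1; rewrite /on_line scale0r addr0.
have [->|n1] := eqVneq s 1; first by constructor 2; rewrite /on_line scale1r addrC subrK.
by constructor 3; exists s; rewrite !lt_neqAle eq_sym n0 n1 s0 s1.
Qed.
End Segments.

Section Lattice.
Variables (R : realType) (I : Type) (tri : I -> triangle R).
Hypothesis Htiling : periodic_triangle_tiling tri.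
Implicit Types (a b c p q : plane R) (T : I) (x y : Z2).
Variables (T0 : I) (A0 A1 A2 : plane R).
Hypothesis base : vertices3 (tri T0) A0 A1 A2.
Local Notation lat := (lat A0 A1 A2).
Local Notation ca := (ca A0 A1 A2).
Local Notation cb := (cb A0 A1 A2).

Lemma ca_line x y s : ca (on_line (lat x) (lat y) s) = x.1%:~R + s * (y.1%:~R - x.1%:~R).
Proof.
have -> : on_line (lat x) (lat y) s = (1 - s) *: lat x + s *: lat y + 0 *: lat y.
  by rewrite /on_line; apply: plane_eq; rewrite !pE; ring.
by rewrite ca_comb ?(ca_lat Htiling base) ?subrK ?addr0 //; ring.
Qed.

Lemma cb_line x y s : cb (on_line (lat x) (lat y) s) = x.2%:~R + s * (y.2%:~R - x.2%:~R).
Proof.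
have -> : on_line (lat x) (lat y) s = (1 - s) *: lat x + s *: lat y + 0 *: lat y.
  by rewrite /on_line; apply: plane_eq; rewrite !pE; ring.
by rewrite cb_comb ?(cb_lat Htiling base) ?subrK ?addr0 //; ring.
Qed.

Lemma edge_meet x y x' y' p : hexadj x y -> hexadj x' y' ->
  open_segment (lat x) (lat y) p -> segment (lat x') (lat y') p ->
  (x = x' /\ y = y') \/ (x = y' /\ y = x').
Proof.
have core (a b a' b' : Z2) : up_edge a b -> up_edge a' b' ->
    open_segment (lat a) (lat b) p -> segment (lat a') (lat b') p -> a = a' /\ b = b'.
  move=> u u' [s [s01 ->]] [s' [s01' e]].
  by apply: (up_edge_meet u u' s01 s01'); rewrite -?ca_line -?cb_line e.
move=> /up_edge_ex[] u /up_edge_ex[] u' h h'.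
- by left; apply: core u u' h h'.
- by right; apply: core u u' h (segmentC h').
- by right; have [-> ->] := core _ _ _ _ u u' (open_segmentC h) h'.
- by left; have [-> ->] := core _ _ _ _ u u' (open_segmentC h) (segmentC h').
Qed.

(** On an edge one of [ca], [cb] and [ca - cb] is an integer, inside a tile none is. *)
Lemma edge_inside T x y p : hexadj x y -> segment (lat x) (lat y) p -> inside (tri T) p -> False.
Proof.
have core (a b : Z2) : up_edge a b -> segment (lat a) (lat b) p -> inside (tri T) p -> False.
  move=> u [s [_ pE]]; move: (ca_line a b s) (cb_line a b s); rewrite -{}pE => e1 e2.
  have [[z1 z2] [h|h] /=] := tile_lattice Htiling base T.
    move=> /(inside_up Htiling base _ h) /= [i1 i2 i3].
    case: u => ?; subst b; rewrite /= ?rmorphD /= in e1 e2.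
    + by apply: (@int_in01 R (a.2 - z2) (cb p - z2%:~R)); rewrite ?rmorphB /=; lra.
    + by apply: (@int_in01 R (a.1 - z1) (ca p - z1%:~R)); rewrite ?rmorphB /=; lra.
    + apply: (@int_in01 R (a.1 - z1 - (a.2 - z2)) (ca p - z1%:~R - (cb p - z2%:~R)));
        by rewrite ?rmorphB /= ?rmorphB /=; lra.
  move=> /(inside_down Htiling base _ h) /= [i1 i2 i3].
  case: u => ?; subst b; rewrite /= ?rmorphD /= in e1 e2.
  + by apply: (@int_in01 R (a.2 - z2) (cb p - z2%:~R)); rewrite ?rmorphB /=; lra.
  + by apply: (@int_in01 R (a.1 - z1) (ca p - z1%:~R)); rewrite ?rmorphB /=; lra.
  + apply: (@int_in01 R (a.2 - z2 - (a.1 - z1)) (cb p - z2%:~R - (ca p - z1%:~R)));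
      by rewrite ?rmorphB /= ?rmorphB /=; lra.
by move=> /up_edge_ex[] u h; apply: core u _; rewrite //; apply: segmentC.
Qed.

Variable d : trajectory tri.

Lemma crossing j : exists x y z,
  [/\ shared_side tri (tile_at d j) (tile_at d (j + 1)) (lat x) (lat y),
      vertices3 (tri (tile_at d j)) (lat x) (lat y) (lat z),
      open_segment (lat x) (lat y) (pt d (j + 1)),
      same_direction (pt d (j + 2) - pt d (j + 1))
        (refract (lat y - lat x) (pt d (j + 1) - pt d j)) &
      [/\ hexadj x y, hexadj x z & hexadj y z]].
Proof.
have [a [b [sh op dir]]] := traj_refract d j; have [_ /sideP[c v] _] := sh.
have [x [y [z [[ex ey ez] h]]]] := tile_vertices_lat Htiling base v.
by exists x, y, z; rewrite -ex -ey -ez.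
Qed.

Lemma crossed_edge j : exists x y, hexadj x y /\ open_segment (lat x) (lat y) (pt d j).
Proof.
have [x [y [z [_ _ op _ [h _ _]]]]] := crossing (j - 1).
by exists x, y; move: op; rewrite subrK.
Qed.

(** Otherwise the open segment would be a single point, lying both on an edge and inside a tile. *)
Lemma traj_moves j : pt d j <> pt d (j + 1).
Proof.
move=> e; have [x [y [h op]]] := crossed_edge j.
apply: (edge_inside h (open_segment_segment op) (T := tile_at d j)).
apply: traj_inside; exists 2^-1; split; first lra.
by rewrite -e /on_line subrr scaler0 addr0.
Qed.

(** Between crossing points the curve is inside a tile and meets no edge; at a crossing point the
    crossed edge is the only one it meets. *)
Lemma traj_verticesE p : traj_vertices d p <->
  exists j x y, [/\ p = lat x, hexadj x y & open_segment (lat x) (lat y) (pt d j)].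
Proof.
split=> [[q [e [s [ss [i _ cs]]]]]|[j [x [y [-> h op]]]]].
  have [x [y [ex ey h]]] := tiling_edge_lat Htiling base e.
  have [m sm] : exists m, segment p q (pt d m).
    case: (segment_split cs) => [sE|sE|/(traj_inside (t := d)) ins].
    - by exists i; rewrite -sE.
    - by exists (i + 1); rewrite -sE.
    - by case: (edge_inside (T := tile_at d i) h (p := s)) => //; rewrite -ex -ey.
  have [x' [y' [h' op]]] := crossed_edge m; exists m, x, y; split=> //.
  rewrite ex ey in sm; case: (edge_meet h' h op sm) => -[? ?]; subst x' y' => //.
  exact: open_segmentC.
exists (lat y); split; first exact: (lat_edge Htiling base h).
exists (pt d j); split; first exact: open_segment_segment.
exists j => //; exists 0; split; first by rewrite lexx ler01.
by rewrite /on_line scale0r addr0.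
Qed.
End Lattice.

(** * Folding the tiles *)

Section Refract.
Variable R : realType.
Implicit Types (e t u v w : plane R).

Lemma dot_gt0 e : e != 0 -> 0 < dot e e.
Proof.
rewrite dotE => e0; rewrite lt_neqAle addr_ge0 ?andbT; try by rewrite -expr2 sqr_ge0.
rewrite eq_sym -!expr2 paddr_eq0 ?sqr_ge0 // !sqrf_eq0; apply: contra e0 => /andP[/eqP h1 /eqP h2].
by apply/eqP; apply: plane_eq; rewrite ?h1 ?h2 !pE.
Qed.

Lemma dot_frame t u w : dot t t = 1 ->
  dot u w = dot t u * dot t w + det2 t u * det2 t w.
Proof. by move=> t1; rewrite -[LHS]mul1r -t1 !dotE /det2; ring. Qed.

Lemma det_frame t u w : dot t t = 1 ->
  det2 u w = dot t u * det2 t w - det2 t u * dot t w.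
Proof. by move=> t1; rewrite -[LHS]mul1r -t1 !dotE /det2; ring. Qed.

(** The coefficients are, up to sign, the real and imaginary parts of the square of [e], read as a
    complex number in the frame of [t]. *)
Lemma refract_dot e t w : e != 0 -> dot t t = 1 ->
  dot (refract e t) w * dot e e =
    (det2 t e ^+ 2 - dot t e ^+ 2) * dot t w - 2 * dot t e * det2 t e * det2 t w.
Proof.
move=> /dot_gt0/lt0r_neq0 e0 t1.
have -> : dot (refract e t) w * dot e e = dot t w * dot e e - 2 * dot t e * dot e w.
  by move: e0; rewrite /refract !dotE !pE => e0; field.
by rewrite (dot_frame e e t1) (dot_frame e w t1); ring.
Qed.

Lemma refract_det e t w : e != 0 -> dot t t = 1 ->
  det2 (refract e t) w * dot e e =
    (det2 t e ^+ 2 - dot t e ^+ 2) * det2 t w + 2 * dot t e * det2 t e * dot t w.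
Proof.
move=> /dot_gt0/lt0r_neq0 e0 t1.
have -> : det2 (refract e t) w * dot e e = det2 t w * dot e e - 2 * dot t e * det2 e w.
  by move: e0; rewrite /refract /det2 !dotE !pE => e0; field.
by rewrite (dot_frame e e t1) (det_frame e w t1); ring.
Qed.

Lemma refract_isom e t : e != 0 -> dot (refract e t) (refract e t) = dot t t.
Proof.
by move=> /dot_gt0/lt0r_neq0; rewrite /refract !dotE !pE => e0; field.
Qed.

Lemma refractK e t : e != 0 -> refract e (refract e t) = t.
Proof.
move=> /dot_gt0/lt0r_neq0; rewrite /refract !dotE => e0.
by apply: plane_eq; rewrite !pE; field.
Qed.

Lemma refractZ e (k : R) t : refract e (k *: t) = k *: refract e t.
Proof. by rewrite /refract dotE; apply: plane_eq; rewrite !dotE !pE; ring. Qed.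

(* [b - a] squared is [- |b - a|^2 a b] for points [a], [b] of the unit circle
   of the complex plane. *)
Lemma chord_square (a1 a2 b1 b2 : R) : a1 ^+ 2 + a2 ^+ 2 = 1 -> b1 ^+ 2 + b2 ^+ 2 = 1 ->
  let L := (b1 - a1) ^+ 2 + (b2 - a2) ^+ 2 in
  (b1 - a1) ^+ 2 - (b2 - a2) ^+ 2 = - L * (a1 * b1 - a2 * b2) /\
  2 * (b1 - a1) * (b2 - a2) = - L * (a1 * b2 + a2 * b1).
Proof.
move=> na nb L; split; apply/eqP; rewrite -subr_eq0; apply/eqP.
  transitivity (((b1 - a1) * b1 - (b2 - a2) * b2) * (1 - (a1 ^+ 2 + a2 ^+ 2)) -
    ((b1 - a1) * a1 - (b2 - a2) * a2) * (1 - (b1 ^+ 2 + b2 ^+ 2))).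
    by rewrite /L; ring.
  by rewrite na nb !subrr !mulr0 subrr.
transitivity (((b1 - a1) * b2 + (b2 - a2) * b1) * (1 - (a1 ^+ 2 + a2 ^+ 2)) -
  ((b1 - a1) * a2 + (b2 - a2) * a1) * (1 - (b1 ^+ 2 + b2 ^+ 2))).
  by rewrite /L; ring.
by rewrite na nb !subrr !mulr0 subrr.
Qed.

(** In complex notation, refraction conjugates and then multiplies by minus the square of the
    direction of [b - a]. The conjugation turns the phase [ga] into [- ga], the square contributes
    [al + be] by [chord_square], and the orientation [s] is reversed. *)
Lemma refract_phase (r s al be ga : R) (a b c o t : plane R) :
  0 < r -> s ^+ 2 = 1 -> dot t t = 1 -> a != b ->
  det2 t (a - o) = r * cos al -> s * dot t (a - o) = r * sin al ->
  det2 t (b - o) = r * cos be -> s * dot t (b - o) = r * sin be ->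
  det2 t (c - o) = r * cos ga -> s * dot t (c - o) = r * sin ga ->
  det2 (refract (b - a) t) (o - c) = r * cos (al + be - ga) /\
  - s * dot (refract (b - a) t) (o - c) = r * sin (al + be - ga).
Proof.
move=> r0 s1 t1 ab ca sa cb sb cc sc.
have e0 : b - a != 0 by rewrite subr_eq0 eq_sym.
have r0' := lt0r_neq0 r0.
pose S v := s * dot t v.
have ce : det2 t (b - a) = r * (cos be - cos al).
  by rewrite mulrBr -ca -cb /det2 !pE; ring.
have de : s * dot t (b - a) = r * (sin be - sin al).
  by rewrite mulrBr -sa -sb !dotE !pE; ring.
have dd : dot t (b - a) ^+ 2 = (r * (sin be - sin al)) ^+ 2.
  by rewrite -de exprMn s1 mul1r.
have L0 := lt0r_neq0 (dot_gt0 e0).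
have n1 := cos2Dsin2 al; have n2 := cos2Dsin2 be.
have [q1 q2] := chord_square n1 n2.
set L := (cos be - cos al) ^+ 2 + (sin be - sin al) ^+ 2 in q1 q2.
have LE : dot (b - a) (b - a) = r ^+ 2 * L.
  by rewrite (dot_frame _ _ t1) -!expr2 dd ce /L; ring.
have oc u : det2 u (o - c) = - det2 u (c - o) by rewrite /det2 !pE; ring.
have oc' u : dot u (o - c) = - dot u (c - o) by rewrite !dotE !pE; ring.
have sdd : s * dot t (c - o) * (s * dot t (b - a)) = dot t (c - o) * dot t (b - a).
  have -> : s * dot t (c - o) * (s * dot t (b - a)) = s ^+ 2 * (dot t (c - o) * dot t (b - a)).
    by ring.
  by rewrite s1 mul1r.
rewrite oc oc'; split; apply: (mulIf L0).
  rewrite mulNr refract_det // LE dd ce cc.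
  have -> : 2 * dot t (b - a) * (r * (cos be - cos al)) * dot t (c - o) =
    2 * (r * (cos be - cos al)) * (dot t (c - o) * dot t (b - a)) by ring.
  rewrite -sdd sc de cosB cosD sinD.
  transitivity (- (r ^+ 3) * (((cos be - cos al) ^+ 2 - (sin be - sin al) ^+ 2) * cos ga +
     (2 * (cos be - cos al) * (sin be - sin al)) * sin ga)); first by ring.
  by rewrite q1 q2; ring.
have -> : - s * - dot (refract (b - a) t) (c - o) * dot (b - a) (b - a) =
    s * (dot (refract (b - a) t) (c - o) * dot (b - a) (b - a)) by ring.
rewrite refract_dot // LE dd ce cc.
have -> : s * (((r * (cos be - cos al)) ^+ 2 - (r * (sin be - sin al)) ^+ 2) * dot t (c - o) -
   2 * dot t (b - a) * (r * (cos be - cos al)) * (r * cos ga)) =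
   ((r * (cos be - cos al)) ^+ 2 - (r * (sin be - sin al)) ^+ 2) * (s * dot t (c - o)) -
   2 * (s * dot t (b - a)) * (r * (cos be - cos al)) * (r * cos ga) by ring.
rewrite sc de sinB cosD sinD.
transitivity (r ^+ 3 * (((cos be - cos al) ^+ 2 - (sin be - sin al) ^+ 2) * sin ga -
   (2 * (cos be - cos al) * (sin be - sin al)) * cos ga)); first by ring.
by rewrite q1 q2; ring.
Qed.
End Refract.

Section Phase.
Variable R : realType.
Implicit Types (a b c o p q t : plane R).

Definition phase (t0 w1 w2 : R) (x : Z2) : R := t0 + x.1%:~R * w1 + x.2%:~R * w2.

Lemma phase_opposite (t0 w1 w2 : R) x y z :
  phase t0 w1 w2 (opposite x y z) = phase t0 w1 w2 x + phase t0 w1 w2 y - phase t0 w1 w2 z.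
Proof. by rewrite /phase /opposite /= !rmorphB !rmorphD /=; ring. Qed.

Lemma det2_line t o a b (s : R) :
  det2 t (on_line a b s - o) = (1 - s) * det2 t (a - o) + s * det2 t (b - o).
Proof. by rewrite /det2 /on_line !pE; ring. Qed.

Variables (I : Type) (tri : I -> triangle R).
Hypothesis Htiling : periodic_triangle_tiling tri.
Variables (T0 : I) (A0 A1 A2 : plane R).
Hypothesis base : vertices3 (tri T0) A0 A1 A2.
Variables (r t0 w1 w2 eta : R) (d : trajectory tri).
Hypothesis r_gt0 : 0 < r.
Local Notation lat := (lat A0 A1 A2).
Local Notation Th := (phase t0 w1 w2).

(* Folding [T] onto a fixed triangle inscribed in a circle of radius [r]:
   [o] is the circumcenter of [T], [t] the direction of the trajectory in [T],
   and [s] the orientation of the folding. *)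
Definition frame T t o (s : R) := [/\ dot t t = 1, s ^+ 2 = 1 &
  forall x i, tri T i = lat x ->
    det2 t (lat x - o) = r * cos (Th x) /\ s * dot t (lat x - o) = r * sin (Th x)].

(** The symmetry about the midpoint of the side moves the circumcenter to [a + b - o]. The vertex
    opposite to [z] gets the phase [Th x + Th y - Th z], which is the right one because [Th] is
    affine. *)
Lemma frame_step T T' a b t o s : shared_side tri T T' a b -> frame T t o s ->
  frame T' (refract (b - a) t) (a + b - o) (- s).
Proof.
move=> sh [t1 s1 ph]; have [_ /sideP[c v] _] := sh.
have v' := neighbour_vertices Htiling sh v.
have [x [y [z [[ex ey ez] [xy _ _]]]]] := tile_vertices_lat Htiling base v.
rewrite ex ey ez lat_opposite in v v' *.
have ab : lat x != lat y.
  by apply/eqP => /(lat_inj Htiling base) e; rewrite e hexadj_irr in xy.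
have e0 : lat y - lat x != 0 by rewrite subr_eq0 eq_sym.
have [i [j [k [_ /esym hi /esym hj /esym hk]]]] := v.
have [ci si] := ph _ _ hi; have [cj sj] := ph _ _ hj; have [ck sk] := ph _ _ hk.
split; rewrite ?refract_isom ?sqrrN // => x' i' ei'.
case: (vertices3_in i' v'); rewrite ei' => /(lat_inj Htiling base) ->.
- have -> : lat x - (lat x + lat y - o) = o - lat y by apply: plane_eq; rewrite !pE; ring.
  have -> : Th x = Th x + Th y - Th y by rewrite addrK.
  exact: refract_phase.
- have -> : lat y - (lat x + lat y - o) = o - lat x by apply: plane_eq; rewrite !pE; ring.
  have -> : Th y = Th x + Th y - Th x by rewrite addrC addKr.
  exact: refract_phase.
- have -> : lat (opposite x y z) - (lat x + lat y - o) = o - lat z.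
    by rewrite -lat_opposite; apply: plane_eq; rewrite !pE; ring.
  by rewrite phase_opposite; exact: refract_phase.
Qed.

(** Both ends of the shared side have the same height in the two frames, and height is affine along
    the side. *)
Lemma frame_height T T' a b t o s p : shared_side tri T T' a b -> frame T t o s ->
  open_segment a b p -> det2 (refract (b - a) t) (p - (a + b - o)) = det2 t (p - o).
Proof.
move=> sh fr [k [_ ->]]; rewrite !det2_line.
have [_ _ ph'] := frame_step sh fr; have [_ _ ph] := fr.
have [_ sT sT'] := sh; have [c v] := (sideP _ _ _).1 sT; have [c' v'] := (sideP _ _ _).1 sT'.
have [x [y [z [[ex ey _] _]]]] := tile_vertices_lat Htiling base v.
rewrite {}ex {}ey in ph' v v' *.
have [i [j [_ [_ /esym hi /esym hj _]]]] := v.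
have [i' [j' [_ [_ /esym hi' /esym hj' _]]]] := v'.
by rewrite (ph _ _ hi).1 (ph _ _ hj).1 (ph' _ _ hi').1 (ph' _ _ hj').1.
Qed.

(** The signed distance [r * eta] between trajectory and circumcenter is the same in all tiles: this
    is the fixed chord. The sign of [cos (Th x) - eta] gives the side on which the vertex [x]
    lies. *)
Definition traj_frame j := exists t o s (lam : R), [/\ frame (tile_at d j) t o s,
  0 < lam, pt d (j + 1) - pt d j = lam *: t & det2 t (pt d j - o) = r * eta].

Lemma det2_next t o p q (lam : R) : q - p = lam *: t -> det2 t (q - o) = det2 t (p - o).
Proof.
move=> e; have -> : q = p + lam *: t by rewrite -e addrC subrK.
by rewrite /det2 !pE; ring.
Qed.

Lemma shared_sideC T T' a b : shared_side tri T T' a b -> shared_side tri T' T a b.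
Proof. by case=> ne h h'; split=> // e; apply: ne. Qed.

Lemma shared_side_neq T T' a b : shared_side tri T T' a b -> b - a != 0.
Proof.
move=> [_ /sideP[c v] _]; rewrite subr_eq0; apply/eqP => e.
by have := tile_nondegenerate Htiling v; rewrite e subrr /det2 !pE !mul0r subrr eqxx.
Qed.

Lemma traj_frame_next j : traj_frame j -> traj_frame (j + 1).
Proof.
move=> [t [o [s [lam [fr lam0 dE hE]]]]].
have [a [b [sh op [k [k0 kE]]]]] := traj_refract d j.
exists (refract (b - a) t), (a + b - o), (- s), (k * lam); split.
- exact: frame_step sh fr.
- exact: mulr_gt0.
- have -> : j + 1 + 1 = j + 2 by rewrite -addrA.
  by rewrite kE dE refractZ scalerA.
- by rewrite (frame_height sh fr op) (det2_next _ dE).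
Qed.

Lemma traj_frame_prev j : traj_frame (j + 1) -> traj_frame j.
Proof.
move=> [t [o [s [lam [fr lam0 dE hE]]]]].
have [a [b [sh op [k [k0 kE]]]]] := traj_refract d j.
have e0 := shared_side_neq sh; have sh' := shared_sideC sh.
have dE' : pt d (j + 1) - pt d j = (lam / k) *: refract (b - a) t.
  have e2 : j + 2 = j + 1 + 1 by rewrite -addrA.
  move: kE; rewrite e2 dE => /(congr1 (refract (b - a))).
  rewrite !refractZ refractK // => e.
  by rewrite mulrC -scalerA e scalerA mulVf ?scale1r // lt0r_neq0.
exists (refract (b - a) t), (a + b - o), (- s), (lam / k); split=> //.
- exact: frame_step sh' fr.
- exact: divr_gt0.
- by rewrite -(det2_next _ dE') (frame_height sh' fr op).
Qed.

Lemma traj_frame_all : traj_frame 0 -> forall j, traj_frame j.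
Proof.
move=> h; apply: int_ind2 => // j; [exact: traj_frame_next | exact: traj_frame_prev].
Qed.
End Phase.

Section Base.
Variable R : realType.
Implicit Types (a b c o p q t u v : plane R).

Lemma circumcenter a b c : det2 (b - a) (c - a) != 0 ->
  exists o, dot (b - o) (b - o) = dot (a - o) (a - o) /\
            dot (c - o) (c - o) = dot (a - o) (a - o).
Proof.
move=> D0; pose mk (x y : R) : plane R := \row_i (if i == 0 then x else y).
have mkx x y : px (mk x y) = x by rewrite /px mxE.
have mky x y : py (mk x y) = y by rewrite /py mxE.
pose D := det2 (b - a) (c - a).
pose nb := dot (b - a) (b - a); pose nc := dot (c - a) (c - a).
exists (a + mk ((nb * py (c - a) - nc * py (b - a)) / (2 * D))
               ((nc * px (b - a) - nb * px (c - a)) / (2 * D))).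
move: D0; rewrite -/D /nb /nc !dotE !pE mkx mky.
by rewrite /D /det2 !pE => D0; split; field.
Qed.

Lemma frame_inj t u v : dot t t = 1 -> dot t u = dot t v -> det2 t u = det2 t v -> u = v.
Proof.
move=> t1 e1 e2; apply/eqP; rewrite -subr_eq0; apply/negPn/negP => /dot_gt0.
rewrite (dot_frame _ _ t1); have -> : dot t (u - v) = 0.
  by rewrite -(subrr (dot t v)) -{1}e1 !dotE !pE; ring.
have -> : det2 t (u - v) = 0 by rewrite -(subrr (det2 t v)) -{1}e2 /det2 !pE; ring.
by rewrite !mul0r addr0 ltxx.
Qed.

Lemma unit_direction u : u != 0 -> exists (t : plane R) (l : R), [/\ dot t t = 1, 0 < l & u = l *: t].
Proof.
move=> /dot_gt0 u0; have s0 : 0 < Num.sqrt (dot u u) by rewrite sqrtr_gt0.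
exists ((Num.sqrt (dot u u))^-1 *: u), (Num.sqrt (dot u u)); split=> //.
  transitivity ((Num.sqrt (dot u u))^-1 ^+ 2 * dot u u); first by rewrite !dotE !pE; ring.
  by rewrite exprVn sqr_sqrtr ?ltW // mulVf // lt0r_neq0.
by rewrite scalerA mulfV ?scale1r // lt0r_neq0.
Qed.

Variables (I : Type) (tri : I -> triangle R).
Hypothesis Htiling : periodic_triangle_tiling tri.

Lemma frame_base T (A0 A1 A2 t o : plane R) (r h0 h1 h2 : R) :
  vertices3 (tri T) A0 A1 A2 -> dot t t = 1 ->
  det2 t (A0 - o) = r * cos h0 -> dot t (A0 - o) = r * sin h0 ->
  det2 t (A1 - o) = r * cos h1 -> dot t (A1 - o) = r * sin h1 ->
  det2 t (A2 - o) = r * cos h2 -> dot t (A2 - o) = r * sin h2 ->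
  frame tri A0 A1 A2 r h0 (h1 - h0) (h2 - h1) T t o 1.
Proof.
move=> v t1 c0 s0 c1 s1 c2 s2; split=> //; first exact: expr1n.
have e0 : lat A0 A1 A2 (0, 0) = A0 by apply: plane_eq; rewrite /lat /= !pE; ring.
have e1 : lat A0 A1 A2 (1, 0) = A1 by apply: plane_eq; rewrite /lat /= !pE; ring.
have e2 : lat A0 A1 A2 (1, 1) = A2.
  by apply: plane_eq; rewrite /lat /= !pE; ring.
have L0 := lat_inj Htiling v.
move=> x i ex; rewrite mul1r; case: (vertices3_in i v); rewrite ex => e; rewrite e.
- have -> : x = (0, 0) by apply: L0; rewrite e e0.
  by rewrite /phase /= !mul0r !addr0.
- have -> : x = (1, 0) by apply: L0; rewrite e e1.
  have -> : phase h0 (h1 - h0) (h2 - h1) (1, 0) = h1 by rewrite /phase /=; ring.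
  by [].
- have -> : x = (1, 1) by apply: L0; rewrite e e2.
  have -> : phase h0 (h1 - h0) (h2 - h1) (1, 1) = h2 by rewrite /phase /=; ring.
  by [].
Qed.

Lemma traj_frame_ex (d : trajectory tri) : exists (A0 A1 A2 : plane R) (r t0 w1 w2 eta : R),
  [/\ vertices3 (tri (tile_at d 0)) A0 A1 A2, 0 < r,
      [/\ 0 < w1, 0 < w2 & w1 + w2 < pi *+ 2] &
      traj_frame A0 A1 A2 r t0 w1 w2 eta d 0].
Proof.
pose T := tile_at d 0; pose a := tri T 0; pose b := tri T 1; pose c := tri T 2%:R.
have vT : vertices3 (tri T) a b c by exists 0, 1, 2%:R.
have D0 := tile_nondegenerate Htiling vT.
have [o [ob oc]] := circumcenter D0.
have e0 : pt d (0 + 1) - pt d 0 != 0.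
  by rewrite subr_eq0 eq_sym; apply/eqP; exact: (traj_moves Htiling vT).
have [t [lam [t1 lam0 dE]]] := unit_direction e0.
have ab : a <> b by move=> e; move: D0; rewrite e subrr /det2 !pE !mul0r subrr eqxx.
have ac : a <> c by move=> e; move: D0; rewrite e subrr /det2 !pE !mulr0 subrr eqxx.
have bc : b <> c by move=> e; move: D0; rewrite e /det2 mulrC subrr eqxx.
have r20 : 0 < dot (a - o) (a - o).
  rewrite lt_neqAle; apply/andP; split; last by rewrite dotE -!expr2 addr_ge0 ?sqr_ge0.
  apply/eqP => e; apply: ab.
  have z p : dot (p - o) (p - o) = 0 -> p = o.
    move=> e'; apply/eqP; rewrite -subr_eq0; apply/negPn/negP => /dot_gt0.
    by rewrite e' ltxx.
  have zb : dot (b - o) (b - o) = 0 by rewrite ob; exact: esym e.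
  by rewrite (z a (esym e)) (z b zb).
set r := Num.sqrt (dot (a - o) (a - o)).
have r0 : 0 < r by rewrite sqrtr_gt0.
have r2 : r ^+ 2 = dot (a - o) (a - o) by rewrite sqr_sqrtr // ltW.
have ang p (h : R) : dot (p - o) (p - o) = dot (a - o) (a - o) -> exists h' : R,
    [/\ h <= h' < h + pi *+ 2, det2 t (p - o) = r * cos h' & dot t (p - o) = r * sin h'].
  move=> e; have [|h' [h1 h2 ch sh]] := @angle_ex R (det2 t (p - o) / r) (dot t (p - o) / r) h.
    rewrite !expr_div_n -mulrDl r2 -e (dot_frame (p - o) (p - o) t1) -!expr2 addrC divff //.
    by move: r20; rewrite -e (dot_frame _ _ t1) -!expr2 => /lt0r_neq0.
  by exists h'; rewrite h1 h2; split=> //; rewrite ?ch ?sh mulrC divfK // lt0r_neq0.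
(* The other two angles are chosen in the turn that starts at [ha], so that the two weights add up
   to less than a turn. *)
have [ha [_ ca sa]] := ang a 0 erefl.
have [hb [/andP[hb1 hb2] cb sb]] := ang b ha ob.
have [hc [/andP[hc1 hc2] cc sc]] := ang c ha oc.
have neq p q h h' : p <> q -> det2 t (p - o) = r * cos h -> dot t (p - o) = r * sin h ->
   det2 t (q - o) = r * cos h' -> dot t (q - o) = r * sin h' -> h <> h'.
  move=> pq e1 e2 e3 e4 e; apply: pq; apply: (@addIr _ (- o)).
  by apply: (frame_inj t1); rewrite ?e2 ?e4 ?e1 ?e3 e.
have nab := neq _ _ _ _ ab ca sa cb sb.
have nac := neq _ _ _ _ ac ca sa cc sc.
have nbc := neq _ _ _ _ bc cb sb cc sc.
have lab : ha < hb by rewrite lt_neqAle hb1 andbT; apply/eqP.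
have lac : ha < hc by rewrite lt_neqAle hc1 andbT; apply/eqP.
pose eta := det2 t (pt d 0 - o) / r.
have etaE : det2 t (pt d 0 - o) = r * eta by rewrite mulrC divfK // lt0r_neq0.
(* Naming the vertices in the order of their angles makes both weights positive. *)
have [lbc|lcb|/nbc//] := ltgtP hb hc.
  exists a, b, c, r, ha, (hb - ha), (hc - hb), eta; split=> //.
    by split; lra.
  by exists t, o, 1, lam; split=> //; exact: frame_base.
exists a, c, b, r, ha, (hc - ha), (hb - hc), eta; split=> //.
- exact: vertices3AC.
- by split; lra.
- by exists t, o, 1, lam; split=> //; apply: frame_base => //; exact: vertices3AC.
Qed.
End Base.

(** * The edges crossed by the trajectory *)

Section Heights.
Variables (R : realType) (I : Type) (tri : I -> triangle R).
Hypothesis Htiling : periodic_triangle_tiling tri.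
Variables (T0 : I) (A0 A1 A2 : plane R).
Hypothesis base : vertices3 (tri T0) A0 A1 A2.
Variables (r t0 w1 w2 eta : R) (d : trajectory tri).
Hypothesis r_gt0 : 0 < r.
Hypothesis frames : forall j, traj_frame A0 A1 A2 r t0 w1 w2 eta d j.
Local Notation lat := (lat A0 A1 A2).
Local Notation Th := (phase t0 w1 w2).
Implicit Types (x y z : Z2) (j : int).

Definition crosses j x y := hexadj x y /\ open_segment (lat x) (lat y) (pt d j).

Lemma crossesC j x y : crosses j x y -> crosses j y x.
Proof. by move=> [h o]; split; [apply: hexadj_sym | apply: open_segmentC]. Qed.

Lemma crosses_ex j : exists x y, crosses j x y.
Proof. exact: (crossed_edge Htiling base d j). Qed.

Lemma crosses_uniq j x y x' y' : crosses j x y -> crosses j x' y' ->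
  (x = x' /\ y = y') \/ (x = y' /\ y = x').
Proof.
move=> [h o] [h' o']; apply: (edge_meet Htiling base h h' o).
exact: open_segment_segment.
Qed.

Lemma crosses_shared j x y : crosses (j + 1) x y ->
  shared_side tri (tile_at d j) (tile_at d (j + 1)) (lat x) (lat y).
Proof.
move=> c; have [x' [y' [z [sh _ o _ [h _ _]]]]] := crossing Htiling base d j.
have sideC t (a b : plane R) : side t a b -> side t b a.
  by move=> [i [k [ik ea eb]]]; exists k, i; rewrite eq_sym.
have [[-> ->]|[-> ->]] := crosses_uniq c (conj h o); first exact: sh.
by case: sh => ne s1 s2; split=> //; exact: sideC.
Qed.

Lemma crosses_side j x y : crosses j x y -> side (tri (tile_at d j)) (lat x) (lat y).
Proof. by move=> c; have := @crosses_shared (j - 1) x y; rewrite subrK => /(_ c)[]. Qed.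

Lemma side_third T x y : side (tri T) (lat x) (lat y) -> exists z,
  vertices3 (tri T) (lat x) (lat y) (lat z) /\ hexadj x z /\ hexadj y z.
Proof.
move=> /sideP[c v]; have [x' [y' [z [[ex ey ez] [h1 h2 h3]]]]] := tile_vertices_lat Htiling base v.
exists z; rewrite -ez; split=> //.
by rewrite (lat_inj Htiling base ex) (lat_inj Htiling base ey).
Qed.

Lemma vertices3_uniq T x y z z' : vertices3 (tri T) (lat x) (lat y) (lat z) ->
  vertices3 (tri T) (lat x) (lat y) (lat z') -> z = z'.
Proof.
move=> v v'; have [_ [_ [k [_ _ _ ek]]]] := v'.
have D0 := tile_nondegenerate Htiling v'.
case: (vertices3_in k v); rewrite -ek => e.
- by move: D0; rewrite e /det2 subrr !pE !mulr0 subrr eqxx.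
- by move: D0; rewrite e /det2 mulrC subrr eqxx.
- by apply/esym; apply: (lat_inj Htiling base).
Qed.

Lemma height_line (cx cy s : R) : 0 < s < 1 -> eta = (1 - s) * cx + s * cy ->
  [\/ cx < eta /\ eta < cy, eta < cx /\ cy < eta | cx = eta /\ cy = eta].
Proof.
move=> /andP[s0 s1] e; case: (ltgtP cx eta) => h.
- by constructor 1; split=> //; nra.
- by constructor 2; split=> //; nra.
- by constructor 3; split=> //; apply: (mulfI (lt0r_neq0 s0)); rewrite h in e; lra.
Qed.

Lemma crosses_height j x y : crosses j x y -> exists s : R,
  [/\ 0 < s < 1, pt d j = on_line (lat x) (lat y) s &
      eta = (1 - s) * cos (Th x) + s * cos (Th y)].
Proof.
move=> c; have [i [k [_ ex ey]]] := crosses_side c; have [_ [s [s01 pE]]] := c; exists s; split=> //.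
have [t [o [sg [lam [[t1 _ ph] _ _]]]]] := frames j.
rewrite pE det2_line (ph _ _ (esym ex)).1 (ph _ _ (esym ey)).1 => e.
by apply: (mulfI (lt0r_neq0 r_gt0)); rewrite -e; ring.
Qed.

Lemma crosses_sign j x y : crosses j x y ->
  (cos (Th x) < eta /\ eta < cos (Th y)) \/ (eta < cos (Th x) /\ cos (Th y) < eta).
Proof.
move=> c; have [s [s01 _ he]] := crosses_height c.
(* Otherwise the trajectory runs along the edge, and not inside the tile. *)
case: (height_line s01 he) => [?|?|[hx hy]]; [by left|by right|exfalso].
have [z [v _]] := side_third (crosses_side c).
have [i [k [l [_ ex ey ez]]]] := v; have D0 := tile_nondegenerate Htiling v.
have [t [o [sg [lam [[t1 _ ph] lam0 dE hE]]]]] := frames j.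
have [cx _] := ph _ _ (esym ex); have [cy _] := ph _ _ (esym ey); have [cz _] := ph _ _ (esym ez).
pose q := on_line (pt d j) (pt d (j + 1)) 2^-1.
have hq : det2 t (q - o) = r * eta.
  by rewrite det2_line (det2_next o dE) hE; lra.
have : inside (tri (tile_at d j)) q by apply: traj_inside; exists 2^-1; split=> //; lra.
move=> /(insideE _ v) [k1 [k2 [k3 [[? ? k30] k123 qE]]]].
have : det2 t (q - o) = k1 * det2 t (lat x - o) + k2 * det2 t (lat y - o) + k3 * det2 t (lat z - o).
  have k1E : k1 = 1 - k2 - k3 by lra.
  by rewrite qE k1E /det2 !pE; ring.
rewrite hq cx cy cz hx hy => e.
(* An inner point at the height of [x] and [y] forces [z] to that height too, and the three vertices
   would be collinear. *)
have hz : cos (Th z) = eta.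
  apply: (mulfI (lt0r_neq0 k30)); apply: (mulfI (lt0r_neq0 r_gt0)).
  have -> : r * (k3 * cos (Th z)) = r * eta - (k1 + k2) * (r * eta) by lra.
  have -> : k1 + k2 = 1 - k3 by lra.
  ring.
move/eqP: D0; apply; rewrite (det_frame _ _ t1).
have -> : det2 t (lat z - lat x) = det2 t (lat z - o) - det2 t (lat x - o) by rewrite /det2 !pE; ring.
have -> : det2 t (lat y - lat x) = det2 t (lat y - o) - det2 t (lat x - o) by rewrite /det2 !pE; ring.
by rewrite cx cy cz hx hy hz subrr mulr0 mul0r subrr.
Qed.

(** All crossings happen at height [eta], and the height is not constant along a crossed edge. *)
Lemma crosses_pt i j x y : crosses i x y -> crosses j x y -> pt d i = pt d j.
Proof.
move=> ci cj; have [s [_ -> e]] := crosses_height ci; have [s' [_ -> e']] := crosses_height cj.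
have ne : cos (Th y) - cos (Th x) != 0.
  by rewrite subr_eq0; apply/eqP => e0; case: (crosses_sign ci); rewrite e0 => -[? ?]; lra.
congr on_line; apply: (mulIf ne); lra.
Qed.

Definition crossing_path (w b : int -> Z2) := (forall j, crosses j (w j) (b j)) /\
  forall j, (w (j + 1) = w j /\ b (j + 1) <> b j) \/ (b (j + 1) = b j /\ w (j + 1) <> w j).

Lemma crossing_pathC w b : crossing_path w b -> crossing_path b w.
Proof. by move=> [c st]; split=> j; [apply: crossesC | case: (st j); [right|left]]. Qed.

Lemma crossing_lattice_path w b : crossing_path w b -> exists z : int -> Z2, lattice_path w b z.
Proof.
move=> [c st].
have /boolp.choice[z zP] j := side_third (crosses_side (c j)).
exists z; split=> j; first by have [_ [h1 h2]] := zP j; split=> //; case: (c j).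
have [v [h1 h2]] := zP j; have [v' _] := zP (j + 1).
have sh := crosses_shared (c (j + 1)); have [_ sd _] := sh.
have [mw mb] := side_in v sd; have L0 := lat_inj Htiling base.
have [hn _] := c (j + 1).
have third u : vertices3 (tri (tile_at d j)) (lat (w (j + 1))) (lat (b (j + 1))) (lat u) ->
    z (j + 1) = opposite (w (j + 1)) (b (j + 1)) u.
  move=> vu; apply: (vertices3_uniq v'); rewrite -lat_opposite.
  exact: (neighbour_vertices Htiling sh vu).
case: (st j) => -[e ne]; [left|right].
- have eb : b (j + 1) = z j.
    case: mb => /L0 // e'; by rewrite e e' hexadj_irr in hn.
  have -> : opposite (w j) (z j) (b j) = opposite (w (j + 1)) (b (j + 1)) (b j).
    by rewrite e eb.
  by split=> //; apply: third; rewrite e eb; apply: vertices3AC.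
- have ew : w (j + 1) = z j.
    case: mw => /L0 // e'; by rewrite e e' hexadj_irr in hn.
  have -> : opposite (b j) (z j) (w j) = opposite (w (j + 1)) (b (j + 1)) (w j).
    by rewrite e ew /opposite /=; congr (_, _); ring.
  by split=> //; apply: third; rewrite e ew; apply: vertices3C; apply: vertices3CA.
Qed.

(** A crossed edge has its ends on different sides of the chord, and the end that is kept fixes the
    sides for the next edge. *)
Lemma crossing_path_sign w b : crossing_path w b ->
  (forall j, cos (Th (w j)) < eta /\ eta < cos (Th (b j))) \/
  (forall j, eta < cos (Th (w j)) /\ cos (Th (b j)) < eta).
Proof.
have core w' b' : crossing_path w' b' -> cos (Th (w' 0)) < eta ->
    forall j, cos (Th (w' j)) < eta /\ eta < cos (Th (b' j)).
  move=> [c st] h0.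
  have sg j : (cos (Th (w' j)) < eta) || (eta < cos (Th (b' j))) ->
      cos (Th (w' j)) < eta /\ eta < cos (Th (b' j)).
    by case: (crosses_sign (c j)) => -[h h'] //; rewrite ltNge (ltW h) ltNge (ltW h').
  apply: int_ind2 => [|j [h h']|j [h h']]; apply: sg; first by rewrite h0.
    by case: (st j) => -[-> _]; rewrite ?h ?h' ?orbT.
  by move: h h'; case: (st j) => -[-> _] h h'; rewrite ?h ?h' ?orbT.
move=> p; case: (crosses_sign (p.1 0)) => -[h h']; first by left; apply: core.
by right => j; have [? ?] := core _ _ (crossing_pathC p) h' j.
Qed.

(** A crossing point determines the crossed edge, whose ends are told apart by their sides of the
    chord; conversely an edge determines the point by [crosses_pt]. *)
Lemma crossing_path_periodic w b : crossing_path w b -> Defs.periodic d <-> periodic_path w b.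
Proof.
move=> p; have [c st] := p; split=> -[n [n0 per]]; exists n; split=> // j.
  have cn := c (j + n%:Z); have := c j; rewrite /crosses -per -/(crosses _ _ _) => cj.
  case: (crosses_uniq cn cj) => -[e1 e2] //.
  exfalso; have [sg|sg] := crossing_path_sign p; have [h _] := sg j; have [_] := sg (j + n%:Z);
    by rewrite e2 ltNge (ltW h).
have [e1 e2] := per j; apply: (@crosses_pt _ _ (w j) (b j)); last exact: c.
by rewrite -e1 -e2; exact: c.
Qed.

Lemma crossing_path_ex : exists w b, crossing_path w b /\
  forall j, cos (Th (w j)) < eta /\ eta < cos (Th (b j)).
Proof.
have ex j : exists p : Z2 * Z2, crosses j p.1 p.2 /\ (cos (Th p.1) < eta /\ eta < cos (Th p.2)).
  have [x [y c]] := crosses_ex j; case: (crosses_sign c) => -[h1 h2]; first by exists (x, y).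
  by exists (y, x); split; [apply: crossesC | split].
have /boolp.choice[p pP] := ex; exists (fun j => (p j).1), (fun j => (p j).2).
split; last by move=> j; have [] := pP j.
split=> j; first by have [] := pP j.
have [c [lo hi]] := pP j; have [c' [lo' hi']] := pP (j + 1).
move: c c' lo hi lo' hi'; case: (p j) (p (j + 1)) => [w b] [w' b'] /= c c' lo hi lo' hi'.
have [_ sd _] := crosses_shared c'; have [z [v _]] := side_third (crosses_side c).
have [mw mb] := side_in v sd; have L0 := lat_inj Htiling base.
have ww : w' <> b by move=> e; move: lo'; rewrite e ltNge (ltW hi).
have bb : b' <> w by move=> e; move: hi'; rewrite e ltNge (ltW lo).
(* Two successive crossings of the same edge would be at the same point. *)
have nb : ~ (w' = w /\ b' = b).
  move=> [e1 e2]; rewrite e1 e2 in c'; apply: (traj_moves Htiling base (d := d) (j := j)).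
  exact: crosses_pt c c'.
have nw : w' = w \/ w' = z by case: mw => /L0; [left | | right].
have nz : b' = b \/ b' = z by case: mb => /L0; [ | left | right].
have bz : w' = z -> b' = z -> False.
  by move=> e1 e2; move: hi' lo'; rewrite e1 e2 => h; rewrite ltNge (ltW h).
case: nw => ew; first by left; split=> // eb; apply: nb.
right; case: nz => eb; last by case: bz.
by split=> // ew'; apply: nb.
Qed.
End Heights.

Section Dichotomy.
Variables (R : realType) (I : Type) (tri : I -> triangle R).
Hypothesis Htiling : periodic_triangle_tiling tri.
Variables (T0 : I) (A0 A1 A2 : plane R).
Hypothesis base : vertices3 (tri T0) A0 A1 A2.
Variables (r t0 w1 w2 eta : R) (d : trajectory tri).
Hypothesis r_gt0 : 0 < r.
Hypothesis frames : forall j, traj_frame A0 A1 A2 r t0 w1 w2 eta d j.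
Hypothesis w_gt0 : [/\ 0 < w1, 0 < w2 & w1 + w2 < pi *+ 2].
Local Notation Th := (phase t0 w1 w2).
Local Notation crossing_path := (crossing_path A0 A1 A2 d).

Lemma crossing_path_disjoint w b : crossing_path w b ->
  forall x, on_path b x -> on_path w x -> False.
Proof.
move=> p x [i ->] [j e].
have [sg|sg] := crossing_path_sign Htiling base r_gt0 frames p;
  have [_ hb] := sg i; have [hw _] := sg j; move: hb;
  by rewrite e ltNge (ltW hw).
Qed.

Lemma crossing_dichotomy w b : crossing_path w b -> cycle_dichotomy w b.
Proof.
have core w' b' : crossing_path w' b' ->
    (forall j, cos (Th (w' j)) < eta /\ eta < cos (Th (b' j))) -> cycle_dichotomy w' b'.
  move=> p sg; have [lo hi] := sg 0.
  have [z lp] := crossing_lattice_path Htiling base p.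
  have e1 : -1 < eta by apply: le_lt_trans lo; apply: cos_geN1.
  have e2 : eta < 1 by apply: lt_le_trans hi _; apply: cos_le1.
  have [|_ cE] := @acos_def R eta; first by rewrite !ltW.
  have a0 : 0 < acos eta by apply: acos_gt0; rewrite ltW.
  have a1 : acos eta < pi by apply: acos_ltpi; rewrite e1 ltW.
  have [h1 h2 h3] := w_gt0.
  (* The vertices above the chord fill an arc of half-angle [acos eta] around the angle 0; adding
     [acos eta] to all phases makes the arc begin at 0. *)
  apply: (@lattice_path_dichotomy R w1 w2 (pi *+ 2 - w1 - w2) (pi *+ 2) (acos eta *+ 2)
    (pi *+ 2 - acos eta *+ 2) (t0 + acos eta) _ _ _ lp).
    by split=> //; lra.
  have shift x (n : int) : t0 + acos eta + x.1%:~R * w1 + x.2%:~R * w2 + n%:~R * (pi *+ 2) =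
      Th x + acos eta + n%:~R * (pi *+ 2) by rewrite /phase; ring.
  have [tr _] := lp; split.
  - by split; [exact: ltW | exact: ltW | lra].
  - by split; lra.
  - by split; ring.
  - move=> _ [j ->]; have [_ h] := sg j.
    have [||n hn] := @cos_window_gt R (Th (b' j)) (acos eta) _ _; rewrite ?a0 ?cE //.
    by exists n; rewrite shift.
  - move=> _ [j ->]; have [h _] := sg j.
    have [||n hn] := @cos_window_lt R (Th (w' j)) (acos eta) _ _; rewrite ?a0 ?cE //.
    by exists n; rewrite shift.
  - exact: path_connected_b lp.
  - exact: path_connected_w lp.
  - move=> _ [j ->]; exists (w' j); split; first by exists j.
    by have [h _ _] := tr j; apply: hexadj_sym.
  - move=> _ [j ->]; exists (b' j); split; first by exists j.
    by have [h _ _] := tr j.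
move=> p; have [sg|sg] := crossing_path_sign Htiling base r_gt0 frames p; first exact: core.
apply: cycle_dichotomy_swap; apply: core (crossing_pathC p) _ => j.
by have [? ?] := sg j.
Qed.
End Dichotomy.

(** * Transfer of connectedness and cycles from the lattice to the tiling *)

Section Transfer.
Variables (T : eqType) (f : Z2 -> T) (P : Z2 -> Prop) (G : graph T).
Hypothesis f_inj : injective f.
Hypothesis vertE : forall v, gvert G v <-> exists x, v = f x /\ P x.
Hypothesis adjE : forall x y, gadj G (f x) (f y) = induced_hex P x y.
Hypothesis adj_vert : forall u v, gadj G u v -> gvert G v.

Lemma transfer_connected : connected P hexadj -> connected_graph G.
Proof.
move=> cP _ _ /vertE[x [-> Px]] /vertE[y [-> Py]].
elim: (cP x y Px Py) => [|u v _ [p [pp pl]] Pv uv]; first by exists [::].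
have Pu : P u.
  case/lastP: p pp pl => [_ /f_inj <-//|p q]; rewrite rcons_path last_rcons => /andP[_ a] e.
  by move: (adj_vert a); rewrite e => /vertE[u' [/f_inj -> ]].
exists (rcons p (f v)); rewrite rcons_path last_rcons pp pl adjE /induced_hex uv.
by split=> //=; apply/andP; split; apply/asboolP.
Qed.

Lemma transfer_cycle c : graph_cycle G (map f c) <-> hex_cycle P c.
Proof.
rewrite /graph_cycle /hex_cycle size_map /ucycle /ucycleb map_inj_uniq //.
suff -> : cycle (gadj G) (map f c) = cycle (induced_hex P) c by [].
case: c => //= x c; rewrite -map_rcons path_map; apply: eq_path => u v /=.
exact: adjE.
Qed.

Lemma cycle_transfer c : graph_cycle G c -> exists c', c = map f c' /\ hex_cycle P c'.
Proof.
move=> gc; have [_ /andP[cy _]] := gc.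
suff [c' e] : exists c', c = map f c' by exists c'; split=> //; apply/transfer_cycle; rewrite -e.
have all_v v : v \in c -> exists x, v = f x.
  by move=> /(prev_cycle cy)/adj_vert/vertE[x [-> _]]; exists x.
elim: c {gc cy} all_v => [|v c IH] all_v; first by exists [::].
have [x ->] := all_v v (mem_head _ _).
have [u uc|c' ->] := IH; first by apply: all_v; rewrite inE uc orbT.
by exists (x :: c').
Qed.
End Transfer.

(** * The color graphs *)

Section Coloring.
Variables (R : realType) (I : Type) (tri : I -> triangle R).
Hypothesis Htiling : periodic_triangle_tiling tri.
Variables (T0 : I) (A0 A1 A2 : plane R).
Hypothesis base : vertices3 (tri T0) A0 A1 A2.
Variables (r t0 w1 w2 eta : R) (d : trajectory tri).
Hypothesis r_gt0 : 0 < r.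
Hypothesis frames : forall j, traj_frame A0 A1 A2 r t0 w1 w2 eta d j.
Hypothesis w_gt0 : [/\ 0 < w1, 0 < w2 & w1 + w2 < pi *+ 2].
Local Notation Th := (phase t0 w1 w2).
Local Notation crossing_path := (crossing_path A0 A1 A2 d).
Local Notation lat := (lat A0 A1 A2).

(** The side of the chord is itself a coloring. *)
Lemma coloring_ex : exists L, traj_coloring d L.
Proof.
have [w [b [[c st] sg]]] := crossing_path_ex Htiling base r_gt0 frames.
have L0 := lat_inj Htiling base.
exists (fun v => `[< exists x, v = lat x /\ eta < cos (Th x) >]).
exists (lat \o w), (lat \o b); split=> j /=.
- by have [h o] := c j; split=> //; exact: (lat_edge Htiling base h).
- by case: (st j) => -[-> ne]; [left|right]; split=> // /L0.
- have [lo hi] := sg j; split; last by apply/asboolP; exists (b j).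
  by apply/asboolPn => -[x [/L0 <-]]; rewrite ltNge (ltW lo).
Qed.

Variable L : plane R -> bool.

Lemma coloring_path : traj_coloring d L -> exists w b, crossing_path w b /\
  forall j, L (lat (w j)) = false /\ L (lat (b j)) = true.
Proof.
move=> [W [B [c st col]]].
have ex j : exists p : Z2 * Z2, [/\ W j = lat p.1, B j = lat p.2 & crosses A0 A1 A2 d j p.1 p.2].
  have [e o] := c j; have [x [y [ex ey h]]] := tiling_edge_lat Htiling base e.
  by exists (x, y); split=> //; split=> //; rewrite -ex -ey.
have [p pP] := boolp.choice ex; exists (fun j => (p j).1), (fun j => (p j).2).
have L0 := lat_inj Htiling base.
split=> [|j]; last by have [<- <- _] := pP j.
split=> j; first by have [] := pP j.
have [e1 e2 _] := pP j; have [e3 e4 _] := pP (j + 1).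
by move: (st j); rewrite e1 e2 e3 e4 => -[[/L0 -> ne]|[/L0 -> ne]]; [left|right];
  split=> // e; apply: ne; rewrite e.
Qed.

Variables w b : int -> Z2.
Hypothesis path_wb : crossing_path w b.
Hypothesis col : forall j, L (lat (w j)) = false /\ L (lat (b j)) = true.

Definition color_class (k : bool) := on_path (if k then b else w).

Lemma color_vertE k v : gvert (color_graph d L k) v <-> exists x, v = lat x /\ color_class k x.
Proof.
have [c _] := path_wb.
split=> [[_ [/(traj_verticesE Htiling base)[j [x [y [-> h o]]]] Lk]]|[x [-> [j ->]]]].
  exists x; split=> //; exists j; have [hw hb] := col j.
  case: (crosses_uniq Htiling base (conj h o) (c j)) => -[? _]; subst x.
    by rewrite hw in Lk; rewrite -Lk.
  by rewrite hb in Lk; rewrite -Lk.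
split; first exact: (tiling_vertex_lat Htiling base).
have [hw hb] := col j; have [h o] := c j.
split; last by case: (k).
apply/(traj_verticesE Htiling base); exists j; case: (k); last by exists (w j), (b j).
by exists (b j), (w j); split=> //; [apply: hexadj_sym | apply: open_segmentC].
Qed.

Lemma color_adjE k x y : gadj (color_graph d L k) (lat x) (lat y) = induced_hex (color_class k) x y.
Proof.
have L0 := lat_inj Htiling base.
rewrite /= /induced_hex -andbA; congr [&& _, _ & _].
- apply/asboolP/idP => [e|h]; last exact: (lat_edge Htiling base h).
  by have [x' [y' [/L0 -> /L0 -> h]]] := tiling_edge_lat Htiling base e.
- apply: asbool_equiv_eq; split=> [h|h].
    have [|x' [/L0 -> ]//] := (color_vertE k (lat x)).1.
    by split=> //; exact: (tiling_vertex_lat Htiling base).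
  by have [|_ ] := (color_vertE k (lat x)).2; first by exists x.
- apply: asbool_equiv_eq; split=> [h|h].
    have [|x' [/L0 -> ]//] := (color_vertE k (lat y)).1.
    by split=> //; exact: (tiling_vertex_lat Htiling base).
  by have [|_ ] := (color_vertE k (lat y)).2; first by exists y.
Qed.

Lemma color_adj_vert k u v : gadj (color_graph d L k) u v -> gvert (color_graph d L k) v.
Proof.
move=> /and3P[/asboolP e _ /asboolP h]; split=> //.
by have [x [y [_ -> _]]] := tiling_edge_lat Htiling base e; apply: (tiling_vertex_lat Htiling base).
Qed.

Lemma color_connected k : connected_graph (color_graph d L k).
Proof.
have [z lp] := crossing_lattice_path Htiling base path_wb.
apply: (transfer_connected (lat_inj Htiling base) (color_vertE k) (color_adjE k)).
  exact: color_adj_vert.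
by case: k; [exact: path_connected_b lp | exact: path_connected_w lp].
Qed.

Lemma color_treeE k : is_tree (color_graph d L k) <-> forall c, ~ graph_cycle (color_graph d L k) c.
Proof.
split=> [[]//|h]; split=> //; last exact: color_connected.
by exists (lat ((if k then b else w) 0)); apply/color_vertE; exists ((if k then b else w) 0); split=> //; exists 0.
Qed.

Lemma color_graph_trichotomy :
  [/\ is_tree (color_graph d L false) \/ is_tree (color_graph d L true),
      forall k : bool, is_tree (color_graph d L k) ->
        (periodic d <-> has_unique_cycle (color_graph d L (~~ k))) &
      ~ periodic d <->
        (is_tree (color_graph d L false) /\ is_tree (color_graph d L true))].
Proof.
have L0 := lat_inj Htiling base.
have [perC aperC sameC] := crossing_dichotomy Htiling base r_gt0 frames w_gt0 path_wb.
have perE := crossing_path_periodic Htiling base r_gt0 frames path_wb.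
have classE k : color_class k = on_path b \/ color_class k = on_path w by case: k; [left|right].
have tocyc k c := @transfer_cycle _ lat _ (color_graph d L k) L0 (color_adjE k) c.
have ofcyc k c := @cycle_transfer _ lat _ (color_graph d L k) L0 (color_vertE k) (color_adjE k)
  (@color_adj_vert k) c.
(* Cycles of both colors would have the same edges, hence a common vertex, against disjointness. *)
have excl k c c' : graph_cycle (color_graph d L k) c -> graph_cycle (color_graph d L (~~ k)) c' -> False.
  move=> /ofcyc[x [_ hx]] /ofcyc[y [_ hy]].
  have e := sameC _ _ _ _ (classE _) (classE _) hx hy.
  have dis := crossing_path_disjoint Htiling base r_gt0 frames path_wb.
  have inP P s u : hex_cycle P s -> u \in s -> P u.
    by move=> [_ /andP[cy _]] /(next_cycle cy) /andP[/andP[_ /asboolP]].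
  have [sx /andP[cx ux]] := hx; case: x => [|u x] // in hx sx cx ux e *.
  have eu : cycle_edge (u :: x) u (next (u :: x) u) by rewrite cycle_edge_next // mem_head.
  have uy : u \in y by apply: cycle_edge_in; move: eu; rewrite e; exact.
  have Pu := inP _ _ _ hx (mem_head _ _); have Pu' := inP _ _ _ hy uy.
  by case: (k) Pu Pu' => ? ?; apply: (dis u).
have perCyc : periodic d -> exists k c, graph_cycle (color_graph d L k) c.
  move=> /perE/perC[[c h]|[c h]]; [exists true|exists false]; exists (map lat c); exact/tocyc.
have cycPer k c : graph_cycle (color_graph d L k) c -> periodic d.
  move=> /ofcyc[x [_ hx]]; apply: contrapT => np.
  by apply: (aperC _ _ _ (classE k) hx) => /perE.
have uniqC k c : graph_cycle (color_graph d L k) c -> has_unique_cycle (color_graph d L k).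
  move=> gc; exists c; split=> // c' gc'.
  have [x [ec hx]] := ofcyc _ _ gc; have [y [ec' hy]] := ofcyc _ _ gc'.
  have e := sameC _ _ _ _ (classE _) (classE _) hx hy.
  have [sx /andP[_ ux]] := hx; have [_ /andP[_ uy]] := hy.
  have [n en] := eq_cycle_edge_rot ux uy sx e; exists n; rewrite ec ec'.
  by case: en => ->; [left|right]; rewrite ?map_rot ?map_rev.
split.
- case: (pselect (exists c, graph_cycle (color_graph d L false) c)) => [[c gc]|no].
    by right; apply/color_treeE => c' gc'; exact: (@excl false c c').
  by left; apply/color_treeE => c gc; apply: no; exists c.
- move=> k /color_treeE tk; split=> [/perCyc[k' [c gc]]|[c [gc _]]]; last exact: cycPer gc.
  have [e|ne] := eqVneq k' k; first by rewrite e in gc; case: (tk c).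
  by have <- : k' = ~~ k; [case: (k) (k') ne => -[] | exact: uniqC gc].
- split=> [np|[/color_treeE t0' /color_treeE t1'] /perCyc[[] [c gc]]].
  + by split; apply/color_treeE => c /cycPer.
  + exact: t1' gc.
  + exact: t0' gc.
Qed.
End Coloring.

Theorem theorem15 (R : realType) (I : Type) (tri : I -> triangle R)
    (Htiling : periodic_triangle_tiling tri) (d : trajectory tri) :
  (exists L, traj_coloring d L) /\
  (forall L : plane R -> bool, traj_coloring d L ->
    [/\ is_tree (color_graph d L false) \/ is_tree (color_graph d L true),
        forall k : bool, is_tree (color_graph d L k) ->
          (periodic d <-> has_unique_cycle (color_graph d L (~~ k))) &
        ~ periodic d <->
          (is_tree (color_graph d L false) /\ is_tree (color_graph d L true))]).
Proof.
have [A0 [A1 [A2 [r [t0 [w1 [w2 [eta [base r0 w0 fr0]]]]]]]]] := traj_frame_ex Htiling d.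
have frames := traj_frame_all Htiling base r0 fr0.
split; first exact: (coloring_ex Htiling base r0 frames).
move=> L /(coloring_path Htiling base)[w [b [p col]]].
exact: (color_graph_trichotomy Htiling base r0 frames w0 p col).
Qed.
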